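(* Consider the epigraph of the Belavkin-Staszewski relative entropy function $$\operatorname{epi}(D_{BS})=\{(X,Y,z)\in\mathbf{H}^n_+\times\mathbf{H}^n_+\times\mathbb{R}: X\ll Y\text{ and }D_{BS}(X|Y)\le z\},$$ which is a closed convex set. Then the function $(X,Y,z)\mapsto-\log(z-D_{BS}(X|Y))-\log\det X-\log\det Y$ defined on $\mathbf{H}^n_{++}\times\mathbf{H}^n_{++}\times\mathbb{R}$ is a $(2n+1)$-logarithmically homogeneous self-concordant barrier for $\operatorname{epi}(D_{BS})$. Moreover, this barrier is optimal in the sense that any self-concordant barrier for $\operatorname{epi}(D_{BS})$ has parameter at least $2n+1$.
   Context: $\mathbf{H}^n$ is the real vector space of $n\times n$ complex Hermitian matrices; $\mathbf{H}^n_+$ and $\mathbf{H}^n_{++}$ are the sets of positive semidefinite and positive definite ones. For positive semidefinite $X,Y$, $X\ll Y$ means $\ker(Y)\subset\ker(X)$. For $X,Y\in\mathbf{H}^n_{++}$, $D_{BS}(X|Y)=\operatorname{tr}(X\log(X^{1/2}Y^{-1}X^{1/2}))$ (matrix logarithm). For $X,Y\in\mathbf{H}^n_+$ with $X\ll Y$, it is extended by $D_{BS}(X|Y)=\lim_{\epsilon\downarrow0}D_{BS}(X+\epsilon I|Y+\epsilon I)$. For $f$ defined on a subset of a finite-dimensional real vector space $E$, $D^kf(x)[h]=\frac{d^k}{dt^k}f(x+th)|_{t=0}$. A convex function $f:E\to\mathbb{R}\cup\{+\infty\}$ is self-concordant if $\operatorname{dom}f=\{x:f(x)<+\infty\}$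 is open, its epigraph $\{(x,t)\in E\times\mathbb{R}:f(x)\le t\}$ is closed, and $f$ is $C^3$ on $\operatorname{dom}f$ with $|D^3f(x)[h]|\le2(D^2f(x)[h])^{3/2}$ for all $x\in\operatorname{dom}f$, $h\in E$. It is a self-concordant barrier for a closed convex set $Q$ if moreover $\operatorname{cl}(\operatorname{dom}f)=Q$; it has parameter $\nu$ (is a $\nu$-self-concordant barrier) if moreover $2Df(x)[h]-D^2f(x)[h]\le\nu$ for all $x\in\operatorname{dom}f$, $h\in E$. When $\operatorname{dom}f$ is a convex cone, $f$ is $\nu$-logarithmically homogeneous if $f(\tau x)=f(x)-\nu\log\tau$ for all $x\in\operatorname{dom}f$, $\tau>0$; a $\nu$-logarithmically homogeneous self-concordant barrier is automatically a $\nu$-self-concordant barrier. Convention: $-\log t=+\infty$ for $t\le0$, and the barrier function takes the value $+\infty$ when $X$ or $Y$ is not positive definite. *)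

(* Defs.v *)
From HB Require Import structures.
From mathcomp Require Import all_boot all_order all_algebra.
From mathcomp Require Import sesquilinear spectral.
From mathcomp Require Import all_classical all_reals all_analysis.
From mathcomp Require Import complex.

Set Implicit Arguments.
Unset Strict Implicit.
Unset Printing Implicit Defensive.

Import Order.TTheory GRing.Theory Num.Theory.
Import numFieldNormedType.Exports.

Local Open Scope classical_set_scope.
Local Open Scope ring_scope.
Local Open Scope complex_scope.
Local Open Scope sesquilinear_scope.

Record herm (R : realType) (n : nat) := Herm {
  hmx :> 'M[R[i]]_n;
  hmxP : hmx \is hermsymmx }.

HB.instance Definition _ (R : realType) (n : nat) := [isSub for @hmx R n].
HB.instance Definition _ (R : realType) (n : nat) :=
  [Choice of herm R n by <:].

Section HermSpace.
Context {R : realType} {n : nat}.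
Implicit Types (X Y : herm R n) (a : R).

Lemma hermsymmxE (A : 'M[R[i]]_n) : (A \is hermsymmx) = (A == A ^t*).
Proof. by rewrite is_hermitianmxE expr0 scale1r. Qed.

Fact herm0_subproof : (0 : 'M[R[i]]_n) \is hermsymmx.
Proof. by rewrite hermsymmxE trmx0 map_mx0. Qed.

Fact hermN_subproof X : - (X : 'M[R[i]]_n) \is hermsymmx.
Proof.
by rewrite hermsymmxE linearN map_mxN eqr_opp -hermsymmxE hmxP.
Qed.

Fact hermD_subproof X Y : (X : 'M[R[i]]_n) + Y \is hermsymmx.
Proof.
rewrite hermsymmxE linearD map_mxD.
have := hmxP X; have := hmxP Y.
by rewrite !hermsymmxE => /eqP <- /eqP <-.
Qed.

Fact conjC_real a : Num.conj (a%:C : R[i]) = a%:C.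
Proof. by apply/CrealP; rewrite complex_real. Qed.

Fact hermZ_subproof a X : a%:C *: (X : 'M[R[i]]_n) \is hermsymmx.
Proof.
have /matrixP HX : hmx X = (hmx X) ^t* by apply/eqP; rewrite -hermsymmxE hmxP.
rewrite hermsymmxE; apply/eqP/matrixP => i j.
by have := HX i j; rewrite !mxE rmorphM /= conjC_real => {1}->.
Qed.

Definition herm0 : herm R n := Herm herm0_subproof.
Definition hermN X : herm R n := Herm (hermN_subproof X).
Definition hermD X Y : herm R n := Herm (hermD_subproof X Y).
Definition hermZ a X : herm R n := Herm (hermZ_subproof a X).

Fact hermDA : associative hermD.
Proof. by move=> X Y Z; apply/val_inj; rewrite /= addrA. Qed.
Fact hermDC : commutative hermD.
Proof. by move=> X Y; apply/val_inj; rewrite /= addrC. Qed.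
Fact herm0D : left_id herm0 hermD.
Proof. by move=> X; apply/val_inj; rewrite /= add0r. Qed.
Fact hermND : left_inverse herm0 hermN hermD.
Proof. by move=> X; apply/val_inj; rewrite /= addNr. Qed.

HB.instance Definition _ :=
  GRing.isZmodule.Build (herm R n) hermDA hermDC herm0D hermND.

Fact hermZA a b X : hermZ a (hermZ b X) = hermZ (a * b) X.
Proof. by apply/val_inj; rewrite /= scalerA rmorphM. Qed.
Fact hermZ1 : left_id 1 hermZ.
Proof. by move=> X; apply/val_inj; rewrite /= scale1r. Qed.
Fact hermZDr : right_distributive hermZ +%R.
Proof. by move=> a X Y; apply/val_inj; rewrite /= scalerDr. Qed.
Fact hermZDl X : {morph hermZ^~ X : a b / a + b}.
Proof. by move=> a b; apply/val_inj; rewrite /= rmorphD scalerDl. Qed.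

HB.instance Definition _ :=
  GRing.Zmodule_isLmodule.Build R (herm R n) hermZA hermZ1 hermZDr hermZDl.

(* The choice of norm is immaterial: the space is finite-dimensional, and the
   norm is only used for its topology. *)
Definition herm_norm X : R :=
  `|map_mx (@complex.Re R) X| + `|map_mx (@complex.Im R) X|.

Fact ler_herm_normD X Y : herm_norm (X + Y) <= herm_norm X + herm_norm Y.
Proof.
rewrite /herm_norm addrACA; apply: lerD.
  have -> : map_mx (@complex.Re R) (X + Y) =
    map_mx (@complex.Re R) X + map_mx (@complex.Re R) Y.
    by apply/matrixP => i j; rewrite !mxE raddfD.
  exact: ler_normD.
have -> : map_mx (@complex.Im R) (X + Y) =
    map_mx (@complex.Im R) X + map_mx (@complex.Im R) Y.
  by apply/matrixP => i j; rewrite !mxE raddfD.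
exact: ler_normD.
Qed.

Fact herm_normZ a X : herm_norm (a *: X) = `|a| * herm_norm X.
Proof.
have EZ : map_mx (@complex.Re R) (a *: X) = a *: map_mx (@complex.Re R) X.
  by apply/matrixP => i j; rewrite !mxE /=; case: (X i j) => u v /=;
     rewrite mul0r subr0.
have EI : map_mx (@complex.Im R) (a *: X) = a *: map_mx (@complex.Im R) X.
  by apply/matrixP => i j; rewrite !mxE /=; case: (X i j) => u v /=;
     rewrite mul0r addr0.
by rewrite /herm_norm EZ EI !normrZ mulrDr.
Qed.

Fact herm_norm0_eq0 X : herm_norm X = 0 -> X = 0.
Proof.
move/eqP; rewrite /herm_norm paddr_eq0 ?normr_ge0 // => /andP[].
rewrite !normr_eq0 => /eqP/matrixP HR /eqP/matrixP HI.
apply/val_inj/matrixP => i j; have := HR i j; have := HI i j.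
rewrite !mxE /=; case: (X i j) => u v /= -> ->.
by [].
Qed.

HB.instance Definition _ := Lmodule_isNormed.Build R (herm R n)
  ler_herm_normD herm_normZ herm_norm0_eq0.

End HermSpace.

Section HermFun.
Context {R : realType} {n : nat}.
Implicit Types (A : 'M[R[i]]_n) (X Y : herm R n).

Definition psd X : Prop :=
  forall v : 'cV[R[i]]_n, 0 <= (v ^t* *m X *m v) 0 0.

Definition pd X : Prop :=
  forall v : 'cV[R[i]]_n, v != 0 -> 0 < (v ^t* *m X *m v) 0 0.

Definition ker_le X Y : Prop :=
  forall v : 'cV[R[i]]_n, hmx Y *m v = 0 -> hmx X *m v = 0.

(* Functional calculus: for [A] Hermitian, [A = invmx P *m diag_mx d *m P] with
   [P = spectralmx A] unitary and [d = spectral_diag A] real. The value does not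
   depend on the choice of the spectral decomposition. *)
Definition mxfun (f : R -> R) A : 'M[R[i]]_n :=
  invmx (spectralmx A)
    *m diag_mx (map_mx (fun z => (f (complex.Re z))%:C) (spectral_diag A))
    *m spectralmx A.

Definition mxsqrt := mxfun Num.sqrt.
Definition mxlog := mxfun (@ln R).

Fact herm1_subproof : (1%:M : 'M[R[i]]_n) \is hermsymmx.
Proof. by rewrite hermsymmxE trmx1 map_mx1. Qed.

Definition herm1 : herm R n := Herm herm1_subproof.

(* For positive definite arguments the trace and the determinants below are
   real, so that taking real parts only adjusts the type. *)
Definition DBS_pd X Y : R :=
  complex.Re (\tr (X *m mxlog (mxsqrt X *m invmx Y *m mxsqrt X))).

Definition DBS X Y : R :=
  if `[< pd X /\ pd Y >] then DBS_pd X Y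
  else lim (DBS_pd (X + e *: herm1) (Y + e *: herm1) @[e --> 0^'+]).

Definition logdet X : R := ln (complex.Re (\det X)).

End HermFun.

Section SelfConcordance.
Context {R : realType} {E : normedModType R}.
Implicit Types (f : E -> \bar R) (Q : set E) (nu : R).

Definition dom f : set E := [set x | (f x < +oo)%E].

Definition epigraph f : set (E * R^o) := [set p | (f p.1 <= (p.2 : R)%:E)%E].

Definition econvex_function f : Prop :=
  (forall x, f x != -oo%E) /\
  (forall (x y : E) (t : R), 0 <= t <= 1 ->
    (f (t *: x + (1 - t) *: y)%R <= t%:E * f x + (1 - t)%:E * f y)%E).

(* [g] is of class C^k on the open set [U]. Existence and continuity of all
   iterated directional derivatives is equivalent to the Fréchet version
   because this is only used for finite-dimensional [E]. *)
Fixpoint Ck (k : nat) (U : set E) (g : E -> R^o) : Prop :=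
  (forall x, U x -> {for x, continuous g}) /\
  (if k is k'.+1 then
     (forall x v, U x -> derivable g x v) /\
     (forall v, Ck k' U (fun x => 'D_v g x))
   else True).

(* [f] is real-valued on the open set [dom f], so that [fine] is only a type
   conversion near [t = 0]. *)
Definition Dk (k : nat) f (x h : E) : R :=
  derive1n k (fun t : R => fine (f (x + t *: h)) : R^o) 0.

Definition self_concordant f : Prop :=
  [/\ econvex_function f,
      open (dom f),
      closed (epigraph f),
      Ck 3 (dom f) (fun x => fine (f x)) &
      forall x h, dom f x -> `|Dk 3 f x h| <= 2 * (Dk 2 f x h) `^ (3 / 2)].

Definition sc_barrier Q f : Prop := self_concordant f /\ closure (dom f) = Q.

Definition nu_sc_barrier nu Q f : Prop :=
  sc_barrier Q f /\
  (forall x h, dom f x -> 2 * Dk 1 f x h - Dk 2 f x h <= nu).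

Definition convex_cone (K : set E) : Prop :=
  convex_set (K : set (convex_lmodType E)) /\
  (forall x (tau : R), K x -> 0 < tau -> K (tau *: x)).

Definition log_homogeneous nu f : Prop :=
  convex_cone (dom f) /\
  (forall x (tau : R), dom f x -> 0 < tau ->
    f (tau *: x) = (f x - (nu * ln tau)%:E)%E).

End SelfConcordance.

Section BelavkinStaszewski.
Variables (R : realType) (n : nat).

Definition epi_DBS : set (herm R n * herm R n * R^o) :=
  [set p | let: (X, Y, z) := p in
    [/\ psd X, psd Y, ker_le X Y & DBS X Y <= z]].

(* [lne] is the extended logarithm, equal to [-oo] on nonpositive reals. *)
Definition DBS_barrier (p : herm R n * herm R n * R^o) : \bar R :=
  let: (X, Y, z) := p in
  if `[< pd X /\ pd Y >]
  then (- lne (z - DBS X Y)%:E - (logdet X)%:E - (logdet Y)%:E)%E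
  else +oo%E.

End BelavkinStaszewski.

Arguments epi_DBS R n : clear implicits.
Arguments DBS_barrier R n p : clear implicits.

(* Main.v *)
Require Import Defs.
From HB Require Import structures.
From mathcomp Require Import all_boot all_order all_algebra.
From mathcomp Require Import sesquilinear spectral.
From mathcomp Require Import all_classical all_reals all_analysis.
From mathcomp Require Import complex ring lra.

Set Implicit Arguments.
Unset Strict Implicit.
Unset Printing Implicit Defensive.

Import Order.TTheory GRing.Theory Num.Theory.
Import numFieldNormedType.Exports.

Local Open Scope classical_set_scope.
Local Open Scope ring_scope.

(** Everything rests on one observation: along a line, each positive definite
    matrix that occurs can be diagonalized by a congruence together with its
    velocity, which leaves inequalities between scalars.

    An integral formula. If [X = S' S] and [Y = S' diag(mu) S] with [S']
    the adjoint of [S], then [D(X|Y)] is minus the sum of the [ln mu_k |s_k|^2],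
    where [s_k] are the rows of [S]. Since [mu - 1 - ln mu] is the integral over
    [0, 1] of [s (mu - 1)^2 / (1 + s (mu - 1))], this gives ([DBS_pdE])
    [D(X|Y) = tr X - tr Y + int_0^1 s tr(V W_s^-1 V) ds], with [V = Y - X] and
    [W_s = X + s V]. The right-hand side, called [phi], is free of matrix
    functions; smoothness follows by differentiation under the integral sign.

    Self-concordance. On the line [(X + t H, Y + t K)] the matrix [W_s] moves with
    velocity [w_s = H + s (K - H)]. Reducing [W_s] to the identity and [w_s] to
    [diag(l)] by one congruence turns the trace into a sum of functions
    [(a + b t)^2 / (1 + l t)], whose second and third derivatives at [0] are
    [2 u^2] and [- 6 l u^2] with [u = b - a l] ([kern_jet]). When
    [- rho X <= H <= rho X] and [- rho Y <= K <= rho Y], all the [l] are at most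
    [rho] in absolute value, so [D] is convex and its third derivative is at most
    [3 rho] times the second one. For [rho^2] one may take the second derivative of
    [- log det X - log det Y] ([logdet_jet]). What remains is the scalar inequality
    [sc_ineq].

    The epigraph. Let Q be the set of the [(X, Y, z)] with [X] and [Y] positive
    definite and [D(X|Y) < z] ([strict_epi]), which is the domain of the barrier.
    It is an open convex cone, and its closure is the epigraph ([epi_DBSE]). If
    [X << Y], then [a X <= Y] for some [a > 0]; the commuting pairs [(X, a X)] and
    [(0, Y - a X)], completed by explicit third components, are in the closure,
    hence so is their sum; then [D(X + eps I|Y + eps I)], which increases as [eps]
    decreases, stays bounded and converges.
    Conversely, a lower bound of [D(X|Y)] that only involves [<v, X v>] and
    [<v, Y v>] for one unit vector [v] ([phi_ge]) blows up near any pair for which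
    [Y v = 0] and [X v <> 0].

    Optimality. Let [F] be a barrier with parameter [nu]. Its slope at [x] towards
    any other point of its domain is at most [nu]; and if [p] is a recession
    direction such that [x - b p] is outside the domain, its slope along [p] is at
    most [- 1 / b]. Hence the sum of the [a_i / b_i] is at most [nu] as soon as
    [x] minus the sum of the [a_i p_i] is in the domain ([barrier_parameter_ge]).
    A barrier for the epigraph has the same domain Q, since two open convex sets
    with the same closure are equal. Apply this at
    [(I, I, c / d)] with the [2 n + 1] directions [(0, 0, 1)], [(0, E_ii, 0)] and
    [(E_ii, d E_ii, - ln d)]: the resulting lower bounds of [nu] tend to [2 n + 1]
    with [d] tending to [0] ([optimal_delta]). *)

(** * Functions of class C^k *)

Section CkTheory.
Context {R : realType} {E : normedModType R}.
Implicit Types (U : set E) (f g : E -> R^o).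

Lemma Ck_cont k U f : Ck k U f -> forall x, U x -> {for x, continuous f}.
Proof. by case: k => [|k] []. Qed.

Lemma Ck_derivable k U f : Ck k.+1 U f -> forall x v, U x -> derivable f x v.
Proof. by case=> _ []. Qed.

Lemma Ck_derive k U f : Ck k.+1 U f -> forall v, Ck k U (fun x => 'D_v f x).
Proof. by case=> _ []. Qed.

Lemma CkS k U f : Ck k.+1 U f -> Ck k U f.
Proof.
elim: k f => [|k IH] f [cf [df Df]]; first by split.
by split => //; split => // v; apply: IH.
Qed.

Lemma Ck_le j k U f : (j <= k)%N -> Ck k U f -> Ck j U f.
Proof.
move=> /subnKC <-; elim: (k - j)%N => [|m IH]; first by rewrite addn0.
by rewrite addnS => /CkS.
Qed.

Lemma Ck_sub k U V f : U `<=` V -> Ck k V f -> Ck k U f.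
Proof.
move=> UV; elim: k f => [|k IH] f [cf H]; first by split=> // x /UV; exact: cf.
case: H => df Df; split; first by move=> x /UV; exact: cf.
by split=> [x v /UV|v]; [exact: df|exact: IH (Df v)].
Qed.

Lemma near_eq_continuous f g x : {near x, f =1 g} ->
  {for x, continuous f} -> {for x, continuous g}.
Proof.
move=> nfg cf; rewrite /prop_for /continuous_at -(nbhs_singleton nfg).
exact: cvg_trans (near_eq_cvg nfg) cf.
Qed.

(** The formulas for derivatives below hold on [U] only; this is what allows
    them to be substituted for the derivatives inside [Ck]. *)
Lemma Ck_eq k U f g : open U -> (forall x, U x -> f x = g x) ->
  Ck k U f -> Ck k U g.
Proof.
move=> oU.
have near_of (h1 h2 : E -> R^o) x : (forall x, U x -> h1 x = h2 x) -> U x -> {near x, h1 =1 h2}.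
  by move=> h12 Ux; apply: filterS (open_nbhs_nbhs (conj oU Ux)) => y /h12.
elim: k f g => [|k IH] f g fg.
  case=> cf _; split=> // x Ux.
  exact: near_eq_continuous (near_of _ _ _ fg Ux) (cf _ Ux).
case=> cf [df Df]; split; last split.
- move=> x Ux; exact: near_eq_continuous (near_of _ _ _ fg Ux) (cf _ Ux).
- by move=> x v Ux; apply: (near_eq_derivable (near_of _ _ _ fg Ux)); exact: df.
- move=> v; apply: IH (Df v) => x Ux.
  exact: near_eq_derive (near_of _ _ _ fg Ux).
Qed.

Lemma Ck_cst k U (c : R) : open U -> Ck k U (fun=> c : R^o).
Proof.
move=> oU; elim: k c => [|k IH] c; first by split=> // x _; exact: cst_continuous.
split; first by move=> x _; exact: cst_continuous.
split; first by move=> x v _; exact: derivable_cst.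
by move=> v; apply: Ck_eq (IH 0) => // x _; rewrite derive_cst.
Qed.

Lemma CkD k U f g : open U -> Ck k U f -> Ck k U g ->
  Ck k U (fun x => f x + g x : R^o).
Proof.
move=> oU; elim: k f g => [|k IH] f g [cf Hf] [cg Hg].
  by split=> // x Ux; apply: continuousD; [exact: cf|exact: cg].
case: Hf => df Df; case: Hg => dg Dg; split.
  by move=> x Ux; apply: continuousD; [exact: cf|exact: cg].
split; first by move=> x v Ux; apply: derivableD; [exact: df|exact: dg].
move=> v; apply: Ck_eq (IH _ _ (Df v) (Dg v)) => // x Ux.
by rewrite [RHS]deriveD; [|exact: df|exact: dg].
Qed.

Lemma CkN k U f : open U -> Ck k U f -> Ck k U (fun x => - f x : R^o).
Proof.
move=> oU; elim: k f => [|k IH] f [cf Hf].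
  by split=> // x Ux; apply: continuousN; exact: cf.
case: Hf => df Df; split.
  by move=> x Ux; apply: continuousN; exact: cf.
split; first by move=> x v Ux; apply: derivableN; exact: df.
move=> v; apply: Ck_eq (IH _ (Df v)) => // x Ux.
by rewrite [RHS]deriveN; [|exact: df].
Qed.

Lemma CkM k U f g : open U -> Ck k U f -> Ck k U g ->
  Ck k U (fun x => f x * g x : R^o).
Proof.
move=> oU; elim: k f g => [|k IH] f g Cf Cg.
  split=> // x Ux; apply: continuousM; [exact: Ck_cont Cf _ Ux|exact: Ck_cont Cg _ Ux].
split; first by move=> x Ux; apply: continuousM; [exact: Ck_cont Cf _ Ux|exact: Ck_cont Cg _ Ux].
have df := Ck_derivable Cf; have dg := Ck_derivable Cg.
split; first by move=> x v Ux; apply: derivableM; [exact: df|exact: dg].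
move=> v.
have Df := Ck_derive Cf v; have Dg := Ck_derive Cg v.
have h := CkD oU (IH _ _ (CkS Cf) Dg) (IH _ _ (CkS Cg) Df).
apply: Ck_eq h => // x Ux.
by rewrite [RHS]deriveM; [|exact: df|exact: dg].
Qed.

Lemma CkV k U f : open U -> (forall x, U x -> f x != 0) -> Ck k U f ->
  Ck k U (fun x => (f x)^-1 : R^o).
Proof.
move=> oU f0; elim: k => [|k IH] Cf.
  by split=> // x Ux; apply: cvgV; [exact: f0|exact: Ck_cont Cf _ Ux].
split; first by move=> x Ux; apply: cvgV; [exact: f0|exact: Ck_cont Cf _ Ux].
have df := Ck_derivable Cf.
split; first by move=> x v Ux; apply: derivableV; [exact: f0|exact: df].
move=> v.
have Df := Ck_derive Cf v; have Vf := IH (CkS Cf).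
have h := CkN oU (CkM oU (CkM oU Vf Vf) Df).
apply: Ck_eq h => // x Ux.
rewrite [RHS]deriveV; [|exact: f0|exact: df].
by rewrite -mulNr expr2 invfM.
Qed.

Lemma is_derive_line f x v : derivable f x v ->
  is_derive (0 : R) 1 (fun h : R => f (h *: v + x)) ('D_v f x).
Proof.
move=> dfx; split; first exact: (derivable1P _ _ _).1.
rewrite /derive; congr (lim _); apply/funext => A /=.
suff -> : (fun h : R => h^-1 *: (f ((h *: (1:R) + 0) *: v + x) - f (0 *: v + x)))
  = (fun h : R => h^-1 *: (f (h *: v + x) - f x)) by [].
by apply/funext => h; rewrite addr0 scale0r add0r [h *: _]mulr1.
Qed.

Lemma is_derive_lnf f x v : derivable f x v -> 0 < f x ->
  is_derive x v (fun y => ln (f y) : R^o) ((f x)^-1 * 'D_v f x).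
Proof.
move=> dfx fx0.
have h1 := is_derive_line dfx.
have e0 : f (0 *: v + x) = f x by rewrite scale0r add0r.
have h2 : is_derive (f (0 *: v + x)) 1 (@ln R) (f x)^-1.
  by rewrite e0; exact: is_derive1_ln.
have [d1 e1] := h1; have [d2 e2] := h2.
have dd : derivable (fun h : R => ln (f (h *: v + x))) 0 1.
  apply/derivable1_diffP.
  by apply: (@differentiable_comp _ _ _ _ (fun h : R => f (h *: v + x)) (@ln R));
    apply/derivable1_diffP.
split; first exact/derivable1P.
have e := derive1_comp d1 d2; rewrite !derive1E e1 e2 in e.
transitivity ('D_1 (fun h : R => ln (f (h *: v + x))) 0); last exact: e.
rewrite /derive; congr (lim _); apply/funext => A /=.
set u := fun h : R => _; set w := fun h : R => _.
suff -> : u = w by [].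
by apply/funext => h; rewrite /u /w /= addr0 scale0r add0r [h *: 1]mulr1.
Qed.

Lemma Ck_ln k U f : open U -> (forall x, U x -> 0 < f x) -> Ck k U f ->
  Ck k U (fun x => ln (f x) : R^o).
Proof.
move=> oU f0 Cf.
have cl : forall x, U x -> {for x, continuous (fun x => ln (f x) : R^o)}.
  move=> x Ux; apply: (@continuous_comp _ _ _ f (@ln R)).
    exact: Ck_cont Cf _ Ux.
  by apply: continuous_ln; exact: f0.
case: k Cf => [|k] Cf; first by split.
split => //; split.
  by move=> x v Ux; have [] := @is_derive_lnf f x v (Ck_derivable Cf Ux) (f0 _ Ux).
move=> v.
have h : Ck k U (fun x => (f x)^-1 * 'D_v f x : R^o).
  apply: CkM => //; last exact: Ck_derive Cf v.
  by apply: CkV; [|by move=> x /f0 /lt0r_neq0|exact: CkS].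
apply: Ck_eq h => // x Ux.
by have [_ ->] := @is_derive_lnf f x v (Ck_derivable Cf Ux) (f0 _ Ux).
Qed.

Lemma is_derive_lin f x h : (forall (a : R) x y, f (a *: x + y) = a * f x + f y) ->
  is_derive x h f (f h).
Proof.
move=> lf.
have H : (fun a : R => a^-1 *: ((f \o shift x) (a *: h) - f x)) @ 0^' --> f h.
  apply: cvg_near_cst; near=> a => /=.
  rewrite lf addrK [LHS]mulrA mulVf ?mul1r//; near: a; exact: nbhs_dnbhs_neq.
split; first by apply/cvg_ex; exists (f h).
exact: cvg_lim H.
Unshelve. all: by end_near. Qed.

Lemma Ck_lin k U f : open U -> continuous f -> (forall (a : R) x y, f (a *: x + y) = a * f x + f y) ->
  Ck k U f.
Proof.
move=> oU cf lf.
case: k => [|k]; first by split=> // x _; exact: cf.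
split; first by move=> x _; exact: cf.
have isd x v : is_derive x v f (f v) by exact: is_derive_lin.
split; first by move=> x v _; have [] := isd x v.
move=> v; apply: Ck_eq (Ck_cst k (f v) oU) => // x _.
by have [_ ->] := isd x v.
Qed.

End CkTheory.

(** * Integrals over [0, 1] depending on a parameter *)

Section Int01.
Context {R : realType}.
Local Notation mu := (@lebesgue_measure R).
Implicit Types g h : R -> R.

Definition int01 g : R := (\int[mu]_(s in `[0%R, 1%R]) g s)%R.

Definition cont01 g := {within `[0%R, 1%R] : set R, continuous g}.

Lemma cont01_integrable g : cont01 g -> mu.-integrable `[0%R, 1%R] (EFin \o g).
Proof.
move=> cg; apply: continuous_compact_integrable => //; exact: segment_compact.
Qed.

Lemma cont01_at g : (forall s, 0 <= s <= 1 -> {for s, continuous g}) -> cont01 g.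
Proof.
move=> H; apply: continuous_in_subspaceT => s; rewrite inE/= in_itv/=.
exact: H.
Qed.

Lemma int01_ext g h : (forall s, 0 <= s <= 1 -> g s = h s) -> int01 g = int01 h.
Proof.
by move=> gh; apply: eq_Rintegral => s; rewrite inE/= in_itv/= => /gh.
Qed.

Lemma int01_cst c : int01 (fun=> c) = c.
Proof.
rewrite /int01 Rintegral_cst//= lebesgue_measure_itv/= lte_fin ltr01.
by rewrite oppr0 adde0/= mulr1.
Qed.

Lemma int01D g h : cont01 g -> cont01 h ->
  int01 (fun s => g s + h s) = int01 g + int01 h.
Proof. by move=> cg ch; apply: RintegralD => //; exact: cont01_integrable. Qed.

Lemma int01B g h : cont01 g -> cont01 h ->
  int01 (fun s => g s - h s) = int01 g - int01 h.
Proof. by move=> cg ch; apply: RintegralB => //; exact: cont01_integrable. Qed.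

Lemma int01Z c g : cont01 g -> int01 (fun s => c * g s) = c * int01 g.
Proof. by move=> cg; apply: RintegralZl => //; exact: cont01_integrable. Qed.

Lemma le_int01 g h : cont01 g -> cont01 h ->
  (forall s, 0 <= s <= 1 -> g s <= h s) -> int01 g <= int01 h.
Proof.
move=> cg ch gh; apply: le_Rintegral => [//|||s].
- exact: cont01_integrable.
- exact: cont01_integrable.
- by rewrite /= in_itv/=; exact: gh.
Qed.

Lemma int01_ge0 g : (forall s, 0 <= s <= 1 -> 0 <= g s) -> 0 <= int01 g.
Proof. by move=> H; apply: Rintegral_ge0 => s; rewrite /= in_itv/= => /H. Qed.

Lemma cont01_cst c : cont01 (fun=> c).
Proof. by apply: cont01_at => s _; exact: cst_continuous. Qed.

Lemma int01_norm_leZ c g h : cont01 g -> cont01 h ->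
  (forall s, 0 <= s <= 1 -> `|g s| <= c * h s) -> `|int01 g| <= c * int01 h.
Proof.
move=> cg ch gh; rewrite -int01Z//.
have cch : cont01 (fun s => c * h s) by move=> s; apply: cvgM; [exact: cvg_cst|exact: ch].
rewrite ler_norml; apply/andP; split.
  rewrite -mulN1r -int01Z//; apply: le_int01 => //.
    by move=> s; apply: cvgM; [exact: cvg_cst|exact: cch].
  by move=> s /gh; rewrite ler_norml mulN1r => /andP[].
by apply: le_int01 => // s /gh; rewrite ler_norml => /andP[].
Qed.

Lemma int01_norm_le g M : cont01 g ->
  (forall s, 0 <= s <= 1 -> `|g s| <= M) -> `|int01 g| <= M.
Proof.
move=> cg gM; rewrite -[leRHS]mulr1 -(int01_cst 1).
by apply: int01_norm_leZ => // [|s /gM]; [exact: cont01_cst|rewrite mulr1].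
Qed.

Lemma int01_sum (I : Type) (r : seq I) (F : I -> R -> R) :
  (forall i, cont01 (F i)) ->
  cont01 (fun s => \sum_(i <- r) F i s) /\
  int01 (fun s => \sum_(i <- r) F i s) = \sum_(i <- r) int01 (F i).
Proof.
move=> cF; elim: r => [|i r [IH1 IH2]].
  split; first by under eq_fun do rewrite big_nil; exact: cont01_cst.
  by under [in LHS]int01_ext do rewrite big_nil; rewrite big_nil int01_cst.
split.
  under eq_fun do rewrite big_cons; move=> s; apply: continuousD; [exact: cF|exact: IH1].
transitivity (int01 (fun s => F i s + \sum_(j <- r) F j s)).
  by apply: int01_ext => s _; rewrite big_cons.
by rewrite int01D// IH2 big_cons.
Qed.

End Int01.

Section Along.
Context {R : realType} {E : normedModType R}.

Lemma is_derive_along (F : E -> R^o) (x v : E) (t : R) :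
  derivable F (t *: v + x) v ->
  is_derive t 1 (fun t : R => F (t *: v + x)) ('D_v F (t *: v + x)).
Proof.
move=> /is_derive_line [d e].
have eqf : (fun h : R => h^-1 *: (((fun h : R => F (h *: v + (t *: v + x))) \o shift 0) (h *: 1) - (fun h : R => F (h *: v + (t *: v + x))) 0))
  = (fun h : R => h^-1 *: (((fun t : R => F (t *: v + x)) \o shift t) (h *: 1) - F (t *: v + x))).
  apply/funext => h /=; congr (_ *: (F _ - F _)).
    by rewrite addr0 addrA -scalerDl.
  by rewrite scale0r add0r.
split; first by rewrite /derivable -eqf.
by rewrite -e /derive -eqf.
Qed.

End Along.

Section IntParam.
Context {R : realType} {E : normedModType R}.
Implicit Types (U : set E) (W : set (R^o * E)) (g : R^o * E -> R^o).

(** Tube lemma: compactness of [0, 1] makes a local property uniform in the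
    integration variable. *)
Lemma near_slab (P : R^o * E -> Prop) (p0 : E) :
  (forall s : R^o, 0 <= s <= 1 -> \forall q \near (s, p0), P q) ->
  \forall p \near p0, forall s : R^o, 0 <= s <= 1 -> P (s, p).
Proof.
move=> HP.
have /compact_near_coveringP/near_covering_withinP := @segment_compact R 0 1.
move=> /(_ E (nbhs p0) (fun p s => P (s, p)) _) H.
apply: filterS (H _) => [p Hp s s01|s /=].
  by apply: Hp; rewrite /= in_itv.
rewrite in_itv/= => /HP [[A B] /= [As Bp] AB].
by exists (A, B) => //= -[s' p'] /= [? ?] _; apply: AB.
Qed.

Lemma near_slab_lt g (p0 : E) e : 0 < e ->
  (forall s : R^o, 0 <= s <= 1 -> {for (s, p0), continuous g}) ->
  \forall p \near p0, forall s : R^o, 0 <= s <= 1 -> `|g (s, p) - g (s, p0)| < e.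
Proof.
move=> e0 cg; have e20 : 0 < e / 2 by rewrite divr_gt0.
have := @near_slab (fun q => `|g q - g (q.1, p0)| < e) p0; apply => s s01.
have h1 : \forall q \near (s, p0), `|g (s, p0) - g q| < e / 2.
  by have /cvgrPdist_lt/(_ _ e20) := cg s s01.
have h2 : \forall q \near (s, p0), `|g (s, p0) - g (q.1, p0)| < e / 2.
  have c : {for (s, p0), continuous (fun q : R^o * E => g (q.1, p0))}.
    apply: (@continuous_comp _ _ _ (fun q : R^o * E => (q.1, p0)) g).
      exact: (cvg_pair cvg_fst (cvg_cst p0)).
    exact: cg.
  by have /cvgrPdist_lt/(_ _ e20) := c.
near=> q.
have -> : g q - g (q.1, p0) = (g (s, p0) - g (q.1, p0)) - (g (s, p0) - g q) by ring.
rewrite (le_lt_trans (ler_normB _ _))// [e]splitr ltrD//; near: q; [exact: h2|exact: h1].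
Unshelve. all: by end_near. Qed.

Lemma cont01_slice g (p : E) :
  (forall s : R^o, 0 <= s <= 1 -> {for (s, p), continuous g}) ->
  cont01 (fun s => g (s, p)).
Proof.
move=> cg; apply: cont01_at => s s01.
apply: (@continuous_comp _ _ _ (fun s : R^o => (s, p)) g); last exact: cg.
exact: (cvg_pair cvg_id (cvg_cst p)).
Qed.

Lemma int01_continuous g (p0 : E) :
  (\forall p \near p0, forall s : R^o, 0 <= s <= 1 -> {for (s, p), continuous g}) ->
  {for p0, continuous (fun p => int01 (fun s => g (s, p)) : R^o)}.
Proof.
move=> cg; apply/cvgrPdist_le => e e0.
have cg0 := nbhs_singleton cg.
have H := near_slab_lt e0 cg0.
near=> p.
have cp : forall s : R^o, 0 <= s <= 1 -> {for (s, p), continuous g} by near: p.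
have Hp : forall s : R^o, 0 <= s <= 1 -> `|g (s, p) - g (s, p0)| < e by near: p.
have c1 := cont01_slice cg0; have c2 := cont01_slice cp.
rewrite -int01B//; apply: int01_norm_le.
  by move=> s; apply: continuousB; [exact: c1|exact: c2].
by move=> s /Hp/ltW; rewrite distrC.
Unshelve. all: by end_near. Qed.

(** The increment [h] may have either sign, as it does in a difference
    quotient. *)
Lemma MVT_sym (f df : R -> R) (r h : R) :
  (forall t : R, `|t| < r -> is_derive t 1 f (df t)) -> `|h| < r ->
  exists2 c, `|c| < r & f h - f 0 = df c * h.
Proof.
move=> fd hr; have r0 : 0 < r := le_lt_trans (normr_ge0 _) hr.
have cf t : `|t| < r -> {for t, continuous f}.
  move=> tr; have [d _] := fd _ tr.
  exact/differentiable_continuous/derivable1_diffP.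
have key a b : a < b -> `|a| < r -> `|b| < r ->
    exists2 c, `|c| < r & f b - f a = df c * (b - a).
  rewrite !ltr_norml => ab /andP[a1 a2] /andP[b1 b2].
  have inr x : x \in `[a, b]%R -> `|x| < r.
    rewrite in_itv/= ltr_norml => /andP[ax xb].
    by rewrite (lt_le_trans a1)// (le_lt_trans xb).
  have [||c cab ->] := @MVT _ f df a b ab.
  - by move=> x xab; apply/fd/inr; exact: subset_itv_oo_cc.
  - by apply: continuous_in_subspaceT => x; rewrite inE => /inr/cf.
  - by exists c => //; apply/inr; exact: subset_itv_oo_cc.
have n0 : `|0 : R| < r by rewrite normr0.
have [h0|h0|->] := ltgtP h 0.
- have [c cr E1] := key _ _ h0 hr n0.
  by exists c => //; rewrite -opprB E1 sub0r mulrN opprK.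
- have [c cr ->] := key _ _ h0 n0 hr.
  by exists c => //; rewrite subr0.
- by exists 0; rewrite ?normr0// subrr mulr0.
Qed.

(** The integrand being [C^1] around the compact slab, the mean value theorem
    makes its difference quotients converge uniformly in [s]. *)
Lemma int01_is_derive g (p0 v : E) :
  (\forall p \near p0, forall s : R^o, 0 <= s <= 1 -> {for (s, p), continuous g}) ->
  (\forall p \near p0, forall s : R^o, 0 <= s <= 1 -> derivable g (s, p) (0, v)) ->
  (forall s : R^o, 0 <= s <= 1 -> {for (s, p0), continuous (fun q => 'D_(0 : R^o, v) g q)}) ->
  is_derive p0 v (fun p => int01 (fun s => g (s, p)) : R^o)
    (int01 (fun s => 'D_(0 : R^o, v) g (s, p0))).
Proof.
move=> cg dg cdg.
set G := fun p => int01 _; set D := int01 _.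
suff H : (fun h : R => h^-1 *: ((G \o shift p0) (h *: v) - G p0)) @ 0^' --> (D : R^o).
  split; first by apply/cvg_ex; exists D.
  exact: cvg_lim H.
apply/cvgrPdist_le => e e0.
have cg0 := nbhs_singleton cg.
have H := near_slab_lt e0 cdg.
have cline : (fun h : R^o => h *: v + p0) @ (0:R^o) --> p0.
  rewrite -[X in _ --> X]add0r -[X in _ --> X + _](scale0r v).
  apply: cvgD; last exact: cvg_cst.
  by apply: cvgZl; exact: cvg_id.
pose Q p := [/\ (forall s : R^o, 0 <= s <= 1 -> {for (s, p), continuous g}),
  (forall s : R^o, 0 <= s <= 1 -> derivable g (s, p) (0, v)) &
  (forall s : R^o, 0 <= s <= 1 -> `|'D_(0 : R^o, v) g (s, p) - 'D_(0 : R^o, v) g (s, p0)| < e)].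
have nQ : \forall p \near p0, Q p by near=> p; split; near: p.
have /nbhs_ballP [r /= r0 Hr] := cline _ nQ.
have {}Hr h : `|h| < r -> Q (h *: v + p0).
  by move=> hr; apply: Hr; rewrite /ball/= sub0r normrN.
near=> h.
have hr : `|h| < r.
  near: h; apply: nbhs_dnbhs; apply/nbhs_ballP; exists r => //= y.
  by rewrite /ball/= sub0r normrN.
have h0 : h != 0 by near: h; exact: nbhs_dnbhs_neq.
have [c1 d1 _] := Hr _ hr.
rewrite /= /G /D -int01B; [|exact: cont01_slice..].
have cc : cont01 (fun s => g (s, h *: v + p0) - g (s, p0)).
  by move=> s; apply: continuousB; exact: cont01_slice.
have -> : h^-1 *: int01 (fun s => g (s, h *: v + p0) - g (s, p0)) =
  int01 (fun s => h^-1 * (g (s, h *: v + p0) - g (s, p0))) by rewrite int01Z.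
have cD : cont01 (fun s => 'D_(0:R^o,v) g (s, p0)) by exact: (@cont01_slice (fun q => 'D_(0:R^o,v) g q)).
have cc' : cont01 (fun s => h^-1 * (g (s, h *: v + p0) - g (s, p0))).
  by move=> s; apply: cvgM; [exact: cvg_cst|exact: cc].
rewrite -int01B//; apply: int01_norm_le.
  by move=> s; apply: cvgB; [exact: cD|exact: cc'].
move=> s s01.
pose f t := g (s, t *: v + p0).
have isd (t : R) : `|t| < r -> is_derive t 1 f ('D_(0:R^o,v) g (s, t *: v + p0)).
  move=> /Hr [_ /(_ s s01) dd _].
  have et : t *: ((0 : R^o), v) + (s, p0) = (s, t *: v + p0) :> (R^o * E)%type.
    by congr pair; rewrite /= scaler0 add0r.
  have := @is_derive_along _ _ g (s, p0) (0, v) t; rewrite et => /(_ dd).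
  congr is_derive; apply/funext => u; rewrite /f; congr g.
  by congr pair; rewrite /= scaler0 add0r.
have [c cr] := MVT_sym isd hr.
rewrite /f scale0r add0r => ->.
rewrite mulrCA mulVf// mulr1 distrC.
by have [_ _ /(_ s s01)/ltW] := Hr _ cr.
Unshelve. all: by end_near. Qed.

Lemma Ck_int01 k U W g : open U ->
  (forall (s : R^o) p, 0 <= s <= 1 -> U p -> W (s, p)) ->
  Ck k W g -> Ck k U (fun p => int01 (fun s => g (s, p)) : R^o).
Proof.
move=> oU UW; elim: k g => [|k IH] g Cg.
  split=> // p Up; apply: int01_continuous.
  have := open_nbhs_nbhs (conj oU Up); apply: filterS => q Uq s s01.
  by apply: (Ck_cont Cg); exact: UW.
have cU p : U p -> \forall q \near p, forall s : R^o, 0 <= s <= 1 -> {for (s, q), continuous g}.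
  move=> Up; have := open_nbhs_nbhs (conj oU Up); apply: filterS => q Uq s s01.
  by apply: (Ck_cont Cg); exact: UW.
have isd p v : U p -> is_derive p v (fun p => int01 (fun s => g (s, p)) : R^o)
    (int01 (fun s => 'D_(0 : R^o, v) g (s, p))).
  move=> Up; apply: int01_is_derive; first exact: cU.
    have := open_nbhs_nbhs (conj oU Up); apply: filterS => q Uq s s01.
    by apply: (Ck_derivable Cg); exact: UW.
  by move=> s s01; apply: (Ck_cont (Ck_derive Cg (0, v))); exact: UW.
split; first by move=> p /cU; exact: int01_continuous.
split; first by move=> p v Up; have [] := isd p v Up.
move=> v; apply: Ck_eq (IH _ (Ck_derive Cg (0, v))) => // p Up.
by have [_ ->] := isd p v Up.
Qed.

Lemma derive_int01 k U W g v p : open U ->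
  (forall (s : R^o) p, 0 <= s <= 1 -> U p -> W (s, p)) ->
  Ck k.+1 W g -> U p ->
  'D_v (fun p => int01 (fun s => g (s, p)) : R^o) p =
  int01 (fun s => 'D_(0 : R^o, v) g (s, p)).
Proof.
move=> oU UW Cg Up.
suff [] : is_derive p v (fun p => int01 (fun s => g (s, p)) : R^o)
    (int01 (fun s => 'D_(0 : R^o, v) g (s, p))) by [].
have nU := open_nbhs_nbhs (conj oU Up).
apply: int01_is_derive.
- by apply: filterS nU => q Uq s s01; apply: (Ck_cont Cg); exact: UW.
- by apply: filterS nU => q Uq s s01; apply: (Ck_derivable Cg); exact: UW.
- by move=> s s01; apply: (Ck_cont (Ck_derive Cg (0, v))); exact: UW.
Qed.

End IntParam.

(** * Iterated directional derivatives *)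

Section IterD.
Context {R : realType} {E : normedModType R}.
Implicit Types (U : set E) (F G : E -> R^o).

(** [Dk] differentiates a function of one variable at one point, which cannot
    be iterated; here a derivative is again a function on [E], so that each one can
    be computed from the previous one. See [DkE] for the link. *)
Definition iterD k (h : E) F : E -> R^o := iter k (fun G x => 'D_h G x) F.

Lemma iterDS k h F x : iterD k.+1 h F x = 'D_h (iterD k h F) x.
Proof. by []. Qed.

Lemma Ck_iterD k j U h F : Ck (k + j) U F -> Ck j U (iterD k h F).
Proof.
elim: k j => [|k IH] j // Cf.
by apply: (Ck_derive (IH j.+1 _)); rewrite addnS.
Qed.

Lemma iterD_eq k h U F G : open U -> (forall x, U x -> F x = G x) ->
  forall x, U x -> iterD k h F x = iterD k h G x.
Proof.
move=> oU; elim: k => [|k IH] FG x Ux; first exact: FG.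
rewrite !iterDS; apply: near_eq_derive.
by apply: filterS (open_nbhs_nbhs (conj oU Ux)) => y; exact: IH FG y.
Qed.

Lemma line_near U x h : open U -> U x -> \forall t \near (0 : R), U (x + t *: h).
Proof.
move=> oU Ux.
have c : (fun t : R^o => x + t *: h) @ (0:R^o) --> x.
  rewrite -[X in _ --> X]addr0 -[X in _ --> _ + X](scale0r h).
  by apply: cvgD; [exact: cvg_cst|apply: cvgZl; exact: cvg_id].
exact: (c _ (open_nbhs_nbhs (conj oU Ux))).
Qed.

Lemma is_derive_line_at F x h t : derivable F (x + t *: h) h ->
  is_derive (t : R) 1 (fun t : R => F (x + t *: h)) ('D_h F (x + t *: h)).
Proof.
move=> dF; have := @is_derive_along R E F x h t; rewrite addrC => /(_ dF).
by under eq_fun do rewrite addrC.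
Qed.

Lemma derive1n_line k m U F x h t : open U -> Ck m U F -> (k <= m)%N ->
  U (x + t *: h) ->
  derive1n k (fun t : R => F (x + t *: h) : R^o) t = iterD k h F (x + t *: h).
Proof.
move=> oU; elim: k t => [|k IH] t CF km Ut //.
rewrite derive1nS derive1E iterDS.
have CF' : Ck 1 U (iterD k h F).
  by apply: Ck_iterD; apply: Ck_le CF; rewrite addn1.
have [_ <-] := is_derive_line_at (Ck_derivable CF' (v := h) Ut).
apply: near_eq_derive.
have := line_near h oU Ut; rewrite (near_shift t) /= sub0r => H.
near=> u.
have Uu : U (x + u *: h).
  have -> : x + u *: h = x + t *: h + (u - t) *: h by rewrite scalerBl -addrA subrKC.
  by near: u.
exact: IH CF (ltnW km) Uu.
Unshelve. all: by end_near. Qed.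

Lemma DkE k m (f : E -> \bar R) x h : open (dom f) ->
  Ck m (dom f) (fun x => fine (f x) : R^o) -> (k <= m)%N -> dom f x ->
  Dk k f x h = iterD k h (fun x => fine (f x)) x.
Proof.
move=> od Cf km dx.
have e0 : x + (0 : R) *: h = x by rewrite scale0r addr0.
have := @derive1n_line k m _ _ x h 0 od Cf km.
by rewrite e0; exact.
Qed.

End IterD.

Section IterDInt.
Context {R : realType} {E : normedModType R}.

Lemma iterD_int01 k m (U : set E) (W : set (R^o * E)) (g : R^o * E -> R^o) v p : open U -> 
  (forall (s : R^o) p, 0 <= s <= 1 -> U p -> W (s, p)) ->
  Ck m W g -> (k <= m)%N -> U p ->
  iterD k v (fun p => int01 (fun s => g (s, p)) : R^o) p =
  int01 (fun s => iterD k ((0 : R^o), v) g (s, p)).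
Proof.
move=> oU UW; elim: k p => [|k IH] p Cg km Up //.
rewrite iterDS; pose gk := iterD k ((0 : R^o), v) g.
transitivity ('D_v (fun p => int01 (fun s => gk (s, p)) : R^o) p).
  apply: near_eq_derive.
  by apply: filterS (open_nbhs_nbhs (conj oU Up)) => q Uq; apply: IH Uq => //; exact: ltnW.
apply: (@derive_int01 _ _ 0%N U W) => //.
by apply: Ck_iterD; apply: Ck_le Cg; rewrite addn1.
Qed.

End IterDInt.

(** * Logarithmic barriers *)

Section IsD.
Context {R : realType} {E : normedModType R}.
Implicit Types (f g : E -> R^o).

Lemma isD_add f g x v (a b : R) : is_derive x v f a -> is_derive x v g b ->
  is_derive x v (fun y => f y + g y : R^o) (a + b).
Proof. by move=> df dg; exact: is_deriveD. Qed.

Lemma isD_opp f x v (a : R) : is_derive x v f a ->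
  is_derive x v (fun y => - f y : R^o) (- a).
Proof. by move=> df; exact: is_deriveN. Qed.

Lemma isD_mul f g x v (a b : R) : is_derive x v f a -> is_derive x v g b ->
  is_derive x v (fun y => f y * g y : R^o) (f x * b + g x * a).
Proof. by move=> df dg; exact: is_deriveM. Qed.

Lemma isD_inv f x v (a : R) : f x != 0 -> is_derive x v f a ->
  is_derive x v (fun y => (f y)^-1 : R^o) (- (f x)^-1 * (f x)^-1 * a).
Proof.
move=> f0 [df <-]; split; first exact: derivableV.
by rewrite deriveV// expr2 invfM -mulNr.
Qed.

Lemma isD_ln f x v (a : R) : 0 < f x -> is_derive x v f a ->
  is_derive x v (fun y => ln (f y) : R^o) ((f x)^-1 * a).
Proof. by move=> f0 [df <-]; exact: is_derive_lnf. Qed.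

Lemma isD_cst (c : R) x v : is_derive x v (fun _ : E => c : R^o) 0.
Proof. exact: is_derive_cst. Qed.

Lemma isD_eq f x v (a b : R) : is_derive x v f a -> a = b -> is_derive x v f b.
Proof. by move=> df <-. Qed.

Lemma derive_near U f g x v (a : R) : open U -> U x ->
  (forall y, U y -> f y = g y) -> is_derive x v g a -> 'D_v f x = a.
Proof.
move=> oU Ux fg [_ <-]; apply: near_eq_derive.
by apply: filterS (open_nbhs_nbhs (conj oU Ux)) => y /fg.
Qed.

End IsD.

Section Barrier.
Context {R : realType} {E : normedModType R}.
Variables (U : set E) (z B : E -> R^o) (h : E).
Hypotheses (oU : open U) (Cz : Ck 3 U z) (CB : Ck 3 U B) (z0 : forall x, U x -> 0 < z x).

Let F x : R^o := - ln (z x) + B x.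

Let isz k x : (k < 3)%N -> U x -> is_derive x h (iterD k h z) (iterD k.+1 h z x).
Proof.
move=> k3 Ux; apply: derivableP; apply: (@Ck_derivable _ _ 0 U) => //.
by apply: (@Ck_iterD _ _ k 1); apply: Ck_le Cz; rewrite addn1.
Qed.

Let isB k x : (k < 3)%N -> U x -> is_derive x h (iterD k h B) (iterD k.+1 h B x).
Proof.
move=> k3 Ux; apply: derivableP; apply: (@Ck_derivable _ _ 0 U) => //.
by apply: (@Ck_iterD _ _ k 1); apply: Ck_le CB; rewrite addn1.
Qed.

Lemma iterD1_lnbarrier x : U x ->
  iterD 1 h F x = - ((z x)^-1 * iterD 1 h z x) + iterD 1 h B x.
Proof.
move=> Ux; rewrite iterDS; apply: (derive_near oU Ux) => //.
apply: isD_add; last exact: (isB (k := 0)).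
by apply: isD_opp; apply: isD_ln; [exact: z0|exact: (isz (k := 0))].
Qed.

Lemma iterD2_lnbarrier x : U x ->
  iterD 2 h F x = ((z x)^-1 * iterD 1 h z x) ^+ 2 - (z x)^-1 * iterD 2 h z x
    + iterD 2 h B x.
Proof.
move=> Ux; rewrite iterDS; apply: (derive_near oU Ux iterD1_lnbarrier) => //.
apply: isD_add; last exact: (isB (k := 1)).
have iszV : is_derive x h (fun y => (z y)^-1 : R^o) (- (z x)^-1 * (z x)^-1 * iterD 1 h z x).
  by apply: isD_inv; [rewrite gt_eqF ?z0|exact: (isz (k := 0))].
have m := isD_opp (isD_mul iszV (isz (k := 1) isT Ux)).
by apply: isD_eq m _; ring.
Qed.

Lemma iterD3_lnbarrier x : U x ->
  iterD 3 h F x = - ((z x)^-1 * iterD 3 h z x)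
    + 3 * ((z x)^-1 * iterD 1 h z x) * ((z x)^-1 * iterD 2 h z x)
    - 2 * ((z x)^-1 * iterD 1 h z x) ^+ 3
    + iterD 3 h B x.
Proof.
move=> Ux; rewrite iterDS; apply: (derive_near oU Ux iterD2_lnbarrier) => //.
have iszV : is_derive x h (fun y => (z y)^-1 : R^o) (- (z x)^-1 * (z x)^-1 * iterD 1 h z x).
  by apply: isD_inv; [rewrite gt_eqF ?z0|exact: (isz (k := 0))].
apply: isD_add; last exact: (isB (k := 2)).
have m1 := isD_mul iszV (isz (k := 1) isT Ux).
have m2 := isD_mul iszV (isz (k := 2) isT Ux).
have m := isD_add (isD_mul m1 m1) (isD_opp m2).
under eq_fun do rewrite expr2.
apply: isD_eq m _.
move: (z x)^-1 (iterD 1 h z x) (iterD 2 h z x) (iterD 3 h z x) (iterD 3 h B x).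
by move=> i z1 z2 z3 b3; ring.
Qed.

End Barrier.

Section Ineq.
Context {R : realType}.

Lemma powR32 (x : R) : 0 <= x -> x `^ (3 / 2) = Num.sqrt x ^+ 3.
Proof.
move=> x0; rewrite -powR12_sqrt// -powR_mulrn ?powR_ge0// -powRrM.
by congr (_ `^ _); rewrite mulrC.
Qed.

(** In the application, [a] is the relative slope of [z - D], and [b], [r ^+ 2]
    are the shares of [D] and of the determinants in the second derivative of the
    barrier. With [y ^+ 2 = a ^+ 2 + b + r ^+ 2] and [p = `|a|], the right-hand side
    exceeds [3 r b + 3 p b + 2 p ^+ 3 + 2 r ^+ 3] by
    [(y - (p + r)) ^+ 2 * (2 y + (p + r))]. *)
Lemma sc_ineq (a b r c3 b3 : R) : 0 <= b -> 0 <= r ->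
  `|c3| <= 3 * r * b -> `|b3| <= 2 * r ^+ 3 ->
  `|- c3 - 3 * a * b - 2 * a ^+ 3 + b3| <= 2 * (a ^+ 2 + b + r ^+ 2) `^ (3 / 2).
Proof.
move=> b0 r0 hc hb.
rewrite powR32; last by rewrite !addr_ge0// sqr_ge0.
set y := Num.sqrt _; have y0 : 0 <= y by exact: sqrtr_ge0.
have y2 : y ^+ 2 = a ^+ 2 + b + r ^+ 2 by rewrite sqr_sqrtr// !addr_ge0// sqr_ge0.
have p0 := normr_ge0 a.
set p := `|a| in p0 *.
have p2 : p ^+ 2 = a ^+ 2 by rewrite real_normK ?num_real.
have h1 : `|- c3 - 3 * a * b - 2 * a ^+ 3 + b3| <= 3 * r * b + 3 * p * b + 2 * p ^+ 3 + 2 * r ^+ 3.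
  apply: (le_trans (ler_normD _ _)); apply: lerD hb.
  apply: (le_trans (ler_normB _ _)); apply: lerD; last by rewrite normrM normrX ger0_norm.
  apply: (le_trans (ler_normB _ _)); apply: lerD; first by rewrite normrN.
  by rewrite !normrM (ger0_norm b0) (ger0_norm (_ : 0 <= 3)).
apply: (le_trans h1).
have bE : b = y ^+ 2 - p ^+ 2 - r ^+ 2 by rewrite y2 p2; ring.
rewrite -subr_ge0.
have -> : 2 * y ^+ 3 - (3 * r * b + 3 * p * b + 2 * p ^+ 3 + 2 * r ^+ 3) =
  (y - (p + r)) ^+ 2 * (2 * y + (p + r)) by rewrite bE; ring.
by rewrite mulr_ge0 ?sqr_ge0// !addr_ge0// mulr_ge0.
Qed.

End Ineq.

(** * Second and third derivatives at 0 *)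

Section Jets.
Context {R : realType}.
Implicit Types (f g : R^o -> R^o).

(** The first derivative at [0] is not recorded: self-concordance only involves
    the second and the third one, which are compared with each other. *)
Definition hasjet f (d2 d3 : R) := exists f1 f2 f3 : R^o -> R^o,
  [/\ \forall t \near (0 : R^o), is_derive (t : R^o) 1 f (f1 t),
      \forall t \near (0 : R^o), is_derive (t : R^o) 1 f1 (f2 t),
      \forall t \near (0 : R^o), is_derive (t : R^o) 1 f2 (f3 t),
      f2 0 = d2 & f3 0 = d3].

Lemma hasjet_derive1n f d2 d3 : hasjet f d2 d3 ->
  derive1n 2 f 0 = d2 /\ derive1n 3 f 0 = d3.
Proof.
case=> f1 [f2 [f3 [h1 h2 h3 <- <-]]].
have e1 : \forall t \near (0:R^o), derive1 f t = f1 t.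
  by apply: filterS h1 => t [_]; rewrite derive1E.
have e2 : \forall t \near (0:R^o), derive1n 2 f t = f2 t.
  near=> t; rewrite derive1nS derive1n1 derive1E.
  have nt : {near t, derive1 f =1 f1} by near: t; exact: near_join e1.
  rewrite (near_eq_derive _ nt).
  suff [] : is_derive (t : R^o) 1 f1 (f2 t) by [].
  by near: t.
split; first exact: nbhs_singleton e2.
rewrite derive1nS derive1E (near_eq_derive _ e2).
by have [] := nbhs_singleton h3.
Unshelve. all: by end_near. Qed.

Lemma hasjet_near f g d2 d3 : (\forall t \near (0:R^o), f t = g t) ->
  hasjet f d2 d3 -> hasjet g d2 d3.
Proof.
move=> fg [f1 [f2 [f3 [h1 h2 h3 e2 e3]]]]; exists f1, f2, f3; split => //.
near=> t; apply: (@near_eq_is_derive _ _ _ f).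
  by near: t; exact: near_join fg.
by near: t.
Unshelve. all: by end_near. Qed.

Lemma hasjet_cst c : hasjet (fun=> c) 0 0.
Proof.
exists (fun=> 0), (fun=> 0), (fun=> 0).
by split => //; near=> t; exact: is_derive_cst.
Unshelve. all: by end_near. Qed.

Lemma hasjetD f g a2 a3 b2 b3 : hasjet f a2 a3 -> hasjet g b2 b3 ->
  hasjet (fun t => f t + g t) (a2 + b2) (a3 + b3).
Proof.
move=> [f1 [f2 [f3 [h1 h2 h3 <- <-]]]] [g1 [g2 [g3 [k1 k2 k3 <- <-]]]].
exists (fun t => f1 t + g1 t), (fun t => f2 t + g2 t), (fun t => f3 t + g3 t).
by split => //; near=> t; apply: isD_add; near: t.
Unshelve. all: by end_near. Qed.

Lemma hasjetZ (c : R) f a2 a3 : hasjet f a2 a3 ->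
  hasjet (fun t => c * f t) (c * a2) (c * a3).
Proof.
move=> [f1 [f2 [f3 [h1 h2 h3 <- <-]]]].
have Z (g : R^o -> R^o) (t a : R) : is_derive (t : R^o) 1 g a -> is_derive (t : R^o) 1 (fun t : R^o => c * g t : R^o) (c * a).
  by move=> ga; apply: isD_eq (isD_mul (isD_cst c t 1) ga) _; rewrite mulr0 addr0.
exists (fun t => c * f1 t), (fun t => c * f2 t), (fun t => c * f3 t).
by split => //; near=> t; apply: Z; near: t.
Unshelve. all: by end_near. Qed.

Lemma hasjet_sum (I : Type) (r : seq I) (f : I -> R^o -> R^o) (d2 d3 : I -> R) :
  (forall i, hasjet (f i) (d2 i) (d3 i)) ->
  hasjet (fun t => \sum_(i <- r) f i t) (\sum_(i <- r) d2 i) (\sum_(i <- r) d3 i).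
Proof.
move=> H; elim: r => [|i r IH].
  by rewrite !big_nil; under eq_fun do rewrite big_nil; exact: hasjet_cst.
by rewrite !big_cons; under eq_fun do rewrite big_cons; exact: hasjetD.
Qed.

Lemma near_1addM (l : R) : \forall t \near (0 : R^o), 0 < 1 + l * t.
Proof.
have c : (fun t : R^o => 1 + l * t : R^o) @ (0:R^o) --> (1 + l * 0 : R^o).
  by apply: cvgD; [exact: cvg_cst|apply: cvgMr; exact: cvg_id].
have := cvgr_gt _ c; apply; by rewrite mulr0 addr0.
Qed.

Lemma is_derive_affine (a b t : R) : is_derive (t : R^o) 1 (fun t : R^o => a + b * t : R^o) b.
Proof.
have m : is_derive (t : R^o) 1 (fun t : R^o => a + b * t : R^o) (0 + (b * 1 + t * 0)).
  by apply: isD_add; apply: isD_mul.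
by apply: isD_eq m _; ring.
Qed.

(** Put [d = (1 + l t)^-1] and [w = (a + b t) d]. Then [w' = (b - a l) d ^+ 2],
    and the function is [(a + b t) w], with derivative [2 b w - l w ^+ 2]; each
    further derivative is a constant times a power of [d]. *)
Lemma hasjet_ratio (a b l : R) :
  hasjet (fun t => (a + b * t) ^+ 2 * (1 + l * t)^-1)
    (2 * (b - a * l) ^+ 2) (- 6 * l * (b - a * l) ^+ 2).
Proof.
pose d (t : R^o) : R^o := (1 + l * t)^-1.
pose w (t : R^o) : R^o := (a + b * t) * d t.
have n0 := near_1addM l.
have dd : \forall t \near (0 : R^o), is_derive (t : R^o) 1 d (- l * (d t * d t)).
  apply: filterS n0 => t t0.
  have := isD_inv _ (is_derive_affine 1 l t) => /(_ (lt0r_neq0 t0)) dt.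
  by apply: isD_eq dt _; rewrite /d; ring.
have dw : \forall t \near (0 : R^o), is_derive (t : R^o) 1 w ((b - a * l) * (d t * d t)).
  near=> t.
  have t0 : 1 + l * t != 0 by rewrite gt_eqF//; near: t.
  have dt : is_derive (t : R^o) 1 d (- l * (d t * d t)) by near: t.
  by apply: isD_eq (isD_mul (is_derive_affine a b t) dt) _; rewrite /d; field.
exists (fun t => (2 * b) * w t + (- l) * (w t * w t)),
  (fun t => (2 * (b - a * l) ^+ 2) * (d t * (d t * d t))),
  (fun t => (- 6 * l * (b - a * l) ^+ 2) * ((d t * d t) * (d t * d t))); split.
- near=> t.
  have t0 : 1 + l * t != 0 by rewrite gt_eqF//; near: t.
  have dt : is_derive (t : R^o) 1 d (- l * (d t * d t)) by near: t.
  have m := isD_mul (isD_mul (is_derive_affine a b t) (is_derive_affine a b t)) dt.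
  by under eq_fun do rewrite expr2; apply: isD_eq m _; rewrite /w /d; field.
- near=> t.
  have t0 : 1 + l * t != 0 by rewrite gt_eqF//; near: t.
  have wt : is_derive (t : R^o) 1 w ((b - a * l) * (d t * d t)) by near: t.
  have m := isD_add (isD_mul (isD_cst (2 * b) _ _) wt) (isD_mul (isD_cst (- l) _ _) (isD_mul wt wt)).
  by apply: isD_eq m _; rewrite /w /d; field.
- near=> t.
  have t0 : 1 + l * t != 0 by rewrite gt_eqF//; near: t.
  have dt : is_derive (t : R^o) 1 d (- l * (d t * d t)) by near: t.
  have m := isD_mul (isD_cst (2 * (b - a * l) ^+ 2) _ _) (isD_mul dt (isD_mul dt dt)).
  by apply: isD_eq m _; rewrite /d; field.
- by rewrite /d mulr0 addr0 invr1 !mulr1.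
- by rewrite /d mulr0 addr0 invr1 !mulr1.
Unshelve. all: by end_near. Qed.

Lemma hasjet_ln (l : R) :
  hasjet (fun t => - ln (1 + l * t)) (l ^+ 2) (- 2 * l ^+ 3).
Proof.
pose d (t : R^o) : R^o := (1 + l * t)^-1.
have n0 := near_1addM l.
have dd : \forall t \near (0 : R^o), is_derive (t : R^o) 1 d (- l * (d t * d t)).
  apply: filterS n0 => t t0.
  have := isD_inv _ (is_derive_affine 1 l t) => /(_ (lt0r_neq0 t0)) dt.
  by apply: isD_eq dt _; rewrite /d; ring.
exists (fun t => (- l) * d t), (fun t => l ^+ 2 * (d t * d t)),
  (fun t => (- 2 * l ^+ 3) * (d t * (d t * d t))); split.
- apply: filterS n0 => t t0.
  have m := @isD_ln _ _ (fun t : R^o => 1 + l * t : R^o) _ _ _ t0 (is_derive_affine 1 l t).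
  by apply: isD_eq (isD_opp m) _; rewrite /d; ring.
- near=> t.
  have dt : is_derive (t : R^o) 1 d (- l * (d t * d t)) by near: t.
  by apply: isD_eq (isD_mul (isD_cst (- l) _ _) dt) _; ring.
- near=> t.
  have dt : is_derive (t : R^o) 1 d (- l * (d t * d t)) by near: t.
  by apply: isD_eq (isD_mul (isD_cst (l ^+ 2) _ _) (isD_mul dt dt)) _; ring.
- by rewrite /d mulr0 addr0 invr1 !mulr1.
- by rewrite /d mulr0 addr0 invr1 !mulr1.
Unshelve. all: by end_near. Qed.

End Jets.

(** * Directional derivatives of sums and linear maps; convexity *)

Section IterDMore.
Context {R : realType} {E : normedModType R}.
Implicit Types (U : set E) (F G : E -> R^o).

Lemma iterDD k U F G h x : open U -> Ck k U F -> Ck k U G -> U x ->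
  iterD k h (fun y => F y + G y : R^o) x = iterD k h F x + iterD k h G x.
Proof.
move=> oU; elim: k x => [|k IH] x CF CG Ux //.
rewrite !iterDS.
apply: (derive_near (g := fun y => iterD k h F y + iterD k h G y) oU Ux).
  by move=> y Uy; apply: IH => //; exact: CkS.
have dk (L : E -> R^o) : Ck k.+1 U L -> is_derive x h (iterD k h L) ('D_h (iterD k h L) x).
  move=> CL; apply: derivableP; apply: (@Ck_derivable _ _ 0 U) => //.
  by apply: (@Ck_iterD _ _ k 1); rewrite addn1.
by apply: isD_add; exact: dk.
Qed.

Lemma iterDN k U F h x : open U -> Ck k U F -> U x ->
  iterD k h (fun y => - F y : R^o) x = - iterD k h F x.
Proof.
move=> oU; elim: k x => [|k IH] x CF Ux //.
rewrite !iterDS.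
apply: (derive_near (g := fun y => - iterD k h F y) oU Ux).
  by move=> y Uy; apply: IH => //; exact: CkS.
apply: isD_opp; apply: derivableP; apply: (@Ck_derivable _ _ 0 U) => //.
by apply: (@Ck_iterD _ _ k 1); rewrite addn1.
Qed.

Lemma iterD_lin k F h x : (forall (a : R) x y, F (a *: x + y) = a * F x + F y) ->
  iterD k.+2 h F x = 0.
Proof.
move=> lF; have e1 : iterD 1 h F = fun=> F h.
  by apply/funext => y; rewrite iterDS; have [_] := is_derive_lin y h lF.
elim: k x => [|k IH] x; rewrite iterDS.
  by rewrite e1; have [_ ->] := isD_cst (F h) x h.
have -> : iterD k.+2 h F = fun=> 0 by apply/funext => y; exact: IH.
by have [_ ->] := isD_cst (0 : R) x h.
Qed.

Lemma iterD_derive1n k m U F x h : open U -> Ck m U F -> (k <= m)%N -> U x ->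
  iterD k h F x = derive1n k (fun t : R => F (x + t *: h) : R^o) 0.
Proof.
move=> oU CF km Ux; have e0 : x + (0 : R) *: h = x by rewrite scale0r addr0.
by have := @derive1n_line R E k m U F x h 0 oU CF km; rewrite e0 => ->.
Qed.

(** Derivatives on [E] are obtained from an explicit formula along one line. *)
Lemma iterD_hasjet U F x h (d2 d3 : R) : open U -> Ck 3 U F -> U x ->
  hasjet (fun t : R => F (x + t *: h)) d2 d3 ->
  iterD 2 h F x = d2 /\ iterD 3 h F x = d3.
Proof.
move=> oU CF Ux /hasjet_derive1n [<- <-].
by split; apply: (@iterD_derive1n _ 3 U).
Qed.

Lemma convex_of_iterD2 U F : open U -> Ck 2 U F ->
  (forall x h, U x -> 0 <= iterD 2 h F x) ->
  forall x y (t : R), 0 <= t <= 1 ->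
  (forall s : R, 0 <= s <= 1 -> U (x + s *: (y - x))) ->
  F (x + t *: (y - x)) <= (1 - t) * F x + t * F y.
Proof.
move=> oU CF F2 x y t t01 seg; set h := y - x.
pose f (s : R) : R^o := F (x + s *: h).
have d0 s : U (x + s *: h) -> is_derive (s : R) 1 f (iterD 1 h F (x + s *: h)).
  by move=> Us; apply: is_derive_line_at; apply: Ck_derivable CF _ _ Us.
have C1 : Ck 1 U (iterD 1 h F) by exact: (@Ck_iterD _ _ 1 1).
have d1 s : U (x + s *: h) -> is_derive (s : R) 1 (fun s : R => iterD 1 h F (x + s *: h)) (iterD 2 h F (x + s *: h)).
  by move=> Us; apply: is_derive_line_at; apply: Ck_derivable C1 _ _ Us.
have Dnear s : U (x + s *: h) -> {near s, (fun s : R => iterD 1 h F (x + s *: h)) =1 'D_1 f}.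
  move=> Us; have := line_near h oU Us; rewrite (near_shift (s : R^o)) /= sub0r => H.
  near=> u; have Uu : U (x + u *: h).
    have -> : x + u *: h = x + s *: h + (u - s) *: h by rewrite scalerBl -addrA subrKC.
    by near: u.
  by have [_ ->] := d0 u Uu.
have cf s : 0 <= s <= 1 -> {for s, continuous f}.
  by move=> /seg/d0 [d _]; exact/differentiable_continuous/derivable1_diffP.
have f0 : f 0 = F x by rewrite /f scale0r addr0.
have f1 : f 1 = F y by rewrite /f scale1r /h subrKC.
have /andP[t0 t1] := t01.
have t'0 : 0 <= 1 - t by rewrite subr_ge0.
have t'1 : 1 - t <= 1 by rewrite lerBlDr lerDl.
have in01 s : s \in `]0, 1[ -> 0 <= s <= 1 by rewrite in_itv/= => /andP[/ltW -> /ltW ->].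
have := @second_derivative_convex R f 0 1 _ _ _ _ _ (Itv01 t'0 t'1) ler01.
rewrite !convRE /= /unstable.onem subKr mulr0 add0r mulr1.
rewrite f0 f1; apply.
- move=> s /andP[s0 s1]; have s01 : 0 <= s <= 1 by rewrite !ltW.
  have Us := seg s s01; rewrite -(near_eq_derive _ (Dnear s Us)).
  by have [_ ->] := d1 s Us; exact: F2.
- have c1 : {for 1, continuous f} by apply: cf; rewrite lexx ler01.
  by rewrite -f1; exact: cvg_at_left_filter c1.
- have c0 : {for 0, continuous f} by apply: cf; rewrite lexx ler01.
  by rewrite -f0; exact: cvg_at_right_filter c0.
- by move=> s /in01 s01; have [] := d0 s (seg s s01).
- move=> s /in01 s01; apply: near_eq_derivable (Dnear s (seg s s01)) _.
  by have [] := d1 s (seg s s01).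
Unshelve. all: by end_near. Qed.

End IterDMore.

(** * Differential inequalities along a ray *)

Section OneD.
Context {R : realType}.
Implicit Types (u v w k : R^o -> R^o) (T : R).

Local Notation isd t f a := (is_derive (t : R^o) 1 (f : R^o -> R^o) a).

Lemma derive_ge0_le v (dv : R -> R) T : 0 <= T ->
  (forall t : R, 0 <= t <= T -> isd t v (dv t)) ->
  (forall t : R, 0 <= t <= T -> 0 <= dv t) -> v 0 <= v T.
Proof.
move=> T0 dvt dv0.
have [||c] := @MVT_segment R v dv 0 T T0.
- by move=> t; rewrite in_itv/= => /andP[/ltW t0 /ltW tT]; apply: dvt; rewrite t0.
- apply: continuous_in_subspaceT => t; rewrite inE/= in_itv/= => tT.
  have [d _] := dvt t tT.
  exact/differentiable_continuous/derivable1_diffP.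
- rewrite in_itv/= => cT E; rewrite -subr_ge0 E mulr_ge0 ?dv0// subr_ge0//.
Qed.

(** [u] and [w] are the first two derivatives of a barrier in some direction,
    which may be rescaled by any [a]. The best choice is [a = u / w]; large values of
    [a] rule out [w < 0], and also [w = 0] with [u != 0]. *)
Lemma nu_quad (u w nu : R) : (forall a : R, 2 * (a * u) - a ^+ 2 * w <= nu) ->
  [/\ 0 <= w, 0 <= nu & u ^+ 2 <= nu * w].
Proof.
move=> H; have nu0 : 0 <= nu by have := H 0; rewrite mul0r mulr0 expr0n mul0r subr0.
have w0 : 0 <= w.
  rewrite leNgt; apply/negP => w0.
  pose a := (nu + 1) / - w + 1.
  have a1 : 1 <= a by rewrite lerDr divr_ge0 ?oppr_ge0 ?ltW// ltr_wpDl.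
  have a0 : 0 < a by rewrite (lt_le_trans ltr01).
  have key : nu < a ^+ 2 * - w.
    apply: (@lt_le_trans _ _ (a * - w)).
      rewrite /a mulrDl divfK ?oppr_eq0 ?lt_eqF// mul1r ltr_wpDr ?oppr_ge0 ?ltW//.
      by rewrite ltrDl.
    by rewrite expr2 -mulrA ler_peMl// mulr_ge0 ?oppr_ge0 ?ltW.
  have := H a; have := H (- a); rewrite sqrrN => h1 h2.
  have : (2 * (a * u) - a ^+ 2 * w) + (2 * (- a * u) - a ^+ 2 * w) <= nu + nu by exact: lerD.
  have -> : (2 * (a * u) - a ^+ 2 * w) + (2 * (- a * u) - a ^+ 2 * w) = a ^+ 2 * - w + a ^+ 2 * - w by ring.
  by rewrite leNgt ltrD.
split => //; have [w00|wn0] := eqVneq w 0.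
  rewrite w00 mulr0; have [->|u0] := eqVneq u 0; first by rewrite expr0n.
  have := H ((nu + 1) / u); rewrite w00 mulr0 subr0 divfK// => h.
  have : nu < 2 * (nu + 1).
    by rewrite mulrDr mulr1 mulr_natl mulr2n -addrA ltrDl ltr_wpDl.
  by rewrite ltNge h.
have wp : 0 < w by rewrite lt_neqAle eq_sym wn0.
have := H (u / w); have -> : 2 * (u / w * u) - (u / w) ^+ 2 * w = u ^+ 2 / w by field.
by rewrite ler_pdivrMr.
Qed.

(** The inequality says [u' >= u ^+ 2 / nu], so that [1 / u + t / nu] does not increase
    while [u] is positive: a positive slope blows up by the time [nu / u 0]. *)
Lemma riccati_bound u w nu T : 0 <= T ->
  (forall t : R, 0 <= t <= T -> isd t u (w t)) ->
  (forall t : R, 0 <= t <= T -> [/\ 0 <= w t, 0 <= nu & u t ^+ 2 <= nu * w t]) ->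
  u 0 * T <= nu.
Proof.
move=> T0 du H; have T00 : 0 <= (0 : R) <= T by rewrite lexx T0.
have [_ nu0 _] := H 0 T00.
have [b0|b0] := leP (u 0) 0; first by rewrite (le_trans _ nu0)// mulr_le0_ge0.
have u0 t : 0 <= t <= T -> u 0 <= u t.
  move=> /andP[t0 tT]; apply: (@derive_ge0_le u w t t0) => s /andP[s0 st].
    by apply: du; rewrite s0 (le_trans st).
  by have [] := H s; rewrite ?s0 ?(le_trans st).
have up t : 0 <= t <= T -> 0 < u t by move=> /u0; exact: lt_le_trans.
have nup : 0 < nu.
  rewrite lt_neqAle nu0 andbT; apply/eqP => nu00.
  have [_ _] := H 0 T00; rewrite -nu00 mul0r.
  by rewrite leNgt exprn_gt0.
have h := @derive_ge0_le (fun t : R^o => - (u t)^-1 + (0 + - nu^-1 * t))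
  (fun t => - (- (u t)^-1 * (u t)^-1 * w t) + - nu^-1) T T0.
have {}h : - (u 0)^-1 + (0 + - nu^-1 * 0) <= - (u T)^-1 + (0 + - nu^-1 * T).
  apply: h => t tT.
    apply: isD_add; last exact: is_derive_affine.
    by apply: isD_opp; apply: isD_inv; [rewrite gt_eqF// up|exact: du].
  have [_ _ uw] := H t tT; have upt := up t tT.
  have -> : - (- (u t)^-1 * (u t)^-1 * w t) + - nu^-1 = (u t ^+ 2)^-1 * (nu^-1) * (nu * w t - u t ^+ 2).
    by field; rewrite !gt_eqF.
  by rewrite mulr_ge0 ?subr_ge0// mulr_ge0// invr_ge0 ?sqr_ge0.
have TT : 0 <= T <= T by rewrite lexx T0.
have uT : 0 < (u T)^-1 by rewrite invr_gt0 up.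
have TnuT : T / nu <= (u 0)^-1.
  rewrite -subr_ge0 (le_trans (ltW uT))//.
  by move: h; rewrite -subr_ge0 => h; rewrite -subr_ge0; move: h; congr (0 <= _); ring.
by move: TnuT; rewrite ler_pdivrMr// ler_pdivlMl.
Qed.

(** A positive slope would blow up in finite time by [riccati_bound], whereas
    here the whole ray is available. *)
Lemma ray_nonpos u w nu :
  (forall t : R, 0 <= t -> isd t u (w t)) ->
  (forall t : R, 0 <= t -> [/\ 0 <= w t, 0 <= nu & u t ^+ 2 <= nu * w t]) ->
  forall t : R, 0 <= t -> u t <= 0.
Proof.
move=> du H t t0; rewrite leNgt; apply/negP => ut.
have [_ nu0 _] := H t t0.
pose T := (nu + 1) / u t.
have T0 : 0 <= T by rewrite divr_ge0 ?ltW// ltr_wpDl.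
have sh s : 0 <= s -> 0 <= s + t by move=> s0; rewrite addr_ge0.
suff : u (0 + t) * T <= nu.
  by rewrite add0r mulrC divfK ?gt_eqF// leNgt ltrDl ltr01.
apply: (@riccati_bound (fun s => u (s + t)) (fun s => w (s + t)) nu T T0) => s /andP[s0 _]; last exact/H/sh.
have [d1 d2] := du _ (sh s s0).
have E : (fun h : R^o => h^-1 *: (((fun s0 : R => u (s0 + t)) \o shift s) (h *: 1) - u (s + t)))
    = (fun h : R^o => h^-1 *: ((u \o shift (s + t)) (h *: 1) - u (s + t))).
  by apply/funext => h /=; rewrite addrA.
split; first by rewrite /derivable E.
by rewrite -d2 /derive E.
Qed.

(** [u], [w] and [k] are the first three derivatives of a barrier along a ray.
    By the bound on [k], the function [1 / sqrt w] grows at most at unit rate, so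
    that [sqrt (w t) >= 1 / (r + t)] with [r = 1 / sqrt (w 0)]. Hence [u + 1 / (r + t)]
    is nondecreasing; since [u <= 0], letting [t] tend to infinity gives
    [u 0 + sqrt (w 0) <= 0]. *)
Lemma ray_decrease u w k nu :
  (forall t : R, 0 <= t -> isd t u (w t)) ->
  (forall t : R, 0 <= t -> isd t w (k t)) ->
  (forall t : R, 0 <= t -> `|k t| <= 2 * Num.sqrt (w t) ^+ 3) ->
  (forall t : R, 0 <= t -> [/\ 0 <= w t, 0 <= nu & u t ^+ 2 <= nu * w t]) ->
  w 0 <= u 0 ^+ 2 /\ u 0 <= 0.
Proof.
move=> du dw kw H; have un := ray_nonpos du H.
have w0 t : 0 <= t -> 0 <= w t by move=> /H [].
suff key : u 0 + Num.sqrt (w 0) <= 0.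
  split; last exact: un.
  rewrite -(sqr_sqrtr (w0 0 (lexx 0))) -[leRHS]sqrrN ler_sqr ?nnegrE ?oppr_ge0 ?sqrtr_ge0 ?un//.
  by rewrite -subr_ge0 -opprD oppr_ge0.
apply/ler_addgt0Pr => e e0; rewrite add0r.
(* Adding d > 0 to w makes the square root invertible. At time T the error terms
1 / (r + T) and d * T are both at most 1 / T = e / 2. *)
pose T := 2 / e; have T0 : 0 < T by rewrite divr_gt0.
pose d := T ^- 2; have d0 : 0 < d by rewrite invr_gt0 exprn_gt0.
pose p (t : R^o) : R^o := expR (- (2^-1 * ln (w t + d))).
have wd t : 0 <= t -> 0 < w t + d by move=> /w0 wt; rewrite ltr_wpDl.
have pE t : 0 <= t -> p t = (Num.sqrt (w t + d))^-1.
  move=> t0; rewrite /p expRN; congr (_^-1).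
  by rewrite -powR12_sqrt ?ltW ?wd// /powR gt_eqF// wd.
have p0 t : 0 < p t by exact: expR_gt0.
have dp (t : R) : 0 <= t -> isd t p (p t * (- (2^-1 * ((w t + d)^-1 * k t)))).
  move=> t0.
  have i1 : isd t (fun t => w t + d) (k t).
    by apply: isD_eq (isD_add (dw t t0) (isD_cst d t 1)) _; rewrite addr0.
  have i2 := @isD_ln _ _ (fun t : R^o => w t + d : R^o) t 1 _ (wd t t0) i1.
  have i3 := isD_opp (isD_mul (isD_cst 2^-1 t 1) i2).
  have i4 : isd t (fun t => - (2^-1 * ln (w t + d))) (- (2^-1 * ((w t + d)^-1 * k t))).
    by apply: isD_eq i3 _; rewrite mulr0 addr0.
  have [d1 e1] := i4; have [d2 e2] := is_derive_expR (- (2^-1 * ln (w t + d))).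
  split.
    apply/derivable1_diffP; apply: (@differentiable_comp _ _ _ _ (fun t : R^o => - (2^-1 * ln (w t + d))) (@expR R)); exact/derivable1_diffP.
  by have := derive1_comp d1 d2; rewrite !derive1E e1 e2.
have pt t : 0 <= t -> p t <= p 0 + t.
  move=> t0; have := @derive_ge0_le (fun t : R^o => (0 + 1 * t) + - p t)
    (fun t => 1 + - (p t * (- (2^-1 * ((w t + d)^-1 * k t))))) t t0.
  suff H2 : forall s : R, 0 <= s <= t -> 0 <= 1 + - (p s * (- (2^-1 * ((w s + d)^-1 * k s)))).
    move=> /(_ _ H2) h; have {}h : (0 + 1 * 0) + - p 0 <= (0 + 1 * t) + - p t.
      apply: h => s /andP[s0 _]; apply: isD_add; first exact: is_derive_affine.
      by apply: isD_opp; exact: dp.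
    by rewrite -subr_ge0; move: h; rewrite -subr_ge0; congr (0 <= _); ring.
  move=> s /andP[s0 _]; rewrite subr_ge0.
  apply: (@le_trans _ _ (p s * (2^-1 * ((w s + d)^-1 * (2 * Num.sqrt (w s) ^+ 3))))).
    apply: ler_wpM2l; first exact: ltW.
    rewrite -mulrN -mulrN; apply: ler_wpM2l; first by rewrite invr_ge0.
    apply: ler_wpM2l; first by rewrite invr_ge0 ltW// wd.
    by apply: le_trans (kw s s0); rewrite -normrN ler_norm.
  rewrite pE//; set S := Num.sqrt (w s + d).
  have S0 : 0 < S by rewrite sqrtr_gt0 wd.
  have -> : w s + d = S ^+ 2 by rewrite sqr_sqrtr// ltW// wd.
  have sS : Num.sqrt (w s) <= S by rewrite ler_wsqrtr// lerDl ltW.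
  have -> : S^-1 * (2^-1 * ((S ^+ 2)^-1 * (2 * Num.sqrt (w s) ^+ 3))) = (Num.sqrt (w s) / S) ^+ 3.
    by field; rewrite gt_eqF.
  apply: exprn_ile1; first by rewrite divr_ge0 ?sqrtr_ge0 ?ltW.
  by rewrite ler_pdivrMr// mul1r.
set r := p 0 in pt; have r0 : 0 < r by exact: p0.
have wr t : 0 <= t -> 0 <= w t + (- (r + t)^-1 * (r + t)^-1 + d).
  move=> t0; have rt : 0 < r + t by rewrite ltr_wpDr.
  have h := pt t t0; rewrite (pE t t0) in h.
  have S0 : 0 < Num.sqrt (w t + d) by rewrite sqrtr_gt0 wd.
  have {}h : (r + t)^-1 <= Num.sqrt (w t + d) by rewrite -[leRHS]invrK lef_pV2// posrE invr_gt0.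
  have : (r + t)^-1 ^+ 2 <= w t + d.
    rewrite -[leRHS](sqr_sqrtr (ltW (wd t t0))).
    by rewrite ler_sqr ?nnegrE ?sqrtr_ge0// invr_ge0 ltW.
  by rewrite -subr_ge0; congr (0 <= _); ring.
have := @derive_ge0_le (fun t : R^o => u t + ((r + 1 * t)^-1 + (0 + d * t)))
  (fun t => w t + (- (r + 1 * t)^-1 * (r + 1 * t)^-1 * 1 + d)) T (ltW T0).
move=> h; have {}h : u 0 + ((r + 1 * 0)^-1 + (0 + d * 0)) <= u T + ((r + 1 * T)^-1 + (0 + d * T)).
  apply: h => t /andP[t0 _].
    apply: isD_add; first exact: du.
    apply: isD_add; last exact: is_derive_affine.
    apply: isD_inv; last exact: is_derive_affine.
    by rewrite gt_eqF// mul1r ltr_wpDr.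
  by rewrite !mul1r !mulr1; exact: wr.
move: h; rewrite !mulr0 !mul1r !addr0 add0r => h.
have sr : Num.sqrt (w 0) <= r^-1.
  by rewrite /r pE// invrK ler_wsqrtr// lerDl ltW.
apply: (@le_trans _ _ (u 0 + r^-1)); first by rewrite lerD2l.
apply: (le_trans h); have -> : e = 0 + (T^-1 + T^-1).
  by rewrite /T invf_div add0r -splitr.
apply: lerD; first exact/un/ltW.
apply: lerD; first by rewrite lef_pV2 ?posrE ?addr_gt0// lerDr ltW.
by rewrite /d exprS expr1 invfM -mulrA mulVf ?mulr1// gt_eqF.
Qed.

(** Since [G' <= G ^+ 2], the function [1 / G + t] is nondecreasing, so that [G]
    stays bounded up to the time [b < 1 / G 0], and [Phi] with it. *)
Lemma slope_bound Phi G w (b T : R) : 0 <= T -> T <= b -> 0 < b -> G 0 < b^-1 ->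
  (forall t : R, 0 <= t <= T -> isd t Phi (G t)) ->
  (forall t : R, 0 <= t <= T -> isd t G (w t)) ->
  (forall t : R, 0 <= t <= T -> w t <= G t ^+ 2 /\ 0 <= G t) ->
  Phi T <= Phi 0 + b * (((G 0 + b^-1) / 2)^-1 - b)^-1.
Proof.
move=> T0 Tb b0 Gb dPhi dG H.
have bi : 0 < b^-1 by rewrite invr_gt0.
have T00 : 0 <= (0 : R) <= T by rewrite lexx T0.
have [_ G00] := H 0 T00.
(* The shift by d keeps the slope positive when G vanishes; it is half the gap
to 1 / b, so that the shifted slope still starts below 1 / b. *)
pose d := (b^-1 - G 0) / 2; have d0 : 0 < d by rewrite divr_gt0 ?subr_gt0.
pose y (t : R^o) : R^o := G t + d.
have y0E : (G 0 + b^-1) / 2 = y 0 by rewrite /y /d; field; rewrite gt_eqF.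
rewrite y0E; have y00 : 0 < y 0 by rewrite /y ltr_wpDl.
have yb : y 0 < b^-1 by rewrite -y0E ltr_pdivrMr// mulr_natr mulr2n ltrD2r.
set c := (y 0)^-1 - b; have c0 : 0 < c by rewrite subr_gt0 -[ltLHS]invrK ltf_pV2.
have Gc t : 0 <= t <= T -> G t <= c^-1.
  move=> /andP[t0 tT].
  have sT s : 0 <= s <= t -> 0 <= s <= T by move=> /andP[-> st]; rewrite (le_trans st).
  have yp s : 0 <= s <= t -> 0 < y s by move=> /sT/H [_ Gs]; rewrite /y ltr_wpDl.
  have h := @derive_ge0_le (fun t : R^o => (y t)^-1 + (0 + 1 * t))
    (fun t => - (y t)^-1 * (y t)^-1 * w t + 1) t t0.
  have {}h : (y 0)^-1 + (0 + 1 * 0) <= (y t)^-1 + (0 + 1 * t).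
    apply: h => s st.
      apply: isD_add; last exact: is_derive_affine.
      apply: isD_inv; first by rewrite gt_eqF// yp.
      by apply: isD_eq (isD_add (dG s (sT s st)) (isD_cst d s 1)) _; rewrite addr0.
    have [wG G0] := H s (sT s st); have ys := yp s st.
    have -> : - (y s)^-1 * (y s)^-1 * w s + 1 = (y s ^+ 2)^-1 * (y s ^+ 2 - w s).
      by field; rewrite gt_eqF.
    rewrite mulr_ge0 ?invr_ge0 ?sqr_ge0// subr_ge0 (le_trans wG)//.
    by rewrite ler_sqr ?nnegrE ?(ltW ys)// /y lerDl ltW.
  have yt : 0 < y t by apply: yp; rewrite t0 lexx.
  have ct : c <= (y t)^-1.
    rewrite lerBlDr; move: h; rewrite !mul1r !add0r addr0 => /le_trans; apply.
    by rewrite lerD2l (le_trans tT).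
  apply: (@le_trans _ _ (y t)); first by rewrite /y lerDl ltW.
  by rewrite -[leLHS]invrK lef_pV2 ?posrE// invr_gt0.
have h := @derive_ge0_le (fun t : R^o => (0 + c^-1 * t) + - Phi t) (fun t => c^-1 + - G t) T T0.
have {}h : (0 + c^-1 * 0) + - Phi 0 <= (0 + c^-1 * T) + - Phi T.
  apply: h => t tT; last by rewrite subr_ge0; exact: Gc.
  by apply: isD_add; [exact: is_derive_affine|apply: isD_opp; exact: dPhi].
move: h; rewrite mulr0 !add0r -lerBlDl => h.
have h2 : Phi T <= Phi 0 + c^-1 * T.
  by rewrite -subr_ge0; move: h; rewrite -subr_ge0; congr (0 <= _); ring.
apply: (le_trans h2); rewrite lerD2l mulrC; apply: ler_wpM2r => //.
by rewrite invr_ge0 ltW.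
Qed.

End OneD.

(** * A lower bound for the parameter of a barrier *)

Section OpenConvex.
Context {R : realType} {E : normedModType R}.
Implicit Types (U V : set E).

Definition seg_convex U := forall x y (t : R), U x -> U y -> 0 <= t <= 1 -> U (x + t *: (y - x)).

(** Reflect a point [v] of [V] through [z], to a point of [U] slightly beyond
    [z], and approximate the latter by some [w] in [V]. The point [w'] that is
    aligned with [w] and [z] is close to [v], hence in [V], and [z] is between [w]
    and [w']. *)
Lemma open_convex_closure_sub U V : open U -> open V -> seg_convex V ->
  U `<=` closure V -> U `<=` V.
Proof.
move=> oU oV sV UV z Uz.
have [v [Vv _]] := UV _ Uz _ filterT.
have nU := line_near (z - v) oU Uz.
have [s s0 Us] : exists2 s : R, 0 < s & U (z + s *: (z - v)).
  have /nbhs_ballP [r /= r0 rU] := nU.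
  exists (r / 2); first by rewrite divr_gt0.
  apply: rU; rewrite /ball/= sub0r normrN gtr0_norm ?divr_gt0//.
  by rewrite ltr_pdivrMr// ltr_pMr// ltr1n.
set z' := z + s *: (z - v) in Us.
have c : (fun w : E => s^-1 *: ((1 + s) *: z - w)) @ z' --> v.
  have e : s^-1 *: ((1 + s) *: z - z') = v.
    rewrite /z' scalerDl scale1r opprD addrACA subrr add0r -scalerBr subKr scalerA.
    by rewrite mulVf ?scale1r// gt_eqF.
  by rewrite -[X in _ --> X]e; apply: cvgZr; apply: cvgB; [exact: cvg_cst|exact: cvg_id].
have [w [Vw Vw']] := UV _ Us _ (c _ (open_nbhs_nbhs (conj oV Vv))).
have s1 : 0 < 1 + s by rewrite addr_gt0.
set w' := s^-1 *: ((1 + s) *: z - w) in Vw'.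
have {}Vw' : V w' by [].
have sw : s *: w' = (1 + s) *: z - w.
  by rewrite /w' scalerA divff ?scale1r// gt_eqF.
have -> : z = w' + (1 + s)^-1 *: (w - w').
  have -> : w - w' = (1 + s) *: (z - w').
    by rewrite scalerBr [(1 + s) *: w']scalerDl scale1r sw opprD opprB addrCA subrKC addrC.
  by rewrite scalerA mulVf ?gt_eqF// scale1r subrKC.
apply: sV => //; rewrite invr_ge0 ltW//= invf_le1// lerDl ltW//.
Qed.

Lemma open_convex_closure_eq U V : open U -> open V -> seg_convex U -> seg_convex V ->
  closure U = closure V -> U = V.
Proof.
move=> oU oV sU sV UV; apply/seteqP; split.
  by apply: open_convex_closure_sub => //; rewrite -UV; exact: subset_closure.
by apply: open_convex_closure_sub => //; rewrite UV; exact: subset_closure.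
Qed.

End OpenConvex.

Section SegmentIdentities.
Context {R : realType} {E : lmodType R}.
Implicit Types (x y h k : E).

Lemma segE x y (t : R) : x + t *: (y - x) = (1 - t) *: x + t *: y.
Proof. by rewrite scalerBr scalerBl scale1r addrA addrAC. Qed.

Lemma half_half x : (2^-1 : R) *: x + (2^-1 : R) *: x = x.
Proof. by rewrite -scalerDl (_ : 2^-1 + 2^-1 = 1 :> R) ?scale1r//; field. Qed.

Lemma mid_line x h k (t : R) :
  (2^-1 : R) *: (x + t *: ((2 : R) *: h)) + (2^-1 : R) *: (x + t *: ((2 : R) *: k))
  = x + t *: (h + k).
Proof.
have E1 (u : E) : (2^-1 : R) *: (t *: ((2 : R) *: u)) = t *: u.
  by rewrite !scalerA (_ : 2^-1 * t * 2 = t)//; field.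
by rewrite !scalerDr !E1 addrACA half_half.
Qed.

End SegmentIdentities.

Section NuBound.
Context {R : realType} {E : normedModType R}.
Variables (f : E -> \bar R) (Q : set E) (nu : R).
Hypothesis Hf : nu_sc_barrier nu Q f.

Let U := dom f.
Let F x : R^o := fine (f x).

Let oU : open U. Proof. by case: Hf => [[[]]]. Qed.
Let CF : Ck 3 U F. Proof. by case: Hf => [[[]]]. Qed.
Let cepi : closed (epigraph f). Proof. by case: Hf => [[[]]]. Qed.

Let fE x : U x -> f x = (F x)%:E.
Proof.
move=> Ux; rewrite /F fineK// fin_numElt; apply/andP; split; last exact: Ux.
by case: Hf => [[[[fN _] _ _ _ _] _] _]; rewrite ltNye fN.
Qed.

Lemma barrier_dom_convex : seg_convex U.
Proof.
move=> x y t Ux Uy /andP[t0 t1].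
case: Hf => [[[[_ cf] _ _ _ _] _] _].
have t'01 : 0 <= 1 - t <= 1 by rewrite subr_ge0 t1 lerBlDr lerDl.
have := cf x y (1 - t) t'01; rewrite subKr (fE Ux) (fE Uy).
rewrite segE => h; by apply: le_lt_trans h _; rewrite -!EFinM -EFinD ltry.
Qed.

Let F_mid x y : U x -> U y ->
  F ((2^-1 : R) *: x + (2^-1 : R) *: y) <= 2^-1 * F x + 2^-1 * F y.
Proof.
move=> Ux Uy; case: Hf => [[[[_ cf] _ _ _ _] _] _].
have h01 : 0 <= (2^-1 : R) <= 1 by rewrite invr_ge0 ler0n invf_le1// ler1n.
have hE : 1 - 2^-1 = 2^-1 :> R by field.
have := cf x y 2^-1 h01; rewrite hE.
have Um : U ((2^-1 : R) *: x + (2^-1 : R) *: y).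
  by have := barrier_dom_convex Ux Uy h01; rewrite segE hE.
by rewrite (fE Um) (fE Ux) (fE Uy) -!EFinM -EFinD lee_fin.
Qed.

Let isF k x h t : (k < 3)%N -> U (x + t *: h) ->
  is_derive (t : R) 1 (fun t : R => iterD k h F (x + t *: h)) (iterD k.+1 h F (x + t *: h)).
Proof.
move=> k3 Ut; apply: is_derive_line_at; apply: (@Ck_derivable _ _ 0 U) => //.
by apply: (@Ck_iterD _ _ k 1); apply: Ck_le CF; rewrite addn1.
Qed.

Let derive_scale (G : E -> R^o) x h (a : R) : Ck 1 U G -> U x -> 'D_(a *: h) G x = a * 'D_h G x.
Proof.
move=> CG Ux.
have [d1 e1] := is_derive_line (Ck_derivable CG (v := h) Ux).
have [d2 e2] := is_derive_line (Ck_derivable CG (v := a *: h) Ux).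
rewrite -e1 -e2.
have da : is_derive (0 : R^o) 1 (fun t : R^o => 0 + a * t : R^o) a by exact: is_derive_affine.
have [d3 e3] := da.
have d1' : derivable (fun t : R => G (t *: h + x)) (0 + a * 0) 1 by rewrite add0r mulr0.
have := derive1_comp d3 d1'; rewrite !derive1E e3 add0r mulr0 => e.
rewrite mulrC -e.
suff -> : (fun t : R => G (t *: (a *: h) + x)) =
  (fun t : R => G (t *: h + x)) \o (fun t : R^o => 0 + a * t) by [].
by apply/funext => t /=; rewrite add0r scalerA mulrC.
Qed.

Let iterD1_scale x h (a : R) : U x -> iterD 1 (a *: h) F x = a * iterD 1 h F x.
Proof. by move=> Ux; apply: derive_scale => //; apply: Ck_le CF. Qed.

Let iterD2_scale x h (a : R) : U x -> iterD 2 (a *: h) F x = a ^+ 2 * iterD 2 h F x.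
Proof.
move=> Ux; rewrite iterDS.
have nU := open_nbhs_nbhs (conj oU Ux).
have C1 : Ck 1 U (iterD 1 h F) by apply: (@Ck_iterD _ _ 1 1); apply: Ck_le CF.
have dh : is_derive x (a *: h) (iterD 1 h F) (a * iterD 2 h F x).
  by split; [exact: Ck_derivable C1 _ _ Ux|rewrite derive_scale].
apply: (derive_near (g := fun y => a * iterD 1 h F y) oU Ux).
  by move=> y Uy; rewrite iterD1_scale.
by apply: isD_eq (isD_mul (isD_cst a x (a *: h)) dh) _; ring.
Qed.

Let quad x h : U x ->
  [/\ 0 <= iterD 2 h F x, 0 <= nu & iterD 1 h F x ^+ 2 <= nu * iterD 2 h F x].
Proof.
move=> Ux; apply: nu_quad => a.
case: Hf => _ /(_ x (a *: h) Ux).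
rewrite (@DkE _ _ 1 3 f x (a *: h) oU CF isT Ux) (@DkE _ _ 2 3 f x (a *: h) oU CF isT Ux).
by rewrite -/F iterD1_scale// iterD2_scale.
Qed.

Let sc3 x h : U x -> `|iterD 3 h F x| <= 2 * Num.sqrt (iterD 2 h F x) ^+ 3.
Proof.
move=> Ux; have [w0 _ _] := quad h Ux.
rewrite -powR32//.
have [[[_ _ _ _ /(_ x h Ux) h3] _] _] := Hf; move: h3.
by rewrite (@DkE _ _ 3 3 f x h oU CF isT Ux) (@DkE _ _ 2 3 f x h oU CF isT Ux).
Qed.

(* Along the segment from x to y, the slope does not blow up before time 1. *)
Let slope_le x y : U x -> U y -> iterD 1 (y - x) F x <= nu.
Proof.
move=> Ux Uy; set h := y - x.
have seg t : 0 <= t <= 1 -> U (x + t *: h) by exact: barrier_dom_convex.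
have := @riccati_bound R (fun t => iterD 1 h F (x + t *: h)) (fun t => iterD 2 h F (x + t *: h)) nu 1 ler01.
rewrite scale0r addr0 mulr1; apply => t /seg Ut; first exact: isF.
exact: quad.
Qed.

(** Directions of unbounded rays, from every point of the domain; for a convex
    cone, the elements of its closure ([cQ_recession]). *)
Definition recession p := forall y (t : R), U y -> 0 <= t -> U (y + t *: p).

Let recession_slope x p : U x -> recession p ->
  iterD 2 p F x <= iterD 1 p F x ^+ 2 /\ iterD 1 p F x <= 0.
Proof.
move=> Ux rp; have Ut t : 0 <= t -> U (x + t *: p) by exact: rp.
have := @ray_decrease R (fun t => iterD 1 p F (x + t *: p)) (fun t => iterD 2 p F (x + t *: p))
  (fun t => iterD 3 p F (x + t *: p)) nu.
rewrite scale0r addr0; apply => t /Ut Uxt; [exact: isF|exact: isF|exact: sc3|exact: quad].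
Qed.

(* If the slope were larger than - 1 / b, then going back from x by at most b
would keep F below the bound M of slope_bound; as the epigraph is closed, the
last point reached would be in the domain, and so would x - b *: p. *)
Let recession_bound x p (b : R) : U x -> recession p -> 0 < b -> ~ U (x - b *: p) ->
  iterD 1 p F x <= - b^-1.
Proof.
move=> Ux rp b0 nU; rewrite leNgt; apply/negP => hlt.
pose M := F x + b * (((- iterD 1 p F x + b^-1) / 2)^-1 - b)^-1.
pose A := [set t : R | 0 <= t <= b /\ U (x - t *: p)].
have seg t : A t -> forall s, 0 <= s <= t -> U (x - s *: p).
  move=> [/andP[t0 tb] Ut] s /andP[s0 st].
  have -> : x - s *: p = (x - t *: p) + (t - s) *: p.
    by rewrite scalerBl addrA subrK.
  by apply: rp => //; rewrite subr_ge0.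
have AM t : A t -> F (x - t *: p) <= M.
  move=> At; have [/andP[t0 tb] _] := At.
  have Us := seg t At.
  have Us' (s : R) : 0 <= s <= t -> U (x + s *: (- p)) by move=> /Us; rewrite scalerN.
  have := @slope_bound R (fun s => iterD 0 (- p) F (x + s *: (- p)))
    (fun s => iterD 1 (- p) F (x + s *: (- p)))
    (fun s => iterD 2 (- p) F (x + s *: (- p))) b t t0 tb b0.
  rewrite !scale0r !addr0 scalerN.
  have m1 y : U y -> iterD 1 (- p) F y = - iterD 1 p F y.
    by move=> Uy; rewrite -scaleN1r iterD1_scale// mulN1r.
  have m2 y : U y -> iterD 2 (- p) F y = iterD 2 p F y.
    by move=> Uy; rewrite -scaleN1r iterD2_scale// sqrrN expr1n mul1r.
  rewrite m1//; apply.
  - by rewrite ltrNl.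
  - by move=> s /Us' Uxs; exact: (isF (k := 0)).
  - by move=> s /Us' Uxs; exact: (isF (k := 1)).
  - move=> s /Us' Uxs; rewrite m1// m2//.
    have [h1 h2] := recession_slope Uxs rp.
    by rewrite sqrrN oppr_ge0.
have A0 : A 0 by split; [rewrite lexx ltW|rewrite scale0r subr0].
have ubA : ubound A b by move=> t [/andP[]].
have supA : has_sup A by split; [exists 0|exists b].
pose s := sup A.
have sb : s <= b by apply: ge_sup => //; exists 0.
have s0 : 0 <= s by apply: ub_le_sup A0; exists b.
have csub (t : R^o) : {for t, continuous (fun t : R^o => x - t *: p)}.
  by apply: cvgB; [exact: cvg_cst|apply: cvgZl; exact: cvg_id].
have Us : U (x - s *: p).
  suff : epigraph f (x - s *: p, M) by rewrite /epigraph/= => h; exact: le_lt_trans h (ltry _).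
  apply: cepi => B [[B1 B2] /= [B1s B2M] BB].
  have /nbhs_ballP [r /= r0 rB] := csub s _ B1s.
  have [t At ts] := sup_adherent r0 supA.
  have ts' : t <= s by apply: ub_le_sup At; exists b.
  exists (x - t *: p, M); split.
    by rewrite /epigraph/= fE ?lee_fin; [exact: AM|exact: At.2].
  apply: BB; split => /=; last exact: nbhs_singleton.
  by apply: rB; rewrite /ball/= ger0_norm ?subr_ge0// ltrBlDr addrC -ltrBlDr.
have sltb : s < b.
  rewrite lt_neqAle sb andbT; apply/eqP => sE; by apply: nU; rewrite -sE.
have /nbhs_ballP [r /= r0 rU] := csub s _ (open_nbhs_nbhs (conj oU Us)).
pose t := Num.min b (s + r / 2).
have st : s < t by rewrite lt_min sltb ltrDl divr_gt0.
have tA : A t.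
  split; first by rewrite (le_trans s0 (ltW st)) ge_min lexx.
  apply: rU; rewrite /ball/= distrC gtr0_norm ?subr_gt0//.
  rewrite ltrBlDl gt_min; apply/orP; right; rewrite ltrD2l.
  by rewrite ltr_pdivrMr// ltr_pMr// ltr1n.
have : t <= s by apply: ub_le_sup tA; exists b.
by rewrite leNgt st.
Qed.

(* By convexity m is nonnegative; as m 0 = 0, its derivative vanishes at 0. This
replaces an appeal to differentiability on E. *)
Let slopeD x h k : U x -> iterD 1 (h + k) F x = iterD 1 h F x + iterD 1 k F x.
Proof.
move=> Ux.
pose m (t : R) : R := 2^-1 * F (x + t *: ((2 : R) *: h)) + 2^-1 * F (x + t *: ((2 : R) *: k)) - F (x + t *: (h + k)).
have n1 := line_near ((2 : R) *: h) oU Ux.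
have n2 := line_near ((2 : R) *: k) oU Ux.
have n3 := line_near (h + k) oU Ux.
have n123 : nbhs (0 : R) [set t : R | (U (x + t *: ((2 : R) *: h)) /\ U (x + t *: ((2 : R) *: k))) /\ U (x + t *: (h + k))].
  exact: filterI (filterI n1 n2) n3.
have /nbhs_ballP [r /= r0 Hr] := n123.
have {}Hr (t : R) : - r < t < r -> [/\ U (x + t *: ((2 : R) *: h)), U (x + t *: ((2 : R) *: k)) & U (x + t *: (h + k))].
  by move=> tr; have [|[]] := Hr t; first by rewrite /ball/= sub0r normrN ltr_norml.
have dm (t : R) : t \in `]- r, r[ -> is_derive (t : R) 1 (m : R^o -> R^o)
   (2^-1 * iterD 1 ((2 : R) *: h) F (x + t *: ((2 : R) *: h)) + 2^-1 * iterD 1 ((2 : R) *: k) F (x + t *: ((2 : R) *: k))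
    - iterD 1 (h + k) F (x + t *: (h + k))).
  rewrite in_itv/= => tr.
  have [U1 U2 U3] := Hr t tr.
  have i1 := isD_mul (isD_cst 2^-1 t 1) (isF (k := 0) isT U1).
  have i2 := isD_mul (isD_cst 2^-1 t 1) (isF (k := 0) isT U2).
  have i3 := isD_opp (isF (k := 0) isT U3).
  by apply: isD_eq (isD_add (isD_add i1 i2) i3) _; rewrite !mulr0 !addr0.
have m0 : m 0 = 0 by rewrite /m !scale0r !addr0; field.
have mge t : t \in `]- r, r[ -> m 0 <= m t.
  rewrite in_itv/= => tr.
  have [U1 U2 U3] := Hr t tr.
  rewrite m0 /m subr_ge0; by have := F_mid U1 U2; rewrite mid_line.
have z0 : (0 : R) \in `]- r, r[ by rewrite in_itv/= oppr_lt0 r0.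
have rr : - r <= r by rewrite ge0_cp// ltW.
have z00 : 0 <= (0 : R) < r by rewrite lexx.
have dm0 (t : R) : t \in `]- r, r[ -> derivable (m : R^o -> R^o) t 1 by move=> /dm [].
have [_ em] := @derive1_at_min R m (- r) r 0 rr dm0 z0 mge.
have [_] := dm 0 z0; rewrite em !scale0r !addr0 !iterD1_scale// => e.
have e' : iterD 1 h F x + iterD 1 k F x - iterD 1 (h + k) F x = 0 by rewrite [RHS]e; field.
by apply/eqP; rewrite eq_sym -subr_eq0 e'.
Qed.

Let slope_sum (I : Type) (r : seq I) (p : I -> E) (a : I -> R) x : U x ->
  iterD 1 (\sum_(i <- r) a i *: p i) F x = \sum_(i <- r) a i * iterD 1 (p i) F x.
Proof.
move=> Ux; elim: r => [|i r IH].
  by rewrite !big_nil -(scale0r 0) iterD1_scale// mul0r.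
by rewrite !big_cons slopeD// iterD1_scale// IH.
Qed.

(** Let [y = x - \sum a i p i]. The slope at [x] towards [y] is at most [nu], and
    it is the sum of the [a i] times the slopes along [- p i], each of which is at
    least [1 / b i]. *)
Lemma barrier_parameter_ge (I : Type) (r : seq I) (p : I -> E) (a b : I -> R) x :
  U x -> U (x - \sum_(i <- r) a i *: p i) ->
  (forall i, [/\ recession (p i), 0 <= a i, 0 < b i & ~ U (x - b i *: p i)]) ->
  \sum_(i <- r) a i / b i <= nu.
Proof.
move=> Ux Uy H; apply: le_trans (slope_le Ux Uy).
rewrite addrAC subrr add0r -scaleN1r iterD1_scale// slope_sum// mulN1r -sumrN.
apply: ler_sum => i _; have [rp a0 b0 nU] := H i.
by rewrite lerNr -mulrN; apply: ler_wpM2l => //; exact: recession_bound.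
Qed.

End NuBound.

Local Open Scope complex_scope.
Local Open Scope sesquilinear_scope.

(** * Hermitian matrices and their quadratic forms *)

Section ComplexBasics.
Context {R : realType}.
Local Notation C := R[i].
Implicit Types (z w : C) (a : R).

Local Notation Re := (@complex.Re R).
Local Notation Im := (@complex.Im R).

Definition nsq z : R := Re z ^+ 2 + Im z ^+ 2.

Lemma nsq_ge0 z : 0 <= nsq z.
Proof. by rewrite addr_ge0// sqr_ge0. Qed.

Lemma ReD z w : Re (z + w) = Re z + Re w. Proof. by case: z w => ? ? []. Qed.
Lemma ImD z w : Im (z + w) = Im z + Im w. Proof. by case: z w => ? ? []. Qed.
Lemma ReN z : Re (- z) = - Re z. Proof. by case: z. Qed.
Lemma ImN z : Im (- z) = - Im z. Proof. by case: z. Qed.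
Lemma ReB z w : Re (z - w) = Re z - Re w. Proof. by rewrite ReD ReN. Qed.
Lemma ReM z w : Re (z * w) = Re z * Re w - Im z * Im w.
Proof. by case: z w => ? ? []. Qed.
Lemma ImM z w : Im (z * w) = Re z * Im w + Im z * Re w.
Proof. by case: z w => ? ? []. Qed.
Lemma ReJ z : Re (Num.conj z) = Re z. Proof. by case: z. Qed.
Lemma ImJ z : Im (Num.conj z) = - Im z. Proof. by case: z. Qed.
Lemma ReZ a z : Re (a%:C * z) = a * Re z.
Proof. by rewrite ReM /= mul0r subr0. Qed.
Lemma ImZ a z : Im (a%:C * z) = a * Im z.
Proof. by rewrite ImM /= mul0r addr0. Qed.

Lemma Re_sum (I : Type) (r : seq I) (P : pred I) (F : I -> C) :
  Re (\sum_(i <- r | P i) F i) = \sum_(i <- r | P i) Re (F i).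
Proof. by elim/big_rec2: _ => // i x y _ <-; rewrite ReD. Qed.

Lemma Re_conj_mul z : Re (Num.conj z * z) = nsq z.
Proof. by rewrite ReM ReJ ImJ /nsq; ring. Qed.

Lemma nsqM z w : nsq (z * w) = nsq z * nsq w.
Proof. by rewrite /nsq ReM ImM; ring. Qed.

Lemma nsq_line z w (t c : R) : c * nsq (z + t%:C * w) =
  (Re z + Re w * t) ^+ 2 * c + (Im z + Im w * t) ^+ 2 * c.
Proof. by rewrite /nsq ReD ImD ReZ ImZ; ring. Qed.

Lemma nsqJ z : nsq (Num.conj z) = nsq z.
Proof. by rewrite /nsq ReJ ImJ sqrrN. Qed.

Lemma nsq_eq0 z : (nsq z == 0) = (z == 0).
Proof.
rewrite /nsq paddr_eq0 ?sqr_ge0// !sqrf_eq0.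
by case: z => a b /=; rewrite eq_complex.
Qed.

Lemma nsq_gt0 z : (0 < nsq z) = (z != 0).
Proof. by rewrite lt_neqAle nsq_ge0 andbT eq_sym nsq_eq0. Qed.

Lemma nsqR a : nsq a%:C = a ^+ 2.
Proof. by rewrite /nsq /= expr0n addr0. Qed.

Lemma nsq0 : nsq 0 = 0. Proof. by rewrite /nsq /= expr0n addr0. Qed.
Lemma nsq1 : nsq 1 = 1. Proof. by rewrite /nsq /= expr1n expr0n addr0. Qed.

Lemma Re_conj_le z w : Re (Num.conj z * w) <= (nsq z + nsq w) / 2.
Proof.
rewrite ReM ReJ ImJ ler_pdivlMr// -subr_ge0 /nsq.
have -> : Re z ^+ 2 + Im z ^+ 2 + (Re w ^+ 2 + Im w ^+ 2) - (Re z * Re w - - Im z * Im w) * 2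
  = (Re z - Re w) ^+ 2 + (Im z - Im w) ^+ 2 by ring.
by rewrite addr_ge0// sqr_ge0.
Qed.

(** Cauchy-Schwarz, obtained by summing the inequality between two means. *)
Lemma nsq_sum_le n (s v : 'I_n -> C) :
  nsq (\sum_i s i * v i) <= (\sum_i nsq (s i)) * (\sum_i nsq (v i)).
Proof.
rewrite -Re_conj_mul rmorph_sum mulr_suml Re_sum.
under eq_bigr do rewrite mulr_sumr Re_sum.
have h i j : Re (Num.conj (s i * v i) * (s j * v j)) <=
    (nsq (s i) * nsq (v j) + nsq (s j) * nsq (v i)) / 2.
  have := Re_conj_le (s i * Num.conj (v j)) (s j * Num.conj (v i)).
  rewrite !nsqM !nsqJ; apply: le_trans; rewrite le_eqVlt; apply/orP; left; apply/eqP.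
  by congr complex.Re; rewrite !rmorphM /= conjCK; ring.
apply: le_trans (_ : \sum_i \sum_j (nsq (s i) * nsq (v j) + nsq (s j) * nsq (v i)) / 2 <= _).
  by apply: ler_sum => i _; apply: ler_sum => j _; exact: h.
rewrite le_eqVlt; apply/orP; left; apply/eqP.
under eq_bigr do rewrite -mulr_suml big_split/= -mulr_sumr -mulr_suml.
rewrite -mulr_suml big_split/= -mulr_suml -mulr_sumr.
by field.
Qed.

End ComplexBasics.

(** Locked, so that unification compares the functions on the diagonal and does
    not unfold the matrices. *)
HB.lock Definition rdiag (R : realType) (n : nat) (d : 'I_n -> R) : 'M[R[i]]_n :=
  diag_mx (\row_j (d j)%:C).

Section HermAlgebra.
Context {R : realType}.
Local Notation C := R[i].
Local Notation Re := (@complex.Re R).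

Lemma adjM m n p (A : 'M[C]_(m, n)) (B : 'M[C]_(n, p)) :
  (A *m B) ^t* = B ^t* *m A ^t*.
Proof. by rewrite trmx_mul map_mxM. Qed.

Lemma adj1 n : (1%:M : 'M[C]_n) ^t* = 1%:M.
Proof. by rewrite trmx1 map_mx1. Qed.

Variable n : nat.
Implicit Types (X Y : herm R n) (A B S P : 'M[C]_n) (d e : 'I_n -> R) (v : 'cV[C]_n).

Lemma hermE X : hmx X ^t* = hmx X.
Proof. by apply/esym/eqP; rewrite -hermsymmxE hmxP. Qed.

Lemma adj_inv A : invmx A ^t* = invmx (A ^t*).
Proof. by rewrite trmx_inv map_invmx. Qed.

Lemma rdiagE d i j : rdiag d i j = if i == j then (d j)%:C else 0.
Proof. by rewrite rdiag.unlock !mxE; case: eqP => [->|_]; rewrite ?mulr1n ?mulr0n. Qed.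

Lemma rdiagM d e : rdiag d *m rdiag e = rdiag (fun i => d i * e i).
Proof.
rewrite rdiag.unlock mulmx_diag; congr diag_mx; apply/rowP => j.
by rewrite !mxE rmorphM.
Qed.

Lemma rdiagD d e : rdiag d + rdiag e = rdiag (fun i => d i + e i).
Proof.
by apply/matrixP => i j; rewrite mxE !rdiagE; case: eqP; rewrite ?addr0// rmorphD.
Qed.

Lemma rdiagZ (a : R) d : a%:C *: rdiag d = rdiag (fun i => a * d i).
Proof.
by apply/matrixP => i j; rewrite mxE !rdiagE; case: eqP; rewrite ?mulr0// rmorphM.
Qed.

Lemma rdiag1 : rdiag (fun=> 1) = 1%:M :> 'M[C]_n.
Proof. by apply/matrixP => i j; rewrite rdiagE !mxE; case: eqP. Qed.

Lemma adj_rdiag d : rdiag d ^t* = rdiag d.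
Proof.
rewrite rdiag.unlock tr_diag_mx map_diag_mx; congr diag_mx; apply/rowP => j.
by rewrite !mxE; exact: conjC_real.
Qed.

Lemma det_rdiag d : \det (rdiag d) = (\prod_i d i)%:C.
Proof.
by rewrite rdiag.unlock det_diag rmorph_prod; apply: eq_bigr => i _; rewrite mxE.
Qed.

Lemma invmx_eq A B : A *m B = 1%:M -> invmx A = B.
Proof.
move=> AB; have [uA _] := mulmx1_unit AB.
by rewrite -[LHS]mulmx1 -AB mulKmx.
Qed.

Lemma rdiag_inv d : (forall i, d i != 0) ->
  invmx (rdiag d) = rdiag (fun i => (d i)^-1) /\ rdiag d \in unitmx.
Proof.
move=> d0.
have E : rdiag d *m rdiag (fun i => (d i)^-1) = 1%:M.
  by rewrite rdiagM -rdiag1; apply/matrixP => i j; rewrite !rdiagE divff.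
by have [uD _] := mulmx1_unit E; split; [apply: invmx_eq|].
Qed.

Lemma adj_cong A S : (S ^t* *m A *m S) ^t* = S ^t* *m A ^t* *m S.
Proof. by rewrite !adjM trmxCK mulmxA. Qed.

Definition qf A v : R := Re ((v ^t* *m A *m v) 0 0).

Lemma qfD A B v : qf (A + B) v = qf A v + qf B v.
Proof. by rewrite /qf mulmxDr mulmxDl mxE ReD. Qed.

Lemma qfZ (a : R) A v : qf (a%:C *: A) v = a * qf A v.
Proof. by rewrite /qf -scalemxAr -scalemxAl mxE ReZ. Qed.

Lemma qf_cong A S v : qf (S ^t* *m A *m S) v = qf A (S *m v).
Proof. by rewrite /qf adjM !mulmxA. Qed.

Lemma qf_rdiag d v : qf (rdiag d) v = \sum_k d k * nsq (v k 0).
Proof.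
rewrite /qf mxE Re_sum; apply: eq_bigr => k _.
rewrite rdiag.unlock mul_mx_diag !mxE mulrAC [_ * _ * _]mulrC ReZ.
by rewrite Re_conj_mul.
Qed.

Lemma herm_qf_real X v : (v ^t* *m X *m v) 0 0 = (qf X v)%:C.
Proof.
rewrite /qf RRe_real//; apply/CrealP.
have : (v ^t* *m hmx X *m v) ^t* = v ^t* *m hmx X *m v.
  by rewrite !adjM hermE trmxCK mulmxA.
by move=> /matrixP/(_ 0 0); rewrite !mxE.
Qed.

Lemma psdP X : psd X <-> forall v, 0 <= qf X v.
Proof. by split=> H v; have := H v; rewrite herm_qf_real ler0c. Qed.

Lemma pdP X : pd X <-> forall v, v != 0 -> 0 < qf X v.
Proof. by split=> H v v0; have := H v v0; rewrite herm_qf_real ltcR. Qed.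

Lemma pd_psd X : pd X -> psd X.
Proof.
move=> /pdP pX; apply/psdP => v; have [->|v0] := eqVneq v 0; last exact/ltW/pX.
by rewrite /qf mulmx0 mxE.
Qed.

Lemma unitaryE P : P \is unitarymx -> P *m P ^t* = 1%:M /\ P ^t* *m P = 1%:M.
Proof. by move=> /unitarymxP E; split => //; exact: mulmx1C. Qed.

Lemma mxfun_ex (f : R -> R) A : A ^t* = A -> exists P d,
  [/\ P *m P ^t* = 1%:M, P ^t* *m P = 1%:M, A = P ^t* *m rdiag d *m P &
      mxfun f A = P ^t* *m rdiag (fun k => f (d k)) *m P].
Proof.
move=> AE; have hA : A \is hermsymmx by rewrite hermsymmxE AE.
have uP := spectral_unitarymx A; have [P1 P2] := unitaryE uP.
have dE : spectral_diag A = \row_j (Re (spectral_diag A 0 j))%:C.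
  apply/rowP => j; rewrite mxE RRe_real//.
  by have /mxOverP := hermitian_spectral_diag_real hA; exact.
have AP := orthomx_spectralP (hermitian_normalmx hA).
rewrite (invmx_unitary uP) in AP.
exists (spectralmx A), (fun j => Re (spectral_diag A 0 j)).
split; [exact: P1|exact: P2|by rewrite rdiag.unlock -dE; exact: AP|].
rewrite /mxfun (invmx_unitary uP) rdiag.unlock.
set D := map_mx (fun z => (f (Re z))%:C) _; set D' := \row_j _.
suff -> : D = D' by [].
by apply/rowP => j; rewrite !mxE.
Qed.

Lemma spectral_herm A : A ^t* = A -> exists P d,
  [/\ P *m P ^t* = 1%:M, P ^t* *m P = 1%:M & A = P ^t* *m rdiag d *m P].
Proof. by move=> /(mxfun_ex id) [P [d [P1 P2 AE _]]]; exists P, d. Qed.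

Lemma spectral_ex X : exists P d,
  [/\ P *m P ^t* = 1%:M, P ^t* *m P = 1%:M & hmx X = P ^t* *m rdiag d *m P].
Proof. exact: spectral_herm (hermE X). Qed.

Lemma unit_of_unitary P : P *m P ^t* = 1%:M -> P \in unitmx.
Proof. by move=> /mulmx1_unit []. Qed.

Definition ecol (k : 'I_n) : 'cV[C]_n := delta_mx k 0.

Lemma qf_rdiag_ecol d k : qf (rdiag d) (ecol k) = d k.
Proof.
rewrite qf_rdiag (bigD1 k)//= big1 => [|j jk]; rewrite mxE ?eqxx/=.
  by rewrite nsq1 mulr1 addr0.
by rewrite (negbTE jk) nsq0 mulr0.
Qed.

Lemma ecol_neq0 k : ecol k != 0.
Proof.
apply/eqP => /matrixP/(_ k 0); rewrite !mxE !eqxx/= => /eqP.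
by rewrite oner_eq0.
Qed.

Lemma unitmx_mul_neq0 S v : S \in unitmx -> v != 0 -> S *m v != 0.
Proof.
move=> uS; apply: contra => /eqP Sv.
by rewrite -[v]mul1mx -(mulVmx uS) -mulmxA Sv mulmx0.
Qed.

Lemma pd_cong_diag X S d : S \in unitmx -> hmx X = S ^t* *m rdiag d *m S ->
  pd X <-> (forall k, 0 < d k).
Proof.
move=> uS XE; rewrite pdP; split=> [H k|d0 v v0].
  have := H (invmx S *m ecol k).
  rewrite XE qf_cong mulKVmx// qf_rdiag_ecol; apply.
  by rewrite unitmx_mul_neq0 ?ecol_neq0// unitmx_inv.
rewrite XE qf_cong qf_rdiag.
have : S *m v != 0 by exact: unitmx_mul_neq0.
case/cV0Pn => k vk; rewrite (bigD1 k)//= ltr_wpDr//.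
  by apply: sumr_ge0 => j _; rewrite mulr_ge0 ?nsq_ge0// ltW.
by rewrite mulr_gt0// nsq_gt0.
Qed.

Lemma psd_cong_diag X S d : S \in unitmx -> hmx X = S ^t* *m rdiag d *m S ->
  psd X <-> (forall k, 0 <= d k).
Proof.
move=> uS XE; rewrite psdP; split=> [H k|d0 v].
  have := H (invmx S *m ecol k).
  by rewrite XE qf_cong mulKVmx// qf_rdiag_ecol.
rewrite XE qf_cong qf_rdiag.
by apply: sumr_ge0 => j _; rewrite mulr_ge0 ?nsq_ge0.
Qed.

Lemma unitmx_adj S : (S ^t* \in unitmx) = (S \in unitmx).
Proof. by rewrite map_unitmx unitmx_tr. Qed.

Lemma pd_factor X : pd X -> exists2 T, T \in unitmx & hmx X = T ^t* *m T.
Proof.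
move=> pX; have [P [e [P1 P2 XE]]] := spectral_ex X.
have uP := unit_of_unitary P1.
have e0 := (pd_cong_diag uP XE).1 pX.
exists (rdiag (fun k => Num.sqrt (e k)) *m P).
  rewrite unitmx_mul uP andbT; apply: (rdiag_inv _).2 => i.
  by rewrite sqrtr_eq0 -ltNge.
rewrite adjM adj_rdiag !mulmxA -[_ *m rdiag _ *m rdiag _]mulmxA rdiagM XE.
congr (_ *m _ *m _); congr rdiag; apply/funext => i.
by rewrite -expr2 sqr_sqrtr// ltW.
Qed.

(** Simultaneous diagonalization: write [X = T' T] and diagonalize the Hermitian
    matrix [T'^-1 Y T^-1] by a unitary matrix. *)
Lemma pd_cong X Y : pd X -> exists S d, [/\ S \in unitmx,
  hmx X = S ^t* *m S & hmx Y = S ^t* *m rdiag d *m S].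
Proof.
move=> /pd_factor [T uT XT].
pose B := (invmx T) ^t* *m Y *m invmx T.
have BE : B ^t* = B by rewrite adj_cong hermE.
have [Q [d [Q1 Q2 BQ]]] := spectral_herm BE.
exists (Q *m T), d; split.
- by rewrite unitmx_mul uT (unit_of_unitary Q1).
- by rewrite adjM mulmxA -(mulmxA (T ^t*)) Q2 mulmx1.
- have TT : T ^t* *m (invmx T) ^t* = 1%:M by rewrite -adjM mulVmx// adj1.
  rewrite adjM -!mulmxA (mulmxA (Q ^t*)) (mulmxA (Q ^t* *m _)) -BQ.
  by rewrite /B !mulmxA TT mul1mx -mulmxA mulVmx// mulmx1.
Qed.

End HermAlgebra.

(** * An integral formula for the relative entropy *)

Section IntRatio.
Context {R : realType}.

Lemma lin01_gt0 (mu s : R) : 0 < mu -> 0 <= s <= 1 -> 0 < 1 + s * (mu - 1).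
Proof.
move=> m0 /andP[s0 s1].
have -> : 1 + s * (mu - 1) = (1 - s) + s * mu by ring.
have [->|sn0] := eqVneq s 0; first by rewrite subr0 mul0r addr0.
by rewrite ltr_wpDl ?subr_ge0// mulr_gt0// lt_neqAle eq_sym sn0.
Qed.

Let isF (m s : R) : 0 < 1 + s * m ->
  is_derive (s : R^o) 1 (fun s : R^o => s * m - ln (1 + s * m) : R^o) (s * (m ^+ 2 * (1 + s * m)^-1)).
Proof.
move=> s0.
have i1 : is_derive (s : R^o) 1 (fun s : R^o => s * m : R^o) (s * 0 + m * 1).
  by apply: isD_mul.
have i2 : is_derive (s : R^o) 1 (fun s : R^o => 1 + s * m : R^o) (0 + (s * 0 + m * 1)).
  by apply: isD_add.
have m1 := @isD_ln _ _ (fun s : R^o => 1 + s * m : R^o) _ _ _ s0 i2.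
apply: isD_eq (isD_add i1 (isD_opp m1)) _.
by field; rewrite gt_eqF.
Qed.

Lemma cont01_ratio (mu : R) : 0 < mu ->
  cont01 (fun s => s * ((mu - 1) ^+ 2 * (1 + s * (mu - 1))^-1)).
Proof.
move=> m0; apply: cont01_at => s s01; apply: cvgM; first exact: cvg_id.
apply: cvgM; first exact: cvg_cst.
apply: cvgV; first by rewrite gt_eqF// lin01_gt0.
by apply: cvgD; [exact: cvg_cst|apply: cvgM; [exact: cvg_id|exact: cvg_cst]].
Qed.

(** This identity trades the logarithm for an integral of rational functions, for
    which the corresponding matrix expression only involves inverses. *)
Lemma int01_ratio (mu : R) : 0 < mu ->
  int01 (fun s => s * ((mu - 1) ^+ 2 * (1 + s * (mu - 1))^-1)) = mu - 1 - ln mu.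
Proof.
move=> m0.
pose F s := s * (mu - 1) - ln (1 + s * (mu - 1)).
have isF01 s : 0 <= s <= 1 -> is_derive (s : R^o) 1 (F : R^o -> R^o) (s * ((mu - 1) ^+ 2 * (1 + s * (mu - 1))^-1)).
  by move=> s01; apply: isF; exact: lin01_gt0.
have cF s : 0 <= s <= 1 -> {for s, continuous F}.
  move=> /isF01 [d _]; exact/differentiable_continuous/derivable1_diffP.
rewrite /int01 /Rintegral (@continuous_FTC2 _ _ F) //=.
- by rewrite /F !mul0r addr0 ln1 subr0 !mul1r oppr0 addr0; congr (_ - ln _); ring.
- exact: cont01_ratio.
- split.
  + by move=> s; rewrite in_itv/= => /andP[/ltW s0 /ltW s1]; have [] := isF01 s; rewrite ?s0 ?s1.
  + by apply: cvg_at_right_filter; apply: cF; rewrite lexx ler01.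
  + by apply: cvg_at_left_filter; apply: cF; rewrite lexx ler01.
- move=> s; rewrite in_itv/= => /andP[/ltW s0 /ltW s1].
  have s01 : 0 <= s <= 1 by rewrite s0 s1.
  by rewrite derive1E; have [_ ->] := isF01 s s01.
Qed.

End IntRatio.

Section Phi.
Context {R : realType} {n : nat}.
Local Notation C := R[i].
Local Notation Re := (@complex.Re R).
Implicit Types (A B H K S P : 'M[C]_n) (d e mu u v w : 'I_n -> R).

Definition Wmx (s : R) A B : 'M[C]_n := A + s%:C *: (B - A).

Definition kern (s : R) A B : R := Re (\tr ((B - A) *m invmx (Wmx s A B) *m (B - A))).

(** The relative entropy of positive definite matrices, by [DBS_pdE]. *)
Definition phi A B : R := Re (\tr A) - Re (\tr B) + int01 (fun s => s * kern s A B).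

Definition rownorm S k : R := \sum_j nsq (S k j).

Lemma rownorm_ge0 S k : 0 <= rownorm S k.
Proof. by apply: sumr_ge0 => j _; exact: nsq_ge0. Qed.

(** [rownorm S k] is the weight of the [k]-th eigenvalue in every trace that
    follows. *)
Lemma Re_tr_cong S d : Re (\tr (S ^t* *m rdiag d *m S)) = \sum_k d k * rownorm S k.
Proof.
rewrite /mxtrace Re_sum.
under eq_bigr => i _.
  rewrite mxE Re_sum.
  under eq_bigr => k _.
    rewrite rdiag.unlock mul_mx_diag !mxE mulrAC [_ * _ * _]mulrC ReZ Re_conj_mul; over.
  over.
by rewrite exchange_big; apply: eq_bigr => k _; rewrite mulr_sumr.
Qed.

Lemma cong_rdiag1 S : S ^t* *m S = S ^t* *m rdiag (fun=> 1) *m S.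
Proof. by rewrite rdiag1 mulmx1. Qed.

Lemma cong_rdiag_line S d (t : R) : S ^t* *m S + t%:C *: (S ^t* *m rdiag d *m S) =
  S ^t* *m rdiag (fun k => 1 + d k * t) *m S.
Proof.
have -> : (fun k => 1 + d k * t) = (fun k => 1 + t * d k).
  by apply/funext => k; rewrite mulrC.
by rewrite -rdiagD mulmxDr mulmxDl -cong_rdiag1 -rdiagZ -scalemxAr -scalemxAl.
Qed.

Lemma Re_tr_cong1 S : Re (\tr (S ^t* *m S)) = \sum_k rownorm S k.
Proof. by rewrite cong_rdiag1 Re_tr_cong; apply: eq_bigr => k _; rewrite mul1r. Qed.

Lemma Wmx_line (s t : R) A B H K : Wmx s (A + t%:C *: H) (B + t%:C *: K) =
  Wmx s A B + t%:C *: Wmx s H K.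
Proof.
rewrite /Wmx opprD addrACA -scalerBr (scalerDr s%:C (B - A)) (scalerDr t%:C H).
by rewrite (addrACA A (t%:C *: H)) !scalerA [s%:C * _]mulrC.
Qed.

Lemma cong_rdiagB S d e : S ^t* *m rdiag e *m S - S ^t* *m rdiag d *m S =
  S ^t* *m rdiag (fun k => e k - d k) *m S.
Proof.
rewrite -(mulmxBl (S ^t* *m rdiag e) (S ^t* *m rdiag d) S).
rewrite -(mulmxBr (S ^t*) (rdiag e) (rdiag d)).
suff -> : rdiag e - rdiag d = rdiag (fun k => e k - d k) by [].
by apply/matrixP => i j; rewrite !mxE !rdiagE; case: eqP; rewrite ?subr0// rmorphB.
Qed.

Lemma Wmx_cong (s : R) S d e :
  Wmx s (S ^t* *m rdiag d *m S) (S ^t* *m rdiag e *m S)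
  = S ^t* *m rdiag (fun k => d k + s * (e k - d k)) *m S.
Proof.
rewrite /Wmx.
rewrite (cong_rdiagB S d e).
have -> : s%:C *: (S ^t* *m rdiag (fun k => e k - d k) *m S) =
    S ^t* *m (s%:C *: rdiag (fun k => e k - d k)) *m S.
  by rewrite scalemxAl scalemxAr.
by rewrite rdiagZ -rdiagD mulmxDr mulmxDl.
Qed.

Lemma invmx_cong S d : S \in unitmx -> (forall k, d k != 0) ->
  invmx (S ^t* *m rdiag d *m S) =
  invmx S *m rdiag (fun k => (d k)^-1) *m invmx (S ^t*).
Proof.
move=> uS d0; have [<- ud] := rdiag_inv d0.
have uS' : S ^t* \in unitmx by rewrite unitmx_adj.
apply: invmx_eq; rewrite !mulmxA (mulmxK uS) (mulmxK ud); exact: mulmxV.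
Qed.

Lemma cong_rdiagMM S u v w :
  S ^t* *m rdiag u *m rdiag v *m rdiag w *m S =
  S ^t* *m rdiag (fun k => u k * v k * w k) *m S.
Proof.
by rewrite -(mulmxA (S ^t*) (rdiag u) (rdiag v)) rdiagM -(mulmxA (S ^t*)) rdiagM.
Qed.

Lemma kern_cong (s : R) S d e : S \in unitmx ->
  (forall k, d k + s * (e k - d k) != 0) ->
  kern s (S ^t* *m rdiag d *m S) (S ^t* *m rdiag e *m S) =
  \sum_k ((e k - d k) ^+ 2 * (d k + s * (e k - d k))^-1) * rownorm S k.
Proof.
move=> uS W0; have uS' : S ^t* \in unitmx by rewrite unitmx_adj.
rewrite /kern Wmx_cong (invmx_cong uS W0) cong_rdiagB.
rewrite !mulmxA (mulmxK uS) (mulmxKV uS').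
rewrite cong_rdiagMM Re_tr_cong.
by apply: eq_bigr => k _; ring.
Qed.

(** The congruence cancels in [kern], which leaves one integral [int01_ratio]
    for each eigenvalue [mu = e k / d k]. *)
Lemma phi_cong S d e : S \in unitmx -> (forall k, 0 < d k) -> (forall k, 0 < e k) ->
  phi (S ^t* *m rdiag d *m S) (S ^t* *m rdiag e *m S) =
  \sum_k d k * ln (d k / e k) * rownorm S k.
Proof.
move=> uS d0 e0; rewrite /phi (Re_tr_cong S d) (Re_tr_cong S e).
have m0 k : 0 < e k / d k by rewrite divr_gt0.
pose g k s := s * ((e k / d k - 1) ^+ 2 * (1 + s * (e k / d k - 1))^-1).
pose G k s := (d k * rownorm S k) * g k s.
have cg k : cont01 (g k) := cont01_ratio (m0 k).
have cG k : cont01 (G k) by move=> s; apply: cvgM; [exact: cvg_cst|exact: cg].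
have Gs s : 0 <= s <= 1 -> forall k, 0 < d k + s * (e k - d k).
  move=> s01 k; have := mulr_gt0 (d0 k) (lin01_gt0 (m0 k) s01).
  by congr (0 < _); field; rewrite gt_eqF.
have -> : int01 (fun s => s * kern s (S ^t* *m rdiag d *m S) (S ^t* *m rdiag e *m S))
  = int01 (fun s => \sum_k G k s).
  apply: int01_ext => s s01; rewrite (kern_cong uS); last first.
    by move=> k; rewrite gt_eqF// Gs.
  rewrite mulr_sumr; apply: eq_bigr => k _; rewrite /G /g.
  have := Gs s s01 k; have := lin01_gt0 (m0 k) s01; have := d0 k.
  by move=> dk h1 h2; field; rewrite !gt_eqF//; move: h2; congr (0 < _); ring.
rewrite (int01_sum _ cG).2 -sumrB -big_split/=; apply: eq_bigr => k _.
rewrite /G (int01Z _ (cg k)) /g (int01_ratio (m0 k)) !ln_div ?posrE//.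
by field; rewrite gt_eqF.
Qed.

Lemma phi_cong1 S mu : S \in unitmx -> (forall k, 0 < mu k) ->
  phi (S ^t* *m S) (S ^t* *m rdiag mu *m S) = - \sum_k ln (mu k) * rownorm S k.
Proof.
move=> uS m0.
rewrite (congr1 (phi^~ _) (cong_rdiag1 S)) phi_cong// -sumrN.
by apply: eq_bigr => k _; rewrite div1r lnV ?posrE// mul1r mulNr.
Qed.

Lemma phi_diag P d e : P *m P ^t* = 1%:M -> (forall k, 0 < d k) -> (forall k, 0 < e k) ->
  phi (P ^t* *m rdiag d *m P) (P ^t* *m rdiag e *m P) = \sum_k d k * ln (d k / e k).
Proof.
move=> P1 d0 e0; rewrite phi_cong ?(unit_of_unitary P1)//.
apply: eq_bigr => k _; suff -> : rownorm P k = 1 by rewrite mulr1.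
have /(congr1 (fun A : 'M[C]_n => Re (A k k))) := P1; rewrite !mxE eqxx/= Re_sum => <-.
by apply: eq_bigr => j _; rewrite !mxE -Re_conj_mul mulrC.
Qed.

End Phi.

(** * The entropy and its integral formula *)

Section PhiFacts.
Context {R : realType} {n : nat}.
Local Notation C := R[i].
Local Notation Re := (@complex.Re R).
Implicit Types (A B S P : 'M[C]_n) (d e mu : 'I_n -> R) (X Y H K : herm R n).

Lemma pd_cong_pd X Y : pd X -> pd Y -> exists S mu, [/\ S \in unitmx,
  forall k, 0 < mu k, hmx X = S ^t* *m S & hmx Y = S ^t* *m rdiag mu *m S].
Proof.
move=> pX pY; have [S [d [uS XE YE]]] := pd_cong Y pX.
by exists S, d; split => //; exact: (pd_cong_diag uS YE).1.
Qed.

Lemma mxsqrt_pd X : pd X -> (mxsqrt X) ^t* = mxsqrt X /\ mxsqrt X *m mxsqrt X = X.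
Proof.
move=> pX; have [P [d [P1 P2 XE]]] := mxfun_ex Num.sqrt (hermE X).
rewrite -/(mxsqrt X) => ->.
have d0 := (pd_cong_diag (unit_of_unitary P1) XE).1 pX.
split; first by rewrite adj_cong adj_rdiag.
rewrite -!mulmxA (mulmxA P) P1 mul1mx (mulmxA (rdiag _)) rdiagM XE mulmxA.
suff -> : (fun k => Num.sqrt (d k) * Num.sqrt (d k)) = d by [].
by apply/funext => k; rewrite -expr2 sqr_sqrtr// ltW.
Qed.

Lemma pd_unitmx X : pd X -> hmx X \in unitmx.
Proof. by move=> /pd_factor [S uS ->]; rewrite unitmx_mul unitmx_adj uS. Qed.

(** Write [T] for the square root of [X] and [T Y^-1 T = Q' diag(m) Q] with [Q]
    unitary. For [S = Q T], one has [X = S' S] and [Y = S' diag(1 / m) S], so that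
    [phi X Y] is the sum of the [ln (m k)] times the weights of [S]; the same sum is
    the trace of [X ln (T Y^-1 T)]. *)
Lemma DBS_pdE X Y : pd X -> pd Y -> DBS_pd X Y = phi X Y.
Proof.
move=> pX pY; have [aT TT] := mxsqrt_pd pX; rewrite /DBS_pd.
have uX := pd_unitmx pX; have uY := pd_unitmx pY.
move: (mxsqrt X) aT TT => T aT TT.
have uT : T \in unitmx by move: uX; rewrite -TT unitmx_mul andbb.
have aM : (T *m invmx Y *m T) ^t* = T *m invmx Y *m T.
  by rewrite !adjM adj_inv hermE aT mulmxA.
have [Q [m [Q1 Q2 ME LE]]] := mxfun_ex (@ln R) aM.
rewrite /mxlog LE {LE}.
have uQ := unit_of_unitary Q1.
have uQ' : Q ^t* \in unitmx by rewrite unitmx_adj.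
have uD : rdiag m \in unitmx.
  have : Q ^t* *m rdiag m *m Q \in unitmx by rewrite -ME !unitmx_mul uT unitmx_inv uY.
  by rewrite !unitmx_mul => /andP[/andP[]].
have m0 k : m k != 0.
  move: uD; rewrite unitmxE det_rdiag unitfE (inj_eq (@complexI _)) => /prodf_neq0; exact.
have iM : invmx (T *m invmx Y *m T) = invmx T *m Y *m invmx T.
  apply: invmx_eq; rewrite !mulmxA (mulmxK uT) (mulmxKV uY); exact: mulmxV.
have iM' : invmx (T *m invmx Y *m T) = Q ^t* *m rdiag (fun k => (m k)^-1) *m Q.
  have [iQ iQ'] := (invmx_eq Q1, invmx_eq Q2).
  by rewrite ME (invmx_cong uQ m0) iQ iQ'.
have YE : hmx Y = (Q *m T) ^t* *m rdiag (fun k => (m k)^-1) *m (Q *m T).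
  have -> : (Q *m T) ^t* *m rdiag (fun k => (m k)^-1) *m (Q *m T) =
    T *m (Q ^t* *m rdiag (fun k => (m k)^-1) *m Q) *m T by rewrite adjM aT !mulmxA.
  by rewrite -iM' iM !mulmxA (mulmxV uT) mul1mx (mulmxKV uT).
have XE : hmx X = (Q *m T) ^t* *m (Q *m T).
  by rewrite adjM aT mulmxA -(mulmxA T) Q2 mulmx1 TT.
have uS : Q *m T \in unitmx by rewrite unitmx_mul uQ uT.
have mi0 := (pd_cong_diag uS YE).1 pY.
rewrite YE [in phi _]XE (phi_cong1 uS mi0) -TT.
have -> : \tr (T *m T *m (Q ^t* *m rdiag (fun j => ln (m j)) *m Q)) =
  \tr ((Q *m T) ^t* *m rdiag (fun j => ln (m j)) *m (Q *m T)).
  by rewrite -mulmxA mxtrace_mulC adjM aT !mulmxA.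
rewrite Re_tr_cong -sumrN; apply: eq_bigr => k _.
by rewrite lnV ?mulNr ?opprK// posrE -invr_gt0.
Qed.

Lemma phi_scale (a : R) X Y : 0 < a -> pd X -> pd Y ->
  phi (a%:C *: hmx X) (a%:C *: hmx Y) = a * phi X Y.
Proof.
move=> a0 pX pY; have [S [mu [uS m0 -> ->]]] := pd_cong_pd pX pY.
have sa : Num.sqrt a * Num.sqrt a = a by rewrite -expr2 sqr_sqrtr// ltW.
pose T := (Num.sqrt a)%:C *: S.
have aT A : a%:C *: (S ^t* *m A *m S) = T ^t* *m A *m T.
  have -> : T ^t* = (Num.sqrt a)%:C *: S ^t*.
    by apply/matrixP => i j; rewrite !mxE rmorphM /= conjC_real.
  by rewrite -!scalemxAl -scalemxAr scalerA -rmorphM /= sa.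
have aT1 : a%:C *: (S ^t* *m S) = T ^t* *m T by have := aT 1%:M; rewrite !mulmx1.
rewrite aT aT1 !phi_cong1//; last first.
  rewrite unitmxZ// unitfE; apply/eqP => /complexI/eqP.
  by rewrite sqrtr_eq0 leNgt a0.
rewrite mulrN mulr_sumr; congr (- _); apply: eq_bigr => k _.
rewrite mulrCA; congr (_ * _); rewrite mulr_sumr; apply: eq_bigr => j _.
by rewrite mxE nsqM nsqR sqr_sqrtr// ltW.
Qed.

(** The tangent of the logarithm at [m] lies above its graph. *)
Lemma ln_tangent (m mu : R) : 0 < m -> 0 < mu -> ln mu <= ln m + (mu / m - 1).
Proof.
move=> m0 mu0.
have e : mu = m * (1 + (mu / m - 1)) by rewrite addrC subrK mulrC divfK// gt_eqF.
have h : 0 < 1 + (mu / m - 1) by rewrite addrC subrK divr_gt0.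
rewrite {1}e lnM ?posrE// lerD2l.
by apply: le_ln1Dx; rewrite -subr_gt0 opprK addrC.
Qed.

(** In diagonal form, [phi - tr X + tr Y] is the sum of the nonnegative
    [mu k - 1 - ln (mu k)] times the weights [rownorm S k], and these are at least
    [nsq ((S v) k)] by Cauchy-Schwarz. Replacing the convex function
    [mu - 1 - ln mu] by its tangent at [m = <v, Y v> / <v, X v>], which is the
    weighted mean of the [mu k], gives the bound. *)
Lemma phi_ge X Y (v : 'cV[C]_n) : pd X -> pd Y -> v != 0 -> \sum_i nsq (v i 0) = 1 ->
  Re (\tr X) - Re (\tr Y) + (qf Y v - qf X v - qf X v * ln (qf Y v / qf X v)) <= phi X Y.
Proof.
move=> pX pY v0 v1.
have x0 := (pdP X).1 pX v v0; have y0 := (pdP Y).1 pY v v0.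
have [S [mu [uS m0 XE YE]]] := pd_cong_pd pX pY.
set m := qf Y v / qf X v; have mm0 : 0 < m by rewrite divr_gt0.
have aX : qf X v = \sum_k nsq ((S *m v) k 0).
  by rewrite XE cong_rdiag1 qf_cong qf_rdiag; apply: eq_bigr => k _; rewrite mul1r.
have aY : qf Y v = \sum_k mu k * nsq ((S *m v) k 0) by rewrite YE qf_cong qf_rdiag.
rewrite XE YE phi_cong1// -XE -YE.
have tX : Re (\tr X) = \sum_k rownorm S k by rewrite XE Re_tr_cong1.
have tY : Re (\tr Y) = \sum_k mu k * rownorm S k by rewrite YE Re_tr_cong.
rewrite tX tY -lerBrDl -sumrB -sumrN -sumrB.
apply: (le_trans (y := \sum_k (mu k - 1 - ln (mu k)) * nsq ((S *m v) k 0))); last first.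
  apply: ler_sum => k _.
  have -> : - (ln (mu k) * rownorm S k) - (rownorm S k - mu k * rownorm S k) =
    (mu k - 1 - ln (mu k)) * rownorm S k by ring.
  apply: ler_wpM2l.
    rewrite subr_ge0; have := ln_tangent ltr01 (m0 k).
    by rewrite ln1 add0r divr1.
  rewrite mxE -[leRHS]mulr1 -v1; exact: nsq_sum_le.
apply: (le_trans (y := \sum_k (mu k - 1 - (ln m + (mu k / m - 1))) * nsq ((S *m v) k 0))); last first.
  apply: ler_sum => k _; apply: ler_wpM2r; first exact: nsq_ge0.
  by rewrite lerB//; exact: ln_tangent.
have -> : \sum_k (mu k - 1 - (ln m + (mu k / m - 1))) * nsq ((S *m v) k 0) =
  (1 - m^-1) * qf Y v - ln m * qf X v.
  rewrite aX aY !mulr_sumr -sumrB; apply: eq_bigr => k _.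
  by field; rewrite gt_eqF.
rewrite le_eqVlt; apply/orP; left; apply/eqP; rewrite /m.
by move: (qf X v) (qf Y v) x0 y0 => a b a0 b0; field; rewrite !gt_eqF.
Qed.

Lemma phi_ge_tr X Y : pd X -> pd Y -> Re (\tr X) - Re (\tr Y) <= phi X Y.
Proof.
move=> pX pY; have [S [mu [uS m0 XE YE]]] := pd_cong_pd pX pY.
rewrite XE YE (phi_cong1 uS m0) Re_tr_cong1 Re_tr_cong -sumrB -sumrN.
apply: ler_sum => k _; rewrite -subr_ge0.
have -> : - (ln (mu k) * rownorm S k) - (rownorm S k - mu k * rownorm S k) =
    (mu k - 1 - ln (mu k)) * rownorm S k by ring.
rewrite mulr_ge0 ?rownorm_ge0// subr_ge0; have := ln_tangent ltr01 (m0 k).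
by rewrite ln1 add0r divr1.
Qed.

End PhiFacts.

(** * Derivatives of the entropy and of the determinant along a line *)

Section LineJets.
Context {R : realType} {n : nat}.
Local Notation C := R[i].
Local Notation Re := (@complex.Re R).
Local Notation Im := (@complex.Im R).
Implicit Types (A B S P : 'M[C]_n) (v : 'cV[C]_n) (e mu : 'I_n -> R) (X Y H K : herm R n).

Lemma near_1addM_all (m : nat) (l : 'I_m -> R) :
  \forall t \near (0 : R^o), forall k, 0 < 1 + l k * t.
Proof. 
apply: (@filter_forall R^o 'I_m (fun k t => 0 < 1 + l k * t) (nbhs (0 : R^o))) => k.
exact: near_1addM.
 Qed.

(** One congruence reduces the positive definite [W] to the identity and its
    velocity [w] to a diagonal matrix, with entries [l] at most [rho] in absolute
    value. The trace along the line is then a sum of functions of the form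
    [hasjet_ratio], for which the third derivative is [- 3 l] times the second. *)
Lemma kern_jet (s rho : R) X Y H K :
  pd (X + s *: (Y - X)) ->
  (forall v, `|qf (H + s *: (K - H)) v| <= rho * qf (X + s *: (Y - X)) v) ->
  exists d2 d3 : R, [/\ hasjet (fun t => kern s (X + t *: H) (Y + t *: K)) d2 d3,
    0 <= d2 & `|d3| <= 3 * rho * d2].
Proof.
set W := X + s *: (Y - X); set w := H + s *: (K - H) => pW hw.
have [S [l [uS WE wE]]] := pd_cong w pW.
have uS' : S ^t* \in unitmx by rewrite unitmx_adj.
have lrho k : `|l k| <= rho.
  have := hw (invmx S *m @ecol R n k); rewrite wE qf_cong mulKVmx// qf_rdiag_ecol.
  rewrite (_ : hmx W = S ^t* *m rdiag (fun=> 1) *m S); last by rewrite rdiag1 mulmx1.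
  by rewrite qf_cong mulKVmx// qf_rdiag_ecol mulr1.
pose Z0 := invmx (S ^t*) *m (Y - X); pose Z1 := invmx (S ^t*) *m (K - H).
pose u k j := Re (Z1 k j) - Re (Z0 k j) * l k.
pose u' k j := Im (Z1 k j) - Im (Z0 k j) * l k.
pose d2 := \sum_k \sum_j (2 * u k j ^+ 2 + 2 * u' k j ^+ 2).
pose d3 := \sum_k \sum_j (- 6 * l k * u k j ^+ 2 + - 6 * l k * u' k j ^+ 2).
exists d2, d3; split.
- apply: (@hasjet_near _ (fun t : R^o => \sum_k \sum_j
     ((Re (Z0 k j) + Re (Z1 k j) * t) ^+ 2 * (1 + l k * t)^-1 +
      (Im (Z0 k j) + Im (Z1 k j) * t) ^+ 2 * (1 + l k * t)^-1))); last first.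
    apply: hasjet_sum => k; apply: hasjet_sum => j.
    by apply: hasjetD; exact: hasjet_ratio.
  have pos := near_1addM_all l.
  apply: filterS pos => t post.
  set Xt := X + t *: H; set Yt := Y + t *: K.
  have WtE : Wmx s Xt Yt = S ^t* *m rdiag (fun k => 1 + l k * t) *m S.
    rewrite -[Wmx s Xt Yt]/(Wmx s (hmx X + t%:C *: hmx H) (hmx Y + t%:C *: hmx K)) Wmx_line.
    rewrite -[Wmx s X Y]/(hmx W) -[Wmx s H K]/(hmx w) WE wE; exact: cong_rdiag_line.
  pose Z := Z0 + t%:C *: Z1.
  have VE : hmx Yt - hmx Xt = S ^t* *m Z.
    rewrite /Z /Z0 /Z1 mulmxDr -scalemxAr !mulKVmx//= opprD addrACA; congr (_ + _).
    by rewrite scalerBr.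
  have VE' : hmx Yt - hmx Xt = Z ^t* *m S.
    have := hermE (Yt - Xt); rewrite /= VE => <-; by rewrite adjM trmxCK.
  rewrite /kern WtE invmx_cong//; last by move=> k; rewrite gt_eqF.
  rewrite [X in _ = Re (\tr (X *m _ *m _))]VE' VE.
  rewrite !mulmxA mulmxK// mulmxKV// Re_tr_cong.
  apply: eq_bigr => k _; rewrite /rownorm mulr_sumr; apply: eq_bigr => j _.
  have -> : Z k j = Z0 k j + t%:C * Z1 k j by rewrite /Z [LHS]mxE; congr (_ + _); rewrite [LHS]mxE.
  exact/esym/nsq_line.
- by rewrite /d2; apply: sumr_ge0 => k _; apply: sumr_ge0 => j _; rewrite addr_ge0// mulr_ge0// sqr_ge0.
- rewrite /d3 /d2 mulr_sumr; apply: (le_trans (ler_norm_sum _ _ _)); apply: ler_sum => k _.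
  rewrite mulr_sumr; apply: (le_trans (ler_norm_sum _ _ _)); apply: ler_sum => j _.
  rewrite -mulrDr !normrM normrN (ger0_norm (_ : 0 <= 6))//.
  rewrite (@ger0_norm _ (u k j ^+ 2 + _)) ?addr_ge0 ?sqr_ge0//.
  have -> : 3 * rho * (2 * u k j ^+ 2 + 2 * u' k j ^+ 2) = 6 * rho * (u k j ^+ 2 + u' k j ^+ 2) by ring.
  by apply: ler_wpM2r; [rewrite addr_ge0 ?sqr_ge0|apply: ler_wpM2l].
Qed.

Lemma Re_det_cong S (d : 'I_n -> R) : Re (\det (S ^t* *m rdiag d *m S)) = nsq (\det S) * \prod_k d k.
Proof.
rewrite !det_mulmx det_map_mx det_tr det_rdiag mulrAC mulrC ReZ mulrC.
by rewrite -Re_conj_mul.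
Qed.

Lemma ln_prod (m : nat) (F : 'I_m -> R) : (forall i, 0 < F i) ->
  ln (\prod_i F i) = \sum_i ln (F i).
Proof.
move=> F0; suff [] : 0 < \prod_i F i /\ ln (\prod_i F i) = \sum_i ln (F i) by [].
elim/big_rec2 : _ => [|k y z _ [z0 IH]]; first by rewrite ln1.
by rewrite mulr_gt0// lnM ?posrE// IH.
Qed.

(** After simultaneous diagonalization, the second derivative [d2] is the sum of
    the squares of the eigenvalues [l] of [H] relative to [X]. It therefore bounds
    each of them, which gives the last clause. *)
Lemma logdet_jet X H : pd X -> exists d2 d3 : R,
  [/\ hasjet (fun t => - logdet (X + t *: H)) d2 d3, 0 <= d2,
    `|d3| <= 2 * d2 * Num.sqrt d2 &
    forall v, `|qf H v| <= Num.sqrt d2 * qf X v].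
Proof.
move=> pX; have [S [l [uS XE HE]]] := pd_cong H pX.
have d20 : 0 <= \sum_k l k ^+ 2 by apply: sumr_ge0 => k _; exact: sqr_ge0.
have lle k : `|l k| <= Num.sqrt (\sum_k l k ^+ 2).
  rewrite -sqrtr_sqr ler_wsqrtr// (bigD1 k)//= lerDl.
  by apply: sumr_ge0 => j _; exact: sqr_ge0.
have dS : 0 < nsq (\det S) by rewrite nsq_gt0 -unitfE -unitmxE.
exists (\sum_k l k ^+ 2), (\sum_k (- 2 * l k ^+ 3)); split => //.
- apply: (@hasjet_near _ (fun t : R^o => - ln (nsq (\det S)) + \sum_k (- ln (1 + l k * t)))); last first.
    rewrite -[\sum_k l k ^+ 2]add0r -[\sum_k (- 2 * _)]add0r.
    apply: hasjetD; first exact: hasjet_cst.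
    by apply: hasjet_sum => k; exact: hasjet_ln.
  have pos := near_1addM_all l.
  apply: filterS pos => t post.
  have XtE : hmx (X + t *: H) = S ^t* *m rdiag (fun k => 1 + l k * t) *m S.
    by rewrite /= XE HE; exact: cong_rdiag_line.
  rewrite /logdet XtE Re_det_cong lnM ?posrE// ?prodr_gt0//.
  by rewrite opprD ln_prod// sumrN.
- apply: (le_trans (ler_norm_sum _ _ _)).
  rewrite [leRHS]mulrAC mulr_sumr; apply: ler_sum => k _.
  rewrite (normrM (- 2)) normrN (ger0_norm (_ : 0 <= 2))// normrX exprS mulrA.
  have -> : `|l k| ^+ 2 = l k ^+ 2 by rewrite real_normK ?num_real.
  by apply: ler_wpM2r; [exact: sqr_ge0|apply: ler_wpM2l].
- move=> v.
  have -> : qf X v = \sum_k nsq ((S *m v) k 0).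
    rewrite XE -[S in _ *m S]mul1mx -rdiag1 mulmxA qf_cong qf_rdiag.
    by apply: eq_bigr => k _; rewrite mul1r.
  rewrite HE qf_cong qf_rdiag mulr_sumr; apply: (le_trans (ler_norm_sum _ _ _)).
  apply: ler_sum => k _; rewrite normrM (ger0_norm (nsq_ge0 _)).
  by apply: ler_wpM2r; [exact: nsq_ge0|].
Qed.

End LineJets.

(** * Smoothness of matrix expressions *)

Section CkComplex.
Context {R : realType} {E : normedModType R}.
Local Notation C := R[i].
Local Notation Re := (@complex.Re R).
Local Notation Im := (@complex.Im R).
Variables (U : set E) (k : nat).
Hypothesis oU : open U.
Implicit Types f g : E -> C.

Definition Ckc f := Ck k U (fun x => Re (f x) : R^o) /\ Ck k U (fun x => Im (f x) : R^o).

Lemma Ckc_eq f g : (forall x, U x -> f x = g x) -> Ckc f -> Ckc g.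
Proof. by move=> fg [h1 h2]; split; [apply: Ck_eq h1|apply: Ck_eq h2] => // x /fg ->. Qed.

Lemma Ckc_cst (c : C) : Ckc (fun=> c).
Proof. by split; exact: Ck_cst. Qed.

Lemma CkcD f g : Ckc f -> Ckc g -> Ckc (fun x => f x + g x).
Proof.
move=> [f1 f2] [g1 g2]; split.
  by apply: Ck_eq (CkD oU f1 g1) => // x _; rewrite ReD.
by apply: Ck_eq (CkD oU f2 g2) => // x _; rewrite ImD.
Qed.

Lemma CkcN f : Ckc f -> Ckc (fun x => - f x).
Proof.
move=> [f1 f2]; split.
  by apply: Ck_eq (CkN oU f1) => // x _; rewrite ReN.
by apply: Ck_eq (CkN oU f2) => // x _; rewrite ImN.
Qed.

Lemma CkcM f g : Ckc f -> Ckc g -> Ckc (fun x => f x * g x).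
Proof.
move=> [f1 f2] [g1 g2]; split.
  by apply: Ck_eq (CkD oU (CkM oU f1 g1) (CkN oU (CkM oU f2 g2))) => // x _; rewrite ReM.
by apply: Ck_eq (CkD oU (CkM oU f1 g2) (CkM oU f2 g1)) => // x _; rewrite ImM.
Qed.

Lemma CkcV f : (forall x, U x -> f x != 0) -> Ckc f -> Ckc (fun x => (f x)^-1).
Proof.
move=> f0 [f1 f2].
have N : Ck k U (fun x => nsq (f x) : R^o) := CkD oU (CkM oU f1 f1) (CkM oU f2 f2).
have nz x : U x -> nsq (f x) != 0 by move=> Ux; rewrite nsq_eq0 f0.
have iN := CkV oU nz N.
have E1 x : (f x)^-1 = Complex (Re (f x) * (nsq (f x))^-1) (- Im (f x) * (nsq (f x))^-1).
  by rewrite /nsq; case: (f x) => a b /=; rewrite mulNr.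
split.
  by apply: Ck_eq (CkM oU f1 iN) => // x _; rewrite E1.
by apply: Ck_eq (CkM oU (CkN oU f2) iN) => // x _; rewrite E1.
Qed.

Lemma Ckc_sum (I : Type) (r : seq I) (P : pred I) (F : I -> E -> C) :
  (forall i, P i -> Ckc (F i)) -> Ckc (fun x => \sum_(i <- r | P i) F i x).
Proof.
move=> H; elim: r => [|i r IH].
  by under eq_fun do rewrite big_nil; exact: Ckc_cst.
under eq_fun do rewrite big_cons; case Pi: (P i) => //.
by apply: CkcD => //; exact: H.
Qed.

Lemma Ckc_prod (I : Type) (r : seq I) (P : pred I) (F : I -> E -> C) :
  (forall i, P i -> Ckc (F i)) -> Ckc (fun x => \prod_(i <- r | P i) F i x).
Proof.
move=> H; elim: r => [|i r IH].
  by under eq_fun do rewrite big_nil; exact: Ckc_cst.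
under eq_fun do rewrite big_cons; case Pi: (P i) => //.
by apply: CkcM => //; exact: H.
Qed.

Definition Ckm m p (A : E -> 'M[C]_(m, p)) := forall i j, Ckc (fun x => A x i j).

Lemma CkmD m p (A B : E -> 'M[C]_(m, p)) : Ckm A -> Ckm B -> Ckm (fun x => A x + B x).
Proof. by move=> cA cB i j; under eq_fun do rewrite mxE; exact: CkcD. Qed.

Lemma CkmN m p (A : E -> 'M[C]_(m, p)) : Ckm A -> Ckm (fun x => - A x).
Proof. by move=> cA i j; under eq_fun do rewrite mxE; exact: CkcN. Qed.

Lemma CkmM m p q (A : E -> 'M[C]_(m, p)) (B : E -> 'M[C]_(p, q)) :
  Ckm A -> Ckm B -> Ckm (fun x => A x *m B x).
Proof.
move=> cA cB i j; under eq_fun do rewrite mxE.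
by apply: Ckc_sum => l _; exact: CkcM.
Qed.

Lemma Ck_det m (A : E -> 'M[C]_m) : Ckm A -> Ckc (fun x => \det (A x)).
Proof.
move=> cA; apply: Ckc_sum => s _; apply: CkcM; first exact: Ckc_cst.
by apply: Ckc_prod => i _; exact: cA.
Qed.

(** Cramer's rule writes the entries as quotients of polynomials. *)
Lemma Ckm_inv m (A : E -> 'M[C]_m) : (forall x, U x -> A x \in unitmx) ->
  Ckm A -> Ckm (fun x => invmx (A x)).
Proof.
move=> uA cA i j.
apply: (@Ckc_eq (fun x => (\det (A x))^-1 * ((-1) ^+ (j + i) * \det (row' j (col' i (A x)))))).
  by move=> x Ux; rewrite /invmx uA// !mxE.
apply: CkcM.
  by apply: CkcV; [move=> x /uA; rewrite unitmxE unitfE|exact: Ck_det].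
apply: CkcM; first exact: Ckc_cst.
by apply: Ck_det => a b; under eq_fun do rewrite !mxE; exact: cA.
Qed.

Lemma Ck_Re_tr m (A : E -> 'M[C]_m) : Ckm A -> Ck k U (fun x => Re (\tr (A x)) : R^o).
Proof. by move=> cA; have [] := @Ckc_sum _ (index_enum 'I_m) xpredT _ (fun i _ => cA i i). Qed.

End CkComplex.

(** * Topology of Hermitian matrices and smoothness of the entropy *)

Lemma lipschitz_continuous {R : realType} {E : normedModType R} (f : E -> R^o) (K : R) :
  (forall x y, `|f x - f y| <= K * `|x - y|) -> continuous f.
Proof.
move=> H x; apply/cvgrPdist_lt => e e0.
have K1 : 0 < `|K| + 1 by rewrite ltr_wpDl.
near=> y.
apply: (le_lt_trans (H x y)).
apply: (le_lt_trans (y := (`|K| + 1) * `|x - y|)).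
  by apply: ler_wpM2r => //; rewrite (le_trans (ler_norm _))// lerDl.
rewrite mulrC -ltr_pdivlMr//; near: y.
by apply: (@cvgr_dist_lt _ _ _ (nbhs x) _ id); [exact: cvg_id|exact: divr_gt0].
Unshelve. all: by end_near. Qed.

Section Projections.
Variables T U V W : topologicalType.

Lemma fst_fst_continuous : continuous (fun p : T * U * V => p.1.1).
Proof. by move=> p; apply: (@continuous_comp _ _ _ (fun p : T * U * V => p.1) fst); exact: cvg_fst. Qed.

Lemma fst_snd_continuous : continuous (fun p : T * U * V => p.1.2).
Proof.
move=> p; apply: (@continuous_comp _ _ _ (fun p : T * U * V => p.1) snd).
  exact: cvg_fst.
exact: cvg_snd.
Qed.

Lemma snd_fst_fst_continuous : continuous (fun q : W * (T * U * V) => q.2.1.1).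
Proof.
move=> q; apply: (@continuous_comp _ _ _ snd (fun p : T * U * V => p.1.1)).
  exact: cvg_snd.
exact: fst_fst_continuous.
Qed.

Lemma snd_fst_snd_continuous : continuous (fun q : W * (T * U * V) => q.2.1.2).
Proof.
move=> q; apply: (@continuous_comp _ _ _ snd (fun p : T * U * V => p.1.2)).
  exact: cvg_snd.
exact: fst_snd_continuous.
Qed.

End Projections.

Section HermTopology.
Context {R : realType} {n : nat}.
Local Notation C := R[i].
Local Notation Re := (@complex.Re R).
Local Notation Im := (@complex.Im R).
Local Notation H2 := (herm R n * herm R n * R^o)%type.
Implicit Types (X Y H K : herm R n) (v : 'cV[C]_n).

Lemma le_mx_entry m p (A : 'M[R]_(m, p)) i j : `|A i j| <= `|A|.
Proof.
rewrite [X in _ <= X]mx_normrE.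
exact: (le_bigmax _ (fun ij : 'I_m * 'I_p => `|A ij.1 ij.2|) (i, j)).
Qed.

Lemma entry_le_norm X i j : `|Re (X i j)| + `|Im (X i j)| <= `|X|.
Proof.
apply: lerD.
  by have := le_mx_entry (map_mx (@complex.Re R) X) i j; rewrite mxE.
by have := le_mx_entry (map_mx (@complex.Im R) X) i j; rewrite mxE.
Qed.

Definition sqnorm v : R := \sum_i nsq (v i 0).

Lemma sqnorm_ge0 v : 0 <= sqnorm v.
Proof. by apply: sumr_ge0 => i _; exact: nsq_ge0. Qed.

Lemma sqnorm_gt0 v : v != 0 -> 0 < sqnorm v.
Proof.
case/cV0Pn => k vk; rewrite /sqnorm (bigD1 k)//= ltr_wpDr ?nsq_gt0//.
by apply: sumr_ge0 => i _; exact: nsq_ge0.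
Qed.

Lemma nsq_le_sqnorm v i : nsq (v i 0) <= sqnorm v.
Proof. by rewrite /sqnorm (bigD1 i)//= lerDl; apply: sumr_ge0 => j _; exact: nsq_ge0. Qed.

Lemma qf1 v : qf (1%:M : 'M[C]_n) v = sqnorm v.
Proof. by rewrite -rdiag1 qf_rdiag; apply: eq_bigr => i _; rewrite mul1r. Qed.

Lemma qfE (A : 'M[C]_n) v : qf A v = \sum_i \sum_j Re (Num.conj (v i 0) * A i j * v j 0).
Proof.
rewrite /qf mxE Re_sum exchange_big; apply: eq_bigr => j _.
by rewrite mxE mulr_suml Re_sum; apply: eq_bigr => i _; rewrite !mxE.
Qed.

Lemma Re_conj_abs (z w : C) : `|Re (Num.conj z * w)| <= (nsq z + nsq w) / 2.
Proof.
rewrite ler_norml Re_conj_le andbT lerNl.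
have := Re_conj_le z (- w); rewrite mulrN ReN; congr (_ <= (_ + _) / _).
by rewrite /nsq ReN ImN !sqrrN.
Qed.

Lemma Im_conj_abs (z w : C) : `|Im (Num.conj z * w)| <= (nsq z + nsq w) / 2.
Proof.
have := Re_conj_abs z (Complex 0 (-1) * w).
have -> : Re (Num.conj z * (Complex 0 (-1) * w)) = Im (Num.conj z * w).
  by rewrite !ReM !ImM /=; ring.
by rewrite nsqM {2}/nsq /= expr0n sqrrN expr1n add0r mul1r.
Qed.

Lemma qf_term_le (h z w : C) M : nsq z <= M -> nsq w <= M ->
  `|Re (Num.conj z * h * w)| <= (`|Re h| + `|Im h|) * M.
Proof.
move=> zM wM; have -> : Num.conj z * h * w = h * (Num.conj z * w) by ring.
have M2 : (nsq z + nsq w) / 2 <= M by rewrite ler_pdivrMr// mulr_natr mulr2n lerD.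
rewrite ReM mulrDl; apply: (le_trans (ler_normB _ _)).
rewrite !normrM; apply: lerD; apply: ler_wpM2l => //; apply: le_trans M2.
  exact: Re_conj_abs.
exact: Im_conj_abs.
Qed.

Lemma qf_le_norm X v : `|qf X v| <= (n * n)%:R * `|X| * sqnorm v.
Proof.
rewrite qfE; apply: (le_trans (ler_norm_sum _ _ _)).
have -> : (n * n)%:R * `|X| * sqnorm v = \sum_(i < n) \sum_(j < n) (`|X| * sqnorm v).
  by rewrite !sumr_const !card_ord -mulrnA -[RHS]mulr_natl mulrA.
apply: ler_sum => i _; apply: (le_trans (ler_norm_sum _ _ _)); apply: ler_sum => j _.
apply: (le_trans (qf_term_le _ (nsq_le_sqnorm v i) (nsq_le_sqnorm v j))).
by apply: ler_wpM2r; [exact: sqnorm_ge0|exact: entry_le_norm].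
Qed.

Lemma qfB (A B : 'M[C]_n) v : qf (A - B) v = qf A v - qf B v.
Proof. by rewrite /qf mulmxBr mulmxBl mxE ReD; congr (_ + _); rewrite mxE ReN. Qed.

Lemma qf_continuous v : continuous (fun X : herm R n => qf X v : R^o).
Proof.
apply: (@lipschitz_continuous _ _ _ ((n * n)%:R * sqnorm v)) => X Y.
by rewrite -qfB mulrAC; exact: (qf_le_norm (X - Y)).
Qed.

Lemma Re_entry_continuous i j : continuous (fun X : herm R n => Re (X i j) : R^o).
Proof.
apply: (@lipschitz_continuous _ _ _ 1) => X Y; rewrite mul1r.
have := entry_le_norm (X - Y) i j; rewrite /= !mxE ReD ReN; apply: le_trans.
by rewrite lerDl.
Qed.

Lemma Im_entry_continuous i j : continuous (fun X : herm R n => Im (X i j) : R^o).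
Proof.
apply: (@lipschitz_continuous _ _ _ 1) => X Y; rewrite mul1r.
have := entry_le_norm (X - Y) i j; rewrite /= !mxE ImD ImN; apply: le_trans.
by rewrite lerDr.
Qed.

(** Diagonalizing the identity relative to [X] gives [I <= c X], a uniform form
    of positivity; this makes positive definiteness an open condition. *)
Lemma pd_coercive X : pd X -> exists2 c, 0 < c & forall v, sqnorm v <= c * qf X v.
Proof.
move=> pX; have [S [d [uS XE E1]]] := pd_cong (@herm1 R n) pX.
pose c := 1 + \sum_k `|d k|.
have dc k : d k <= c.
  rewrite (le_trans (ler_norm _))// /c (bigD1 k)//= addrCA lerDl addr_ge0//.
  by apply: sumr_ge0.
exists c; first by rewrite ltr_pwDl// sumr_ge0.
move=> v; rewrite -qf1 -[1%:M]/(hmx (@herm1 R n)) E1 XE.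
have -> : S ^t* *m S = S ^t* *m rdiag (fun=> 1) *m S by rewrite rdiag1 mulmx1.
rewrite !qf_cong !qf_rdiag mulr_sumr; apply: ler_sum => k _.
by rewrite mul1r; apply: ler_wpM2r => //; exact: nsq_ge0.
Qed.

Lemma open_pd : open [set X : herm R n | pd X].
Proof.
rewrite openE => X /= pX; have [c c0 Hc] := pd_coercive pX.
pose N : R := (n * n)%:R + 1.
have N0 : 0 < N by rewrite ltr_wpDl.
apply/nbhs_ballP; exists (c * N)^-1; first by rewrite /= invr_gt0 mulr_gt0.
move=> Y; rewrite -ball_normE /= => XY; apply/pdP => v v0.
have -> : hmx Y = hmx X - (hmx X - hmx Y) by rewrite opprB addrC subrK.
have v2 := sqnorm_gt0 v0.
rewrite qfB subr_gt0 (le_lt_trans (ler_norm _))//.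
apply: (le_lt_trans (qf_le_norm (X - Y) v)).
have qX : sqnorm v / c <= qf X v by rewrite ler_pdivrMr// mulrC.
apply: lt_le_trans qX; rewrite [ltRHS]mulrC ltr_pM2r//.
apply: (le_lt_trans (y := N * `|X - Y|)).
  by apply: ler_wpM2r => //; rewrite lerDl.
by rewrite mulrC -ltr_pdivlMr// -invfM.
Qed.

Definition pd_pair : set H2 := [set p | pd p.1.1 /\ pd p.1.2].

Lemma open_pd_pair : open pd_pair.
Proof.
have -> : pd_pair = ((fun p : H2 => p.1.1) @^-1` [set X | pd X]) `&` ((fun p : H2 => p.1.2) @^-1` [set X | pd X]) by [].
apply: openI; apply: open_comp (open_pd) => p _.
  exact: fst_fst_continuous.
exact: fst_snd_continuous.
Qed.

Definition Wh (q : R^o * H2) : herm R n := q.2.1.1 + q.1 *: (q.2.1.2 - q.2.1.1).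

Lemma Wh_continuous : continuous Wh.
Proof.
move=> q.
have cX := @snd_fst_fst_continuous (herm R n) (herm R n) R^o R^o q.
have cY := @snd_fst_snd_continuous (herm R n) (herm R n) R^o R^o q.
by apply: cvgD => //; apply: cvgZ; [exact: cvg_fst|exact: cvgB].
Qed.

Definition pd_slab : set (R^o * H2) := [set q | pd (Wh q)].

Lemma open_pd_slab : open pd_slab.
Proof. by apply: (open_comp (f := Wh)) open_pd => q _; exact: Wh_continuous. Qed.

Lemma qf_conv (s : R) (A B : 'M[C]_n) v : qf (A + s%:C *: (B - A)) v = (1 - s) * qf A v + s * qf B v.
Proof. by rewrite qfD qfZ qfB; move: (qf A v) (qf B v) => a b; ring. Qed.

Lemma pd_conv (s : R) X Y : 0 <= s <= 1 -> pd X -> pd Y -> pd (X + s *: (Y - X)).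
Proof.
move=> /andP[s0 s1] /pdP pX /pdP pY; apply/pdP => v v0; rewrite qf_conv.
have [->|sn0] := eqVneq s 0; first by rewrite subr0 mul0r addr0 mul1r pX.
apply: ltr_wpDl; first by rewrite mulr_ge0 ?subr_ge0// ltW// pX.
by rewrite mulr_gt0 ?pY// lt_neqAle eq_sym sn0.
Qed.

Lemma pd_pair_pd_slab (s : R^o) (p : H2) : 0 <= s <= 1 -> pd_pair p -> pd_slab (s, p).
Proof. by move=> s01 [pX pY]; exact: (pd_conv s01 pX pY). Qed.

Lemma Ckm_lin (E : normedModType R) k (U : set E) (L : E -> herm R n) : open U ->
  continuous L -> (forall (a : R) x y, L (a *: x + y) = a *: L x + L y) ->
  Ckm U k (fun x => hmx (L x)).
Proof.
move=> oU cL lL i j; split; apply: Ck_lin => //.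
- by move=> x; apply: (@continuous_comp _ _ _ L (fun X : herm R n => Re (X i j) : R^o)); [exact: cL|exact: Re_entry_continuous].
- by move=> a x y; rewrite lL /= !mxE ReD ReZ.
- by move=> x; apply: (@continuous_comp _ _ _ L (fun X : herm R n => Im (X i j) : R^o)); [exact: cL|exact: Im_entry_continuous].
- by move=> a x y; rewrite lL /= !mxE ImD ImZ.
Qed.

Lemma Ck_kern k : Ck k pd_slab (fun q : R^o * H2 => q.1 * kern q.1 q.2.1.1 q.2.1.2 : R^o).
Proof.
have oW := open_pd_slab.
have C1 : Ck k pd_slab (fun q : R^o * H2 => q.1 : R^o).
  by apply: Ck_lin => // q; exact: cvg_fst.
apply: CkM => //.
have cX : Ckm pd_slab k (fun q : R^o * H2 => hmx q.2.1.1).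
  apply: (@Ckm_lin _ _ _ (fun q : R^o * H2 => q.2.1.1)) => //.
  exact: snd_fst_fst_continuous.
have cY : Ckm pd_slab k (fun q : R^o * H2 => hmx q.2.1.2).
  apply: (@Ckm_lin _ _ _ (fun q : R^o * H2 => q.2.1.2)) => //.
  exact: snd_fst_snd_continuous.
have cV := CkmD oW cY (CkmN oW cX).
have cs : Ckc pd_slab k (fun q : R^o * H2 => (q.1)%:C).
  by split => //=; exact: Ck_cst.
have cW : Ckm pd_slab k (fun q : R^o * H2 => hmx (Wh q)).
  move=> i j; rewrite /Wh /=; under eq_fun do rewrite !mxE.
  exact: (CkcD oW (cX i j) (CkcM oW cs (CkcD oW (cY i j) (CkcN oW (cX i j))))).
have uW q : pd_slab q -> hmx (Wh q) \in unitmx by exact: pd_unitmx.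
have ci := Ckm_inv oW uW cW.
exact: (Ck_Re_tr oW (CkmM oW (CkmM oW cV ci) cV)).
Qed.

Lemma Ck_phi k : Ck k pd_pair (fun p : H2 => phi p.1.1 p.1.2 : R^o).
Proof.
have oU := open_pd_pair.
have cX : Ckm pd_pair k (fun p : H2 => hmx p.1.1).
  by apply: (@Ckm_lin _ _ _ (fun p : H2 => p.1.1)) => //; exact: fst_fst_continuous.
have cY : Ckm pd_pair k (fun p : H2 => hmx p.1.2).
  by apply: (@Ckm_lin _ _ _ (fun p : H2 => p.1.2)) => //; exact: fst_snd_continuous.
apply: CkD => //.
  by apply: CkD => //; [exact: Ck_Re_tr|apply: CkN => //; exact: Ck_Re_tr].
exact: (Ck_int01 oU pd_pair_pd_slab (Ck_kern k)).
Qed.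

Lemma Re_det_gt0 X : pd X -> 0 < Re (\det X).
Proof.
move=> /pd_factor [S uS ->].
rewrite -[S in _ *m S]mul1mx -rdiag1 mulmxA Re_det_cong.
by rewrite mulr_gt0 ?prodr_gt0// nsq_gt0 -unitfE -unitmxE.
Qed.

Lemma Ck_logdet1 k : Ck k pd_pair (fun p : H2 => logdet p.1.1 : R^o).
Proof.
have oU := open_pd_pair; apply: Ck_ln => //; first by move=> p [+ _] => /Re_det_gt0.
suff [] : Ckc pd_pair k (fun p : H2 => \det (hmx p.1.1)) by [].
apply: Ck_det => //.
by apply: (@Ckm_lin _ _ _ (fun p : H2 => p.1.1)) => //; exact: fst_fst_continuous.
Qed.

Lemma Ck_logdet2 k : Ck k pd_pair (fun p : H2 => logdet p.1.2 : R^o).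
Proof.
have oU := open_pd_pair; apply: Ck_ln => //; first by move=> p [_ +] => /Re_det_gt0.
suff [] : Ckc pd_pair k (fun p : H2 => \det (hmx p.1.2)) by [].
apply: Ck_det => //.
by apply: (@Ckm_lin _ _ _ (fun p : H2 => p.1.2)) => //; exact: fst_snd_continuous.
Qed.

End HermTopology.

(** * Self-concordance of the barrier *)

Lemma conv_norm_le {R : realDomainType} (s a b c d rho : R) : 0 <= s <= 1 ->
  `|a| <= rho * c -> `|b| <= rho * d ->
  `|(1 - s) * a + s * b| <= rho * ((1 - s) * c + s * d).
Proof.
move=> /andP[s0 s1] ac bd; apply: (le_trans (ler_normD _ _)).
rewrite !normrM (ger0_norm s0) ger0_norm ?subr_ge0//.
rewrite mulrDr (mulrCA rho) (mulrCA rho s); apply: lerD; apply: ler_wpM2l => //.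
by rewrite subr_ge0.
Qed.

(** [zi] stands for [1 / slack], [z1] for the slope of [slack], and [j2], [j3]
    for the higher derivatives of [phi]; the left-hand sides are those of
    [iterD2_lnbarrier] and [iterD3_lnbarrier]. *)
Lemma sc_combine {R : realType} (zi z1 j2 j3 b3 r : R) : 0 <= zi -> 0 <= j2 -> 0 <= r ->
  `|j3| <= 3 * r * j2 -> `|b3| <= 2 * r ^+ 3 ->
  let f2 := (zi * z1) ^+ 2 - zi * - j2 + r ^+ 2 in
  0 <= f2 /\
  `|- (zi * - j3) + 3 * (zi * z1) * (zi * - j2) - 2 * (zi * z1) ^+ 3 + b3| <= 2 * f2 `^ (3 / 2).
Proof.
move=> zi0 j20 r0 j32 b32 f2; set a := zi * z1.
have b0 : 0 <= zi * j2 by rewrite mulr_ge0.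
have -> : f2 = a ^+ 2 + zi * j2 + r ^+ 2 by rewrite /f2 -/a; ring.
split; first by rewrite !addr_ge0// sqr_ge0.
have -> : - (zi * - j3) + 3 * a * (zi * - j2) - 2 * a ^+ 3 + b3 =
  - (zi * - j3) - 3 * a * (zi * j2) - 2 * a ^+ 3 + b3 by ring.
apply: sc_ineq => //.
by rewrite normrM normrN (ger0_norm zi0) (mulrCA (3 * r)); apply: ler_wpM2l.
Qed.

Section Barrier.
Context {R : realType} {n : nat}.
Local Notation C := R[i].
Local Notation Re := (@complex.Re R).
Local Notation H2 := (herm R n * herm R n * R^o)%type.
Implicit Types (X Y H K : herm R n) (v : 'cV[C]_n) (p x h : H2).

Definition phi2 p : R^o := phi p.1.1 p.1.2.

Let L p : R^o := Re (\tr p.1.1) - Re (\tr p.1.2).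
Let g (q : R^o * H2) : R^o := q.1 * kern q.1 q.2.1.1 q.2.1.2.
Let J p : R^o := int01 (fun s => g (s, p)).

Let CL k : Ck k (@pd_pair R n) L.
Proof.
have oU := @open_pd_pair R n.
have cX : Ckm (@pd_pair R n) k (fun p : H2 => hmx p.1.1).
  by apply: (@Ckm_lin _ _ _ _ _ (fun p : H2 => p.1.1)) => //; exact: fst_fst_continuous.
have cY : Ckm (@pd_pair R n) k (fun p : H2 => hmx p.1.2).
  by apply: (@Ckm_lin _ _ _ _ _ (fun p : H2 => p.1.2)) => //; exact: fst_snd_continuous.
by apply: CkD => //; [exact: Ck_Re_tr|apply: CkN => //; exact: Ck_Re_tr].
Qed.

Let CJ k : Ck k (@pd_pair R n) J.
Proof. exact: (Ck_int01 (@open_pd_pair R n) (@pd_pair_pd_slab R n) (@Ck_kern R n k)). Qed.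

Lemma lin_tr (a : R) (A B : 'M[C]_n) : Re (\tr (a%:C *: A + B)) = a * Re (\tr A) + Re (\tr B).
Proof. by rewrite mxtraceD mxtraceZ ReD ReZ. Qed.

(** The bound of [kern_jet] is integrated over [s]. Its hypothesis is preserved
    by convex combinations, hence holds for every [W_s] with the same [rho]. The
    trace terms of [phi] are linear and do not contribute. *)
Lemma phi2_D23 x h (rho : R) : pd_pair x ->
  (forall v, `|qf h.1.1 v| <= rho * qf x.1.1 v) ->
  (forall v, `|qf h.1.2 v| <= rho * qf x.1.2 v) ->
  0 <= iterD 2 h phi2 x /\ `|iterD 3 h phi2 x| <= 3 * rho * iterD 2 h phi2 x.
Proof.
move=> Ux hX hY; have oU := @open_pd_pair R n; have [pX pY] := Ux.
have lL (a : R) p q : L (a *: p + q) = a * L p + L q.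
  by rewrite /L /= !lin_tr; ring.
have E k : (k.+2 <= 3)%N -> iterD k.+2 h phi2 x = iterD k.+2 h J x.
  move=> k3; rewrite (@iterDD _ _ k.+2 _ L J h x oU (CL _) (CJ _) Ux).
  by rewrite iterD_lin// add0r.
rewrite !E//.
have EJ k : (k <= 3)%N -> iterD k h J x = int01 (fun s => iterD k ((0 : R^o), h) g (s, x)).
  by move=> k3; apply: (@iterD_int01 _ _ k 3 _ _ g h x oU (@pd_pair_pd_slab R n) (@Ck_kern R n 3) k3 Ux).
have cg k : (k <= 3)%N -> cont01 (fun s => iterD k ((0 : R^o), h) g (s, x)).
  move=> k3; apply: (@cont01_slice _ _ (iterD k ((0 : R^o), h) g)) => s s01.
  have C0 : Ck 0 (@pd_slab R n) (iterD k ((0 : R^o), h) g).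
    by apply: Ck_iterD; rewrite addn0; exact: Ck_kern.
  by apply: (Ck_cont C0); exact: pd_pair_pd_slab.
have key (s : R) : 0 <= s <= 1 ->
   0 <= iterD 2 ((0 : R^o), h) g (s, x) /\
   `|iterD 3 ((0 : R^o), h) g (s, x)| <= 3 * rho * iterD 2 ((0 : R^o), h) g (s, x).
  move=> s01; have Wx : pd_slab ((s : R^o), x) by exact: pd_pair_pd_slab.
  have /andP[s0 s1] := s01.
  have hW v : `|qf (h.1.1 + s *: (h.1.2 - h.1.1)) v| <= rho * qf (x.1.1 + s *: (x.1.2 - x.1.1)) v.
    by rewrite !qf_conv; exact: conv_norm_le.
  have [d2 [d3 [jet d20 d32]]] := kern_jet Wx hW.
  have jet' : hasjet (fun t : R => g ((s, x) + t *: ((0 : R^o), h))) (s * d2) (s * d3).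
    rewrite (_ : (fun t : R => _) = fun t => s * kern s (x.1.1 + t *: h.1.1) (x.1.2 + t *: h.1.2)).
      exact: hasjetZ.
    by apply/funext => t; rewrite /g /= scaler0 addr0.
  have [-> ->] := iterD_hasjet (@open_pd_slab R n) (@Ck_kern R n 3) Wx jet'.
  split; first by rewrite mulr_ge0.
  by rewrite normrM (ger0_norm s0) mulrCA; apply: ler_wpM2l.
rewrite !EJ//; split.
  by apply: int01_ge0 => s /key [].
by apply: int01_norm_leZ (cg 3%N isT) (cg 2%N isT) _ => s /key [].
Qed.

(** The domain of the barrier, by [dom_barrier]. *)
Definition strict_epi : set H2 := [set p | pd_pair p /\ phi2 p < p.2].

Definition slack p : R^o := p.2 - phi2 p.
Definition logdet_bar p : R^o := - logdet p.1.1 - logdet p.1.2.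
Definition barrier_fun p : R^o := - ln (slack p) + logdet_bar p.

Lemma Ck_slack k : Ck k (@pd_pair R n) slack.
Proof.
have oU := @open_pd_pair R n.
apply: CkD => //; last by apply: CkN => //; exact: Ck_phi.
by apply: Ck_lin => // p; exact: cvg_snd.
Qed.

Lemma Ck_logdet_bar k : Ck k (@pd_pair R n) logdet_bar.
Proof.
have oU := @open_pd_pair R n.
by apply: CkD => //; apply: CkN => //; [exact: Ck_logdet1|exact: Ck_logdet2].
Qed.

Lemma strict_epi_pd_pair : strict_epi `<=` @pd_pair R n. Proof. by move=> p []. Qed.

Lemma open_strict_epi : open strict_epi.
Proof.
rewrite openE => p [Up zp].
have cz := Ck_cont (@Ck_slack 0) Up.
have z0 : 0 < slack p by rewrite subr_gt0.
near=> q; split; first by near: q; exact: open_nbhs_nbhs (conj (@open_pd_pair R n) Up).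
by rewrite -subr_gt0; near: q; exact: (cvgr_gt _ cz).
Unshelve. all: by end_near. Qed.

Lemma slack_gt0 p : strict_epi p -> 0 < slack p.
Proof. by case=> _; rewrite subr_gt0. Qed.

Lemma Ck_barrier_fun k : Ck k strict_epi barrier_fun.
Proof.
have oQ := open_strict_epi; apply: CkD => //; last exact: Ck_sub strict_epi_pd_pair (@Ck_logdet_bar k).
apply: CkN => //; apply: Ck_ln => //; first exact: slack_gt0.
exact: Ck_sub strict_epi_pd_pair (@Ck_slack k).
Qed.

(** The quantity [r] is the length of [h] in the metric of [logdet_bar]; it
    bounds [h] in the order of Hermitian matrices, which is the hypothesis of
    [phi2_D23]. *)
Lemma logdet_bar_D23 x h : pd_pair x -> exists2 r : R, 0 <= r &
  [/\ iterD 2 h logdet_bar x = r ^+ 2, `|iterD 3 h logdet_bar x| <= 2 * r ^+ 3,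
   forall v, `|qf h.1.1 v| <= r * qf x.1.1 v &
   forall v, `|qf h.1.2 v| <= r * qf x.1.2 v].
Proof.
move=> Ux; have [pX pY] := Ux.
have [a2 [a3 [ja a20 a32 aq]]] := logdet_jet h.1.1 pX.
have [b2 [b3 [jb b20 b32 bq]]] := logdet_jet h.1.2 pY.
have jet : hasjet (fun t : R => logdet_bar (x + t *: h)) (a2 + b2) (a3 + b3) by exact: hasjetD.
have [e2 e3] := iterD_hasjet (@open_pd_pair R n) (@Ck_logdet_bar 3) Ux jet.
exists (Num.sqrt (a2 + b2)); first exact: sqrtr_ge0.
have sa : Num.sqrt a2 <= Num.sqrt (a2 + b2) by rewrite ler_wsqrtr// lerDl.
have sb : Num.sqrt b2 <= Num.sqrt (a2 + b2) by rewrite ler_wsqrtr// lerDr.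
split.
- by rewrite e2 sqr_sqrtr// addr_ge0.
- rewrite e3 (le_trans (ler_normD _ _))//.
  have -> : 2 * Num.sqrt (a2 + b2) ^+ 3 = 2 * a2 * Num.sqrt (a2 + b2) + 2 * b2 * Num.sqrt (a2 + b2).
    by rewrite exprS sqr_sqrtr ?addr_ge0//; ring.
  apply: lerD.
    by apply: (le_trans a32); apply: ler_wpM2l => //; rewrite mulr_ge0.
  by apply: (le_trans b32); apply: ler_wpM2l => //; rewrite mulr_ge0.
- by move=> v; apply: (le_trans (aq v)); apply: ler_wpM2r => //; exact: (psdP _).1 (pd_psd _) _.
- by move=> v; apply: (le_trans (bq v)); apply: ler_wpM2r => //; exact: (psdP _).1 (pd_psd _) _.
Qed.

Lemma barrier_fun_D23 x h : strict_epi x ->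
  0 <= iterD 2 h barrier_fun x /\ `|iterD 3 h barrier_fun x| <= 2 * (iterD 2 h barrier_fun x) `^ (3 / 2).
Proof.
move=> Qx; have Ux := strict_epi_pd_pair Qx; have oQ := open_strict_epi.
have [r r0 [B2 B3 hX hY]] := logdet_bar_D23 h Ux.
have [J2 J3] := phi2_D23 Ux hX hY.
have Cz := Ck_sub strict_epi_pd_pair (@Ck_slack 3); have CB := Ck_sub strict_epi_pd_pair (@Ck_logdet_bar 3).
have Cphi k : Ck k strict_epi phi2 by exact: Ck_sub strict_epi_pd_pair (@Ck_phi R n k).
have Cp2 k : Ck k strict_epi (fun p => p.2 : R^o) by apply: Ck_lin => // p; exact: cvg_snd.
have Ez k : (k.+2 <= 3)%N -> iterD k.+2 h slack x = - iterD k.+2 h phi2 x.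
  move=> k3; rewrite (@iterDD _ _ k.+2 strict_epi (fun p => p.2) (fun p => - phi2 p) h x)//; last exact: CkN.
  by rewrite iterD_lin// add0r (@iterDN _ _ _ strict_epi).
have z0 := slack_gt0 Qx.
have zpos y : strict_epi y -> 0 < slack y by exact: slack_gt0.
have E2 := @iterD2_lnbarrier _ _ strict_epi slack logdet_bar h oQ Cz CB zpos x Qx.
have E3 := @iterD3_lnbarrier _ _ strict_epi slack logdet_bar h oQ Cz CB zpos x Qx.
have {}E2 : iterD 2 h barrier_fun x = _ := E2.
have {}E3 : iterD 3 h barrier_fun x = _ := E3.
rewrite (Ez 0%N isT) B2 in E2; rewrite (Ez 0%N isT) (Ez 1%N isT) in E3.
have zi0 : 0 <= (slack x)^-1 by rewrite invr_ge0 ltW.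
by rewrite E2 E3; exact: sc_combine.
Qed.

Lemma phi2_D2_ge0 x h : pd_pair x -> 0 <= iterD 2 h phi2 x.
Proof.
move=> Ux; have [r r0 [_ _ hX hY]] := logdet_bar_D23 h Ux.
by have [] := phi2_D23 Ux hX hY.
Qed.

End Barrier.

(** * Domain, convexity and homogeneity of the barrier *)

Section Cone.
Context {R : realType} {n : nat}.
Local Notation C := R[i].
Local Notation Re := (@complex.Re R).
Local Notation H2 := (herm R n * herm R n * R^o)%type.
Implicit Types (X Y H K : herm R n) (v : 'cV[C]_n) (p x y h : H2).

Lemma DBSE X Y : pd X -> pd Y -> DBS X Y = phi X Y.
Proof.
move=> pX pY; rewrite /DBS; case: asboolP => [_|[]] //.
exact: DBS_pdE.
Qed.

Lemma barrierE p : strict_epi p -> DBS_barrier R n p = (barrier_fun p)%:E.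
Proof.
case: p => [[X Y] z] [[/= pX pY] zp]; rewrite /DBS_barrier.
have zp' : phi X Y < z by [].
case: asboolP => [_|[]] //; rewrite DBSE// leNgt subr_gt0 zp' /=.
by rewrite -!EFinD /barrier_fun /logdet_bar /slack /= addrA.
Qed.

Lemma barrierN p : ~ strict_epi p -> DBS_barrier R n p = +oo%E.
Proof.
case: p => [[X Y] z] nQ; rewrite /DBS_barrier; case: asboolP => // -[pX pY].
rewrite DBSE// le0_lneNy//.
by rewrite lee_fin subr_le0 leNgt; apply/negP => zp; exact: (nQ (conj (conj pX pY) zp)).
Qed.

Lemma dom_barrier : dom (DBS_barrier R n) = strict_epi.
Proof.
apply/seteqP; split => p; rewrite /dom/=.
  by move=> fp; apply: contrapT => /barrierN E; move: fp; rewrite E ltxx.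
by move=> /barrierE ->; rewrite ltry.
Qed.

Lemma pd_pair_seg x y (t : R) : pd_pair x -> pd_pair y -> 0 <= t <= 1 -> pd_pair (x + t *: (y - x)).
Proof.
move=> [x1 x2] [y1 y2] t01.
exact: (conj (pd_conv t01 x1 y1) (pd_conv t01 x2 y2)).
Qed.

Lemma phi2_convex x y (t : R) : pd_pair x -> pd_pair y -> 0 <= t <= 1 ->
  phi2 (x + t *: (y - x)) <= (1 - t) * phi2 x + t * phi2 y.
Proof.
move=> Ux Uy t01.
apply: (convex_of_iterD2 (@open_pd_pair R n) (@Ck_phi R n 2) _ t01) => [z h Uz|s s01].
  exact: (phi2_D2_ge0 h Uz).
exact: (pd_pair_seg Ux Uy s01).
Qed.

Lemma strict_epi_seg x y (t : R) : strict_epi x -> strict_epi y -> 0 <= t <= 1 -> strict_epi (x + t *: (y - x)).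
Proof.
move=> [Ux zx] [Uy zy] t01; split; first exact: pd_pair_seg.
apply: (le_lt_trans (phi2_convex Ux Uy t01)).
have /andP[t0 t1] := t01.
rewrite -[ltRHS]/(x.2 + t * (y.2 - x.2)).
have -> : x.2 + t * (y.2 - x.2) = (1 - t) * x.2 + t * y.2 by ring.
have [->|tn0] := eqVneq t 0; first by rewrite subr0 !mul0r !addr0 !mul1r.
apply: ler_ltD; first by rewrite ler_wpM2l ?subr_ge0// ltW.
by rewrite ltr_pM2l// lt_neqAle eq_sym tn0.
Qed.

Lemma pdZ X (a : R) : 0 < a -> pd X -> pd (a *: X).
Proof.
by move=> a0 /pdP pX; apply/pdP => v v0; rewrite /= qfZ mulr_gt0// pX.
Qed.

Lemma strict_epiZ x (a : R) : 0 < a -> strict_epi x -> strict_epi (a *: x).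
Proof.
move=> a0 [[pX pY] zx]; split; first exact: (conj (pdZ a0 pX) (pdZ a0 pY)).
by rewrite /phi2 /= phi_scale// -[ltRHS]/(a * x.2) ltr_pM2l.
Qed.

Lemma mid_sum x y : x + y = (2 : R) *: (x + (2^-1 : R) *: (y - x)).
Proof.
rewrite scalerDr scalerA divff// scale1r.
by rewrite scaler_nat mulr2n -addrA [x + (y - x)]addrC subrK.
Qed.

Lemma strict_epiD x y : strict_epi x -> strict_epi y -> strict_epi (x + y).
Proof.
move=> Qx Qy; rewrite mid_sum; apply: strict_epiZ => //; apply: strict_epi_seg => //.
by rewrite invr_ge0 ler0n invf_le1// ler1n.
Qed.

Lemma barrier_fun_convex x y (t : R) : strict_epi x -> strict_epi y -> 0 <= t <= 1 ->
  barrier_fun (x + t *: (y - x)) <= (1 - t) * barrier_fun x + t * barrier_fun y.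
Proof.
move=> Qx Qy t01.
apply: (convex_of_iterD2 (@open_strict_epi R n) (Ck_barrier_fun 2) _ t01) => [z h Qz|s s01].
  exact: (barrier_fun_D23 h Qz).1.
exact: (strict_epi_seg Qx Qy s01).
Qed.

Lemma convC_eq x y (t : R) : t *: x + (1 - t) *: y = x + (1 - t) *: (y - x).
Proof.
by rewrite scalerBr addrCA addrC; congr (_ + _); rewrite scalerBl scale1r subKr.
Qed.

Lemma barrier_neqNy p : DBS_barrier R n p != -oo%E.
Proof.
have [Qp|nQ] := pselect (strict_epi p); first by rewrite barrierE.
by rewrite barrierN.
Qed.

Lemma barrier_convex : econvex_function (DBS_barrier R n).
Proof.
split; first exact: barrier_neqNy.
move=> x y t t01; have /andP[t0 t1] := t01.
have t'0 : 0 <= 1 - t by rewrite subr_ge0.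
have [->|tn0] := eqVneq t 0.
  by rewrite scale0r add0r subr0 scale1r mul0e add0e mul1e.
have [->|tn1] := eqVneq t 1.
  by rewrite scale1r subrr scale0r addr0 mul0e adde0 mul1e.
have tp : 0 < t by rewrite lt_neqAle eq_sym tn0.
have tp' : 0 < 1 - t by rewrite subr_gt0 lt_neqAle tn1.
have [Qx|nQx] := pselect (strict_epi x); last first.
  rewrite (barrierN nQx) gt0_muley ?lte_fin// addye ?leey//.
  by have [Qy|nQy] := pselect (strict_epi y); [rewrite barrierE|rewrite barrierN// gt0_muley].
have [Qy|nQy] := pselect (strict_epi y); last first.
  by rewrite (barrierN nQy) gt0_muley ?lte_fin// (barrierE Qx) addey ?leey.
have t'01 : 0 <= 1 - t <= 1 by rewrite t'0 lerBlDr lerDl.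
rewrite convC_eq (barrierE Qx) (barrierE Qy) (barrierE (strict_epi_seg Qx Qy t'01)).
rewrite -!EFinM -EFinD lee_fin.
by have := barrier_fun_convex Qx Qy t'01; rewrite subKr.
Qed.

Lemma logdetZ X (a : R) : 0 < a -> pd X -> logdet (a *: X) = n%:R * ln a + logdet X.
Proof.
move=> a0 pX; rewrite /logdet /= detZ -rmorphXn ReZ lnM ?posrE ?exprn_gt0//.
  by rewrite lnXn// mulr_natl.
exact: Re_det_gt0.
Qed.

Lemma barrier_loghom : log_homogeneous (2 * n + 1)%:R (DBS_barrier R n).
Proof.
rewrite /log_homogeneous /convex_cone dom_barrier; split; first split.
- move=> x y t; rewrite !inE => Qx Qy.
  rewrite [X in strict_epi X](_ : _ = x + (1 - t%:num) *: (y - x)); last exact: convC_eq.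
  by apply: strict_epi_seg => //; rewrite subr_ge0 lerBlDr lerDl; apply/andP; split.
- by move=> x a Qx a0; exact: strict_epiZ.
- move=> x a Qx a0; rewrite (barrierE Qx) (barrierE (strict_epiZ a0 Qx)) -EFinB.
  congr (_%:E); have [[pX pY] zx] := Qx; have z0 := slack_gt0 Qx.
  have zE : slack (a *: x) = a * slack x.
    by rewrite /slack /phi2 /= phi_scale// mulrBr.
  rewrite /barrier_fun zE lnM ?posrE// /logdet_bar /= !logdetZ//.
  move: (ln (slack x)) (logdet x.1.1) (logdet x.1.2) (ln a) => u v w l.
  by rewrite natrD natrM; ring.
Qed.

End Cone.

(** * The closure of the domain *)

Lemma closure_ge0_at {R : realType} {T : topologicalType} (A : set T) (f : T -> R^o) p :
  {for p, continuous f} -> (forall q, A q -> 0 <= f q) -> closure A p -> 0 <= f p.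
Proof.
move=> cf Af cp; rewrite leNgt; apply/negP => fp.
have [q [Aq]] := cp _ (cvgr_lt _ cf _ fp).
by rewrite /= ltNge Af.
Qed.

Section ClosureGen.
Context {R : realType} {E : normedModType R}.
Implicit Types (A : set E).

Lemma closureD A x y : (forall u v, A u -> A v -> A (u + v)) ->
  closure A x -> closure A y -> closure A (x + y).
Proof.
move=> AD cx cy B /(@add_continuous _ (x, y)) [[U V] /= [Ux Vy] UV].
have [u [Au Uu]] := cx _ Ux; have [v [Av Vv]] := cy _ Vy.
by exists (u + v); split; [exact: AD|exact: (UV (u, v))].
Qed.

Lemma closureZ A x (a : R) : (forall u, A u -> A (a *: u)) ->
  closure A x -> closure A (a *: x).
Proof.
move=> AZ cx B Ba.
have c : (fun u : E => a *: u) @ x --> a *: x by apply: cvgZr; exact: cvg_id.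
have [u [Au Bu]] := cx _ (c _ Ba).
by exists (a *: u); split; [exact: AZ|].
Qed.

(** Approximate [y] by [u] in [A] and move the small difference [y - u] over to
    the interior point [x]. *)
Lemma openD_closure A x y : open A -> (forall u v, A u -> A v -> A (u + v)) ->
  A x -> closure A y -> A (x + y).
Proof.
move=> oA AD Ax cy.
have c : (fun u : E => x + (y - u)) @ y --> x + (y - y).
  by apply: cvgD; [exact: cvg_cst|apply: cvgB; [exact: cvg_cst|exact: cvg_id]].
have Ax' : A (x + (y - y)) by rewrite subrr addr0.
have [u [Au]] := cy _ (c _ (open_nbhs_nbhs (conj oA Ax'))).
by move=> /= /AD /(_ Au); rewrite -addrA subrK.
Qed.

Lemma closure_path A x h : (forall e : R, 0 < e -> A (x + e *: h)) -> closure A x.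
Proof.
move=> H B Bx.
have c : (fun t : R^o => x + t *: h) @ (0:R^o) --> x.
  rewrite -[X in _ --> X]addr0 -[X in _ --> _ + X](scale0r h).
  by apply: cvgD; [exact: cvg_cst|apply: cvgZl; exact: cvg_id].
have /nbhs_ballP [r /= r0 rB] := c _ Bx.
exists (x + (r / 2) *: h); split; first by apply: H; rewrite divr_gt0.
apply: rB; rewrite /ball/= sub0r normrN gtr0_norm ?divr_gt0//.
by rewrite ltr_pdivrMr// ltr_pMr// ltr1n.
Qed.

End ClosureGen.

Section Closure.
Context {R : realType} {n : nat}.
Local Notation C := R[i].
Local Notation Re := (@complex.Re R).
Local Notation H2 := (herm R n * herm R n * R^o)%type.
Local Notation cQ := (closure (@strict_epi R n)).
Local Notation I1 := (@herm1 R n).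
Implicit Types (X Y H K : herm R n) (v : 'cV[C]_n) (p x y h : H2) (d : 'I_n -> R).

Lemma cQD x y : cQ x -> cQ y -> cQ (x + y).
Proof. exact/closureD/strict_epiD. Qed.

Lemma cQZ x (a : R) : 0 < a -> cQ x -> cQ (a *: x).
Proof. by move=> a0; apply: closureZ => u; exact: strict_epiZ. Qed.

Lemma strict_epiD_cQ x y : strict_epi x -> cQ y -> strict_epi (x + y).
Proof. by apply: openD_closure; [exact: open_strict_epi|exact: strict_epiD]. Qed.

Lemma tripleD X Y (z : R^o) (e : R) H K (w : R^o) :
  (X, Y, z) + e *: (H, K, w) = (X + e *: H, Y + e *: K, z + e * w).
Proof. by []. Qed.

Lemma strict_epi_intro X Y (z : R^o) : pd X -> pd Y -> phi X Y < z -> strict_epi (X, Y, z).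
Proof. by move=> pX pY zp; exact: (conj (conj pX pY) zp). Qed.

Lemma pd_pair_intro X Y (z : R^o) : pd X -> pd Y -> pd_pair (X, Y, z).
Proof. by move=> pX pY; exact: (conj pX pY). Qed.

Lemma pd1 : pd I1.
Proof. by apply/pdP => v v0; rewrite qf1 sqnorm_gt0. Qed.

Lemma psd_pdD X (e : R) : 0 < e -> psd X -> pd (X + e *: I1).
Proof.
move=> e0 /psdP pX; apply/pdP => v v0.
rewrite /= qfD qfZ qf1 ltr_wpDl ?pX// mulr_gt0// sqnorm_gt0//.
Qed.

Lemma shift_diag (P : 'M[C]_n) d (e : R) : P ^t* *m P = 1%:M ->
  P ^t* *m rdiag d *m P + e%:C *: 1%:M = P ^t* *m rdiag (fun k => d k + e) *m P.
Proof.
move=> P2.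
have -> : rdiag (fun k => d k + e) = rdiag d + e%:C *: 1%:M.
  by rewrite -rdiag1 rdiagZ rdiagD; congr rdiag; apply/funext => k; rewrite mulr1.
by rewrite mulmxDr mulmxDl -scalemxAr -scalemxAl mulmx1 P2.
Qed.

(** The pair commutes, so that the entropy is computed in an eigenbasis. *)
Lemma phi_proportional X (a : R) : pd X -> 0 < a ->
  phi X (a%:C *: hmx X) = - (Re (\tr X) * ln a).
Proof.
move=> pX a0; have [P [d [P1 P2 XE]]] := spectral_ex X.
have d0 := (pd_cong_diag (unit_of_unitary P1) XE).1 pX.
have -> : a%:C *: hmx X = P ^t* *m rdiag (fun k => a * d k) *m P.
  by rewrite -rdiagZ -scalemxAr -scalemxAl XE.
rewrite XE phi_diag//; last by move=> k; rewrite mulr_gt0.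
have -> : Re (\tr (P ^t* *m rdiag d *m P)) = \sum_k d k.
  rewrite -mulmxA mxtrace_mulC -mulmxA P1 mulmx1 /mxtrace Re_sum.
  by apply: eq_bigr => k _; rewrite rdiagE eqxx.
rewrite mulr_suml -sumrN; apply: eq_bigr => k _.
have [dk] := (d0 k); rewrite invfM mulrCA divff ?gt_eqF// mulr1.
by rewrite lnV ?posrE// mulrN.
Qed.

(** The third component is the limit of [phi_proportional] as [X + e I] tends to
    [X]. *)
Lemma cQ_proportional X (a : R) : psd X -> 0 < a ->
  cQ (X, a *: X, - (Re (\tr X) * ln a)).
Proof.
move=> pX a0.
apply: (@closure_path _ _ _ _ (I1, a *: I1, 1 - Re (\tr I1) * ln a)) => e e0.
have pXe := psd_pdD e0 pX.
have E2 : a *: X + e *: (a *: I1) = a *: (X + e *: I1).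
  by rewrite scalerDr !scalerA mulrC.
rewrite tripleD; apply: (strict_epi_intro pXe); first (rewrite E2; exact: (pdZ a0 pXe)).
rewrite E2 -[hmx (a *: _)]/(a%:C *: hmx (X + e *: I1)) phi_proportional//.
rewrite -[hmx (X + e *: I1)]/(hmx X + e%:C *: hmx I1) mxtraceD mxtraceZ ReD ReZ.
rewrite -subr_gt0.
have -> : - (Re (\tr X) * ln a) + e * (1 - Re (\tr I1) * ln a) -
  - ((Re (\tr X) + e * Re (\tr I1)) * ln a) = e by ring.
by [].
Qed.

(** [0] is approached by [e I] and [Y] by [Y + e I]; the entropy of this
    commuting pair is at most [0], since [e I <= Y + e I]. *)
Lemma cQ_right Y : psd Y -> cQ ((0 : herm R n), Y, (0 : R^o)).
Proof.
move=> pY; apply: (@closure_path _ _ _ _ (I1, I1, (1 : R^o))) => e e0.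
have pYe := psd_pdD e0 pY.
rewrite tripleD add0r; apply: (strict_epi_intro (pdZ e0 pd1) pYe).
have [P [d [P1 P2 YE]]] := spectral_ex Y.
have d0 := (psd_cong_diag (unit_of_unitary P1) YE).1 pY.
rewrite add0r mulr1.
rewrite -[hmx (Y + e *: I1)]/(hmx Y + e%:C *: 1%:M) YE shift_diag//.
have -> : hmx (e *: I1) = P ^t* *m rdiag (fun=> e) *m P.
  have eI : rdiag (fun=> e) = e%:C *: 1%:M :> 'M[C]_n.
    by rewrite -rdiag1 rdiagZ; congr rdiag; apply/funext => k; rewrite mulr1.
  by rewrite eI -scalemxAr -scalemxAl mulmx1 P2.
rewrite phi_diag//; last by move=> k; rewrite ltr_wpDl.
apply: (@le_lt_trans _ _ 0) => //; apply: sumr_le0 => k _.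
have h : ln (e / (d k + e)) <= 0.
  by apply: ln_le0; rewrite ler_pdivrMr ?ltr_wpDl// mul1r lerDr.
by rewrite mulr_ge0_le0// ltW.
Qed.

(** In an eigenbasis of [Y], the kernel condition kills every entry of [X] in
    the rows and columns of the zero eigenvalues. The other entries are bounded by
    the positive eigenvalues of [Y], by the inequality between two means. *)
Lemma ker_le_dominated X Y : psd X -> psd Y -> ker_le X Y ->
  exists2 a : R, 0 < a & psd (Y - a *: X).
Proof.
move=> pX pY kXY; have [P [d [P1 P2 YE]]] := spectral_ex Y.
have d0 := (psd_cong_diag (unit_of_unitary P1) YE).1 pY.
pose A := P *m X *m P ^t*.
have AJ j k : A k j = Num.conj (A j k).
  have : A ^t* = A by rewrite /A !adjM hermE trmxCK mulmxA.
  by move=> /matrixP/(_ k j); rewrite !mxE.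
have A0 j k : d k = 0 -> A j k = 0.
  move=> dk0; have : hmx Y *m (P ^t* *m @ecol R n k) = 0.
    rewrite YE -!mulmxA (mulmxA P) P1 mul1mx.
    have -> : rdiag d *m @ecol R n k = 0.
      apply/matrixP => i l; rewrite rdiag.unlock mul_diag_mx !mxE.
      by case: eqP => [->|_]; rewrite ?mulr0// dk0 mul0r.
    by rewrite mulmx0.
  move=> /kXY XP0; have : A *m @ecol R n k = 0 by rewrite /A -!mulmxA XP0 mulmx0.
  by move=> /matrixP/(_ j 0); rewrite /ecol -colE [LHS]mxE [RHS]mxE.
pose m j k := `|Re (A j k)| + `|complex.Im (A j k)|.
have m0 j k : 0 <= m j k by rewrite addr_ge0.
pose c := \sum_j \sum_k m j k * ((d j)^-1 + (d k)^-1).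
have c0 : 0 <= c.
  apply: sumr_ge0 => j _; apply: sumr_ge0 => k _.
  by rewrite mulr_ge0// addr_ge0// invr_ge0.
have Xc v : qf X v <= c * qf Y v.
  have -> : hmx X = P ^t* *m A *m P.
    by rewrite /A !mulmxA P2 mul1mx -mulmxA P2 mulmx1.
  rewrite YE !qf_cong qf_rdiag; move: (P *m v) => w.
  set q := \sum_k _.
  have qk k : d k * nsq (w k 0) <= q.
    rewrite /q (bigD1 k)//= lerDl; apply: sumr_ge0 => j _.
    by rewrite mulr_ge0// nsq_ge0.
  have q0 : 0 <= q by apply: sumr_ge0 => j _; rewrite mulr_ge0// nsq_ge0.
  rewrite qfE /c mulr_suml; apply: ler_sum => j _.
  rewrite mulr_suml; apply: ler_sum => k _.
  apply: (le_trans (ler_norm _)).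
  have [dj0|dj] := eqVneq (d j) 0.
    have -> : A j k = 0 by rewrite AJ A0// rmorph0.
    by rewrite mulr0 mul0r /= normr0 !mulr_ge0// addr_ge0// invr_ge0.
  have [dk0|dk] := eqVneq (d k) 0.
    by rewrite A0// mulr0 mul0r /= normr0 !mulr_ge0// addr_ge0// invr_ge0.
  have djp : 0 < d j by rewrite lt_neqAle eq_sym dj d0.
  have dkp : 0 < d k by rewrite lt_neqAle eq_sym dk d0.
  rewrite -[leRHS]mulrA /m; apply: qf_term_le; rewrite mulrDl.
    rewrite ler_wpDr ?mulr_ge0 ?invr_ge0//.
    by rewrite mulrC ler_pdivlMr// mulrC.
  rewrite ler_wpDl ?mulr_ge0 ?invr_ge0//.
  by rewrite mulrC ler_pdivlMr// mulrC.
have c1 : 0 < 1 + c by rewrite ltr_pwDl.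
exists (1 + c)^-1; first by rewrite invr_gt0.
apply/psdP => v; rewrite /= qfB qfZ subr_ge0 ler_pdivrMl//.
apply: (le_trans (Xc v)); apply: ler_wpM2r; last by rewrite lerDr.
exact: (psdP Y).1.
Qed.

(** Split [Y] as [a X + (Y - a X)] and use that the closure is a convex cone. *)
Lemma ker_le_cQ X Y : psd X -> psd Y -> ker_le X Y -> exists z : R^o, cQ (X, Y, z).
Proof.
move=> pX pY kXY; have [a a0 pD] := ker_le_dominated pX pY kXY.
have := cQD (cQ_proportional pX a0) (cQ_right pD).
set p := (_ + _) => cp; exists p.2.
suff <- : p = (X, Y, p.2) by [].
by rewrite /p; congr (_, _, _); rewrite /= ?addr0// addrC subrK.
Qed.

Lemma cQ_psd p : cQ p -> psd p.1.1 /\ psd p.1.2.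
Proof.
move=> cp; split; apply/psdP => v.
  apply: (closure_ge0_at (f := fun p : H2 => qf p.1.1 v) _ _ cp).
    apply: (@continuous_comp _ _ _ (fun p : H2 => p.1.1) (fun X : herm R n => qf X v : R^o)).
      exact: fst_fst_continuous.
    exact: qf_continuous.
  by move=> q [[/pd_psd/psdP pX _] _]; exact: pX.
apply: (closure_ge0_at (f := fun p : H2 => qf p.1.2 v) _ _ cp).
  apply: (@continuous_comp _ _ _ (fun p : H2 => p.1.2) (fun X : herm R n => qf X v : R^o)).
    exact: fst_snd_continuous.
  exact: qf_continuous.
by move=> q [[_ /pd_psd/psdP pY] _]; exact: pY.
Qed.

Lemma cQ_pd_pair p : cQ p -> pd_pair p -> phi2 p <= p.2.
Proof.
move=> cp Up; rewrite -subr_ge0.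
apply: (closure_ge0_at (Ck_cont (@Ck_slack R n 0) Up) _ cp) => q Qq.
by rewrite ltW// slack_gt0.
Qed.

Lemma phi_II : phi (1%:M : 'M[C]_n) 1%:M = 0.
Proof.
have := @phi_diag R n 1%:M (fun=> 1) (fun=> 1).
rewrite adj1 !mul1mx !mulmx1 rdiag1 => -> //.
by apply: big1 => k _; rewrite divr1 ln1 mulr0.
Qed.

Lemma strict_epi_II (z : R^o) : 0 < z -> strict_epi (I1, I1, z).
Proof. by move=> z0; split; [split; exact: pd1|rewrite /phi2 /= phi_II]. Qed.

Lemma cQ_II : cQ (I1, I1, (0 : R^o)).
Proof.
apply: (@closure_path _ _ _ _ ((0 : herm R n), (0 : herm R n), (1 : R^o))) => e e0.
by rewrite tripleD !scaler0 !addr0 mulr1 add0r; exact: strict_epi_II.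
Qed.

(** The function whose limit at [0] defines [DBS] on the boundary. *)
Definition psi X Y (e : R) : R := DBS_pd (X + e *: I1) (Y + e *: I1).

Lemma psiE X Y (e : R) : psd X -> psd Y -> 0 < e -> psi X Y e = phi (X + e *: I1) (Y + e *: I1).
Proof. by move=> pX pY e0; apply: DBS_pdE; exact: psd_pdD. Qed.

Lemma shift_eq X Y (z : R^o) (e : R) :
  (X, Y, z) + e *: (I1, I1, (0 : R^o)) = (X + e *: I1, Y + e *: I1, z).
Proof. by rewrite tripleD mulr0 addr0. Qed.

(** Adding [e (I, I, 0)], which is in the closure, keeps the point in the
    closure. *)
Lemma psi_le X Y (z : R^o) (e : R) : cQ (X, Y, z) -> 0 < e -> psi X Y e <= z.
Proof.
move=> cz e0; have [pX pY] := cQ_psd cz; rewrite (psiE pX pY e0).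
have := cQD cz (cQZ e0 cQ_II); rewrite shift_eq => /cQ_pd_pair; apply.
exact: (pd_pair_intro _ (psd_pdD e0 pX) (psd_pdD e0 pY)).
Qed.

Lemma psi_nonincr X Y (e e' : R) : psd X -> psd Y -> 0 < e -> e <= e' ->
  psi X Y e' <= psi X Y e.
Proof.
move=> pX pY e0; rewrite le_eqVlt => /predU1P[-> //|ee'].
have e'0 := lt_trans e0 ee'.
have c1 : cQ (X + e *: I1, Y + e *: I1, (psi X Y e : R^o)).
  apply: (@closure_path _ _ _ _ ((0 : herm R n), (0 : herm R n), (1 : R^o))) => a a0.
  rewrite tripleD !scaler0 !addr0 mulr1; apply: (strict_epi_intro (psd_pdD e0 pX) (psd_pdD e0 pY)).
  by rewrite -(psiE pX pY e0) ltrDl.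
have d0 : 0 < e' - e by rewrite subr_gt0.
have E X' : X' + e *: I1 + (e' - e) *: I1 = X' + e' *: I1.
  by rewrite -addrA -scalerDl subrKC.
by have := psi_le c1 d0; rewrite {1}/psi !E.
Qed.

Lemma psi_cvg X Y (z : R^o) : cQ (X, Y, z) ->
  exists l : R, [/\ psi X Y e @[e --> 0^'+] --> l, l <= z &
    forall e, 0 < e -> psi X Y e <= l].
Proof.
move=> cz; have [pX pY] := cQ_psd cz.
set S := psi X Y @` [set` Interval (BRight 0) (BInfty R false)].
have ubS : ubound S z.
  by move=> _ [e /= + <-]; rewrite in_itv/= andbT => e0; exact: psi_le.
have S0 : S !=set0 by exists (psi X Y 1), 1 => //=; rewrite in_itv/= ltr01.
exists (sup S); split.
- apply: nonincreasing_at_right_cvgr; [by []| |by exists z].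
  move=> e e'; rewrite !in_itv/= !andbT => e0 _ ee'.
  exact: (psi_nonincr pX pY e0 ee').
- exact: ge_sup.
- move=> e e0; apply: ub_le_sup; first by exists z.
  by exists e => //=; rewrite in_itv/= e0.
Qed.

End Closure.

(** * The epigraph is the closure of the domain *)

Section Epi.
Context {R : realType} {n : nat}.
Local Notation C := R[i].
Local Notation Re := (@complex.Re R).
Local Notation H2 := (herm R n * herm R n * R^o)%type.
Local Notation cQ := (closure (@strict_epi R n)).
Local Notation I1 := (@herm1 R n).
Implicit Types (X Y H K : herm R n) (v : 'cV[C]_n) (p x y h : H2) (d : 'I_n -> R).

Lemma xlnxy_gt (x0 M : R) : 0 < x0 -> exists2 eta : R, 0 < eta &
  forall x y : R, x0 <= x -> 0 < y -> y < eta -> M < x * ln (x / y).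
Proof.
move=> x00; pose K := (`|M| + 1) / x0.
have K0 : 0 < K by rewrite divr_gt0// ltr_wpDl.
exists (x0 * expR (- K)); first by rewrite mulr_gt0// expR_gt0.
move=> x y xx0 y0 ye; have xp : 0 < x := lt_le_trans x00 xx0.
have h : K <= ln (x / y).
  rewrite -[K]expRK ler_ln ?posrE ?expR_gt0 ?divr_gt0//.
  rewrite ler_pdivlMr// (le_trans _ xx0)// -[leRHS]mulr1 -(expR0 R) -(subrr K) addrC expRD mulrA.
  by rewrite mulrC ler_wpM2r ?expR_ge0// ltW.
apply: (@lt_le_trans _ _ (x0 * K)); last by rewrite ler_pM// ltW.
by rewrite /K mulrC divfK ?gt_eqF// (le_lt_trans (ler_norm _))// ltrDl.
Qed.

Lemma ln_div_swap (u t : R) : 0 < u -> 0 < t -> ln (t / u) = - ln (u / t).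
Proof. by move=> u0 t0; rewrite !ln_div ?posrE// opprB. Qed.

Lemma entropy_bound (a b t u z : R) : 0 < u -> 0 < t ->
  a - b + (t - u - u * ln (t / u)) <= z -> u * ln (u / t) <= z - a + b - t + u.
Proof.
move=> u0 t0; rewrite (ln_div_swap u0 t0) -subr_ge0 => h; rewrite -subr_ge0.
by move: h; congr (0 <= _); ring.
Qed.

Lemma psd_qf0 X v : psd X -> qf X v = 0 -> hmx X *m v = 0.
Proof.
move=> pX; have [P [d [P1 P2 XE]]] := spectral_ex X.
have d0 := (psd_cong_diag (unit_of_unitary P1) XE).1 pX.
rewrite XE qf_cong qf_rdiag => /eqP.
rewrite psumr_eq0 => [/allP H|k _]; last by rewrite mulr_ge0// nsq_ge0.
rewrite -!mulmxA (_ : rdiag d *m (P *m v) = 0) ?mulmx0//.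
apply/matrixP => k j; rewrite ord1 rdiag.unlock mul_diag_mx mxE [RHS]mxE mxE.
have := H k (mem_index_enum k); rewrite /= mulf_eq0 nsq_eq0 => /orP[] /eqP ->.
  by rewrite mul0r.
by rewrite mulr0.
Qed.

Lemma Re_tr_continuous : continuous (fun X : herm R n => Re (\tr X) : R^o).
Proof.
apply: (@lipschitz_continuous _ _ _ n%:R) => X Y.
rewrite /mxtrace !Re_sum -sumrB; apply: (le_trans (ler_norm_sum _ _ _)).
have -> : n%:R * `|X - Y| = \sum_(i < n) `|X - Y|.
  by rewrite sumr_const card_ord mulr_natl.
apply: ler_sum => i _; have := entry_le_norm (X - Y) i i.
by rewrite /= !mxE ReB; apply: le_trans; rewrite lerDl.
Qed.

(** If [Y v = 0] but [X v <> 0], then near [(X, Y)] the number [<v, X v>] stays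
    away from [0] while [<v, Y v>] tends to [0], so that the lower bound [phi_ge]
    exceeds every [z]. *)
Lemma cQ_ker_le X Y (z : R^o) : cQ (X, Y, z) -> ker_le X Y.
Proof.
move=> cz v Yv; have [pX pY] := cQ_psd cz.
apply: contrapT => Xv.
have v0 : v != 0 by apply/eqP => v0; apply: Xv; rewrite v0 mulmx0.
have N0 := sqnorm_gt0 v0.
pose a : R := (Num.sqrt (sqnorm v))^-1.
pose w := a%:C *: v.
have aa : a ^+ 2 * sqnorm v = 1.
  by rewrite exprVn sqr_sqrtr ?ltW// mulVf// gt_eqF.
have w1 : \sum_i nsq (w i 0) = 1.
  by rewrite -aa /sqnorm mulr_sumr; apply: eq_bigr => i _; rewrite mxE nsqM nsqR.
have a0 : a != 0 by rewrite invr_eq0 sqrtr_eq0 -ltNge.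
have Yw : qf Y w = 0 by rewrite /qf -mulmxA -scalemxAr Yv scaler0 mulmx0 mxE.
have w0 : w != 0 by rewrite scaler_eq0 negb_or v0 andbT (inj_eq (@complexI _)).
have Xw : 0 < qf X w.
  rewrite lt_neqAle ((psdP X).1 pX w) andbT eq_sym; apply/eqP => /(psd_qf0 pX).
  rewrite -scalemxAr => /eqP; rewrite scaler_eq0 (inj_eq (@complexI _)) (negbTE a0)/= => /eqP.
  exact: Xv.
have x20 : 0 < qf X w / 2 by rewrite divr_gt0.
have fX (f : herm R n -> R^o) : continuous f -> (fun p : H2 => f p.1.1) @ (X, Y, z) --> f X.
  move=> cf; apply: (@continuous_comp _ _ _ (fun p : H2 => p.1.1) f (X, Y, z)); last exact: cf.
  exact: fst_fst_continuous.
have fY (f : herm R n -> R^o) : continuous f -> (fun p : H2 => f p.1.2) @ (X, Y, z) --> f Y.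
  move=> cf; apply: (@continuous_comp _ _ _ (fun p : H2 => p.1.2) f (X, Y, z)); last exact: cf.
  exact: fst_snd_continuous.
have cX := fX _ (@qf_continuous R n w); have cY := fY _ (@qf_continuous R n w).
have cu := fX _ Re_tr_continuous; have cv := fY _ Re_tr_continuous.
have cz2 : (fun p : H2 => p.2) @ (X, Y, z) --> z by exact: cvg_snd.
pose B (p : H2) : R^o := p.2 - Re (\tr p.1.1) + Re (\tr p.1.2) - qf p.1.2 w + qf p.1.1 w.
have cB : B @ (X, Y, z) --> B (X, Y, z).
  by apply: cvgD cX; apply: cvgB cY; apply: cvgD cv; apply: cvgB cu.
have [eta eta0 Heta] := xlnxy_gt (B (X, Y, z) + 1) x20.
have N1 : \forall p \near (X, Y, z), qf X w / 2 < qf (hmx (p : H2).1.1) w.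
  by apply: (cvgr_gt _ cX); rewrite ltr_pdivrMr// ltr_pMr// ltr1n.
have N2 : \forall p \near (X, Y, z), qf (hmx (p : H2).1.2) w < eta.
  by apply: (cvgr_lt _ cY); rewrite Yw.
have N3 : \forall p \near (X, Y, z), B p < B (X, Y, z) + 1.
  by apply: (cvgr_lt _ cB); rewrite ltrDl.
have [p [[[pX' pY'] zp] [[h1 h2] h3]]] := cz _ (filterI (filterI N1 N2) N3).
have x'0 := (pdP _).1 pX' w w0; have y'0 := (pdP _).1 pY' w w0.
have := Heta _ _ (ltW h1) y'0 h2; apply/negP; rewrite -leNgt.
apply: le_trans (ltW h3).
exact: (entropy_bound x'0 y'0 (le_trans (phi_ge pX' pY' w0 w1) (ltW zp))).
Qed.

Lemma epi_DBSE : epi_DBS R n = cQ.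
Proof.
apply/seteqP; split => [[[X Y] z]|[[X Y] z] cz].
- case=> pX pY kXY Dz.
  case: (pselect (pd X /\ pd Y)) => [[dX dY]|nXY].
    apply: (@closure_path _ _ _ _ ((0 : herm R n), (0 : herm R n), (1 : R^o))) => e e0.
    rewrite tripleD !scaler0 !addr0 mulr1; apply: (strict_epi_intro dX dY).
    by rewrite -(DBSE dX dY); apply: (le_lt_trans Dz); rewrite ltrDl.
  have [z0 cz0] := ker_le_cQ pX pY kXY.
  have [l [pl _ lub]] := psi_cvg cz0.
  have lz : l <= z.
    move: Dz; rewrite /DBS; case: asboolP => // _; congr (_ <= _).
    exact: cvg_lim pl.
  apply: (@closure_path _ _ _ _ (I1, I1, (1 : R^o))) => e e0.
  rewrite tripleD mulr1; apply: (strict_epi_intro (psd_pdD e0 pX) (psd_pdD e0 pY)).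
  rewrite -(psiE pX pY e0); apply: (le_lt_trans (lub _ e0)).
  by apply: (le_lt_trans lz); rewrite ltrDl.
- have [pX pY] := cQ_psd cz; split; [exact: pX|exact: pY|exact: cQ_ker_le cz|].
  case: (pselect (pd X /\ pd Y)) => [[dX dY]|nXY].
    by rewrite (DBSE dX dY); exact: (cQ_pd_pair cz (pd_pair_intro _ dX dY)).
  have [l [pl lz _]] := psi_cvg cz.
  rewrite /DBS; case: asboolP => // _.
  by rewrite (cvg_lim _ pl).
Qed.

Lemma epi_closed : closed (epi_DBS R n).
Proof. by rewrite epi_DBSE; exact: closed_closure. Qed.

Lemma epi_convex : convex_set (epi_DBS R n : set (convex_lmodType _)).
Proof.
apply/convex_setW => x y; rewrite epi_DBSE !inE => cx cy t t0 t1; rewrite inE.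
rewrite [X in closure _ X](_ : _ = (t%:num *: x + (1 - t%:num) *: y : H2))//.
by apply: cQD; apply: cQZ => //; rewrite subr_gt0.
Qed.

End Epi.

(** * The epigraph of the barrier is closed *)

Section ScBarrier.
Context {R : realType} {n : nat}.
Local Notation C := R[i].
Local Notation Re := (@complex.Re R).
Local Notation H2 := (herm R n * herm R n * R^o)%type.
Implicit Types (X Y H K : herm R n) (p q x y h : H2) (d : 'I_n -> R).

Lemma Re_det_continuous : continuous (fun X : herm R n => Re (\det X) : R^o).
Proof.
move=> X; have oT := @openT (herm R n).
have cm : Ckm [set: herm R n] 0 (fun X : herm R n => hmx X).
  by apply: (@Ckm_lin R n _ 0%N setT id) => // Y; exact: cvg_id.
have [c _] := Ck_det oT cm.
exact: (Ck_cont c).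
Qed.

Lemma psd_det_pd X : psd X -> Re (\det X) != 0 -> pd X.
Proof.
move=> pX; have [P [d [P1 P2 XE]]] := spectral_ex X.
have uP := unit_of_unitary P1.
have d0 := (psd_cong_diag uP XE).1 pX.
rewrite XE Re_det_cong mulf_eq0 negb_or => /andP[_ /prodf_neq0 dn0].
apply: (pd_cong_diag uP XE).2 => k.
by rewrite lt_neqAle d0 eq_sym dn0.
Qed.

Let dX p : R^o := Re (\det p.1.1).
Let dY p : R^o := Re (\det p.1.2).
Let B p : R^o := p.2 - Re (\tr p.1.1) + Re (\tr p.1.2).

Let cdX : continuous dX.
Proof.
move=> p; apply: (@continuous_comp _ _ _ (fun p : H2 => p.1.1) (fun X : herm R n => Re (\det X) : R^o)).
  exact: fst_fst_continuous.
exact: Re_det_continuous.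
Qed.

Let cdY : continuous dY.
Proof.
move=> p; apply: (@continuous_comp _ _ _ (fun p : H2 => p.1.2) (fun X : herm R n => Re (\det X) : R^o)).
  exact: fst_snd_continuous.
exact: Re_det_continuous.
Qed.

Let cB : continuous B.
Proof.
move=> p; apply: cvgD.
  apply: cvgB; first exact: cvg_snd.
  apply: (@continuous_comp _ _ _ (fun p : H2 => p.1.1) (fun X : herm R n => Re (\tr X) : R^o)).
    exact: fst_fst_continuous.
  exact: Re_tr_continuous.
apply: (@continuous_comp _ _ _ (fun p : H2 => p.1.2) (fun X : herm R n => Re (\tr X) : R^o)).
  exact: fst_snd_continuous.
exact: Re_tr_continuous.
Qed.

Lemma barrier_fun_le p (t : R) : strict_epi p -> (barrier_fun p <= t) = (expR (- t) <= slack p * (dX p * dY p)).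
Proof.
move=> Qp; have [[pX pY] _] := Qp; have z0 := slack_gt0 Qp.
have x0 := Re_det_gt0 pX; have y0 := Re_det_gt0 pY.
have d0 : 0 < dX p * dY p by exact: mulr_gt0.
have zd0 : 0 < slack p * (dX p * dY p) by exact: mulr_gt0.
have fE : barrier_fun p = - ln (slack p * (dX p * dY p)).
  by rewrite (lnM z0 d0) (lnM x0 y0) /barrier_fun /logdet_bar /logdet opprD opprD.
rewrite fE lerNl; move: zd0; move: (slack p * _) => a a0.
by rewrite -[LHS]ler_expR lnK.
Qed.

Lemma barrier_le_strict_epi p (t : R) : (DBS_barrier R n p <= t%:E)%E -> strict_epi p /\ barrier_fun p <= t.
Proof.
have [Qp|nQ] := pselect (strict_epi p); last by rewrite barrierN.
by rewrite barrierE// lee_fin.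
Qed.

(** By [barrier_fun_le], a sublevel inequality reads
    [expR (- t) <= slack p * (det X * det Y)]. The slack has no continuous extension
    to the boundary, but it is at most the continuous function [B p], by
    [phi_ge_tr]; with [B] instead, the inequality passes to the limit and shows
    that the determinants do not vanish. The limit point is thus in the region
    where the slack is continuous, and the original inequality passes to the
    limit as well. *)
Lemma epigraph_closed : closed (epigraph (DBS_barrier R n)).
Proof.
move=> [p t] cpt.
have epi (q : H2 * R^o) : epigraph (DBS_barrier R n) q -> strict_epi q.1 /\ barrier_fun q.1 <= q.2.
  exact: barrier_le_strict_epi.
have c1 (g : H2 -> R^o) : {for p, continuous g} ->
    {for (p, t), continuous (fun q : H2 * R^o => g q.1)}.
  move=> cg; apply: (@continuous_comp _ _ _ (fun q : H2 * R^o => q.1) g); first exact: cvg_fst.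
  exact: cg.
have ce : {for (p, t), continuous (fun q : H2 * R^o => expR (- q.2) : R^o)}.
  apply: (@continuous_comp _ _ _ (fun q : H2 * R^o => - q.2 : R^o) (@expR R)).
    by apply: cvgN; exact: cvg_snd.
  exact: continuous_expR.
have cp : closure (@strict_epi R n) p.
  move=> V Vp; have [q [/epi [Qq _] Vq]] := cpt _ (@cvg_fst _ _ (nbhs p) (nbhs t) _ V Vp).
  by exists q.1.
have [pX pY] := cQ_psd cp.
have e0 := expR_gt0 (- t).
have h1 : 0 <= B p * (dX p * dY p) - expR (- t).
  apply: (closure_ge0_at (f := fun q : H2 * R^o => B q.1 * (dX q.1 * dY q.1) - expR (- q.2) : R^o) _ _ cpt).
    by apply: cvgB ce; apply: cvgM (c1 _ (@cB p)) _; apply: cvgM; [exact: (c1 _ (@cdX p))|exact: (c1 _ (@cdY p))].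
  move=> q /epi [Qq]; rewrite (barrier_fun_le _ Qq) subr_ge0 => /le_trans; apply.
  have [[qX qY] _] := Qq.
  apply: ler_wpM2r; first by rewrite mulr_ge0 ?ltW//; exact: Re_det_gt0.
  rewrite /slack /B -addrA lerD2l lerNl opprD opprK.
  exact: (phi_ge_tr qX qY).
have hd : dX p * dY p != 0.
  apply/eqP => d0; move: h1; rewrite d0 mulr0 sub0r oppr_ge0 leNgt e0//.
move: hd; rewrite mulf_eq0 negb_or => /andP[hx hy].
have Up : pd_pair p by exact: (conj (psd_det_pd pX hx) (psd_det_pd pY hy)).
have cz := Ck_cont (@Ck_slack R n 0) Up.
have h2 : 0 <= slack p * (dX p * dY p) - expR (- t).
  apply: (closure_ge0_at (f := fun q : H2 * R^o => slack q.1 * (dX q.1 * dY q.1) - expR (- q.2) : R^o) _ _ cpt).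
    by apply: cvgB ce; apply: cvgM (c1 _ cz) _; apply: cvgM; [exact: (c1 _ (@cdX p))|exact: (c1 _ (@cdY p))].
  by move=> q /epi [Qq]; rewrite (barrier_fun_le _ Qq) subr_ge0.
have [dXp dYp] := Up.
have d0 : 0 < dX p * dY p by rewrite mulr_gt0//; exact: Re_det_gt0.
rewrite subr_ge0 in h2.
have z0 : 0 < slack p by rewrite -(pmulr_lgt0 _ d0) (lt_le_trans e0).
have Qp : strict_epi p by split=> //; rewrite -subr_gt0.
by rewrite /epigraph/= barrierE// lee_fin barrier_fun_le.
Qed.

Lemma barrier_self_concordant : self_concordant (DBS_barrier R n).
Proof.
have fine_bar p : strict_epi p -> barrier_fun p = fine (DBS_barrier R n p) by move=> /barrierE ->.
have oQ := @open_strict_epi R n.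
have CF : Ck 3 strict_epi (fun p : H2 => fine (DBS_barrier R n p) : R^o).
  by apply: Ck_eq (Ck_barrier_fun 3) => //; exact: fine_bar.
split.
- exact: barrier_convex.
- by rewrite dom_barrier.
- exact: epigraph_closed.
- by rewrite dom_barrier.
- move=> x h; rewrite dom_barrier => Qx.
  have E k : (k <= 3)%N -> Dk k (DBS_barrier R n) x h = iterD k h barrier_fun x.
    move=> k3; rewrite (@DkE _ _ k 3) ?dom_barrier//.
    by apply: (iterD_eq k h oQ) Qx => p /fine_bar.
  rewrite !E//; exact: (barrier_fun_D23 h Qx).2.
Qed.

Lemma barrier_sc : sc_barrier (epi_DBS R n) (DBS_barrier R n).
Proof.
split; first exact: barrier_self_concordant.
by rewrite dom_barrier epi_DBSE.
Qed.

End ScBarrier.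

(** * Optimality of the parameter *)

Section Optimal.
Context {R : realType} {n : nat}.
Local Notation C := R[i].
Local Notation Re := (@complex.Re R).
Local Notation H2 := (herm R n * herm R n * R^o)%type.
Local Notation cQ := (closure (@strict_epi R n)).
Local Notation I1 := (@herm1 R n).
Implicit Types (X Y : herm R n) (p x y : H2).

Fact unit_herm_subproof (i : 'I_n) :
  (rdiag (fun k => (k == i)%:R) : 'M[C]_n) \is hermsymmx.
Proof. by rewrite hermsymmxE adj_rdiag. Qed.

Definition unit_herm i : herm R n := Herm (unit_herm_subproof i).

Lemma unit_herm_psd i : psd (unit_herm i).
Proof.
apply/psdP => v; rewrite /= qf_rdiag; apply: sumr_ge0 => k _.
by rewrite mulr_ge0 ?nsq_ge0.
Qed.

Lemma unit_herm_tr i : Re (\tr (unit_herm i)) = 1.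
Proof.
rewrite /mxtrace Re_sum (bigD1 i)//= big1 ?addr0 => [|k ki].
  by rewrite rdiagE !eqxx.
by rewrite rdiagE eqxx (negbTE ki).
Qed.

Lemma sum_unit_herm : \sum_i unit_herm i = I1.
Proof.
apply/val_inj => /=.
have -> : hmx (\sum_i unit_herm i) = \sum_i hmx (unit_herm i).
  by elim/big_rec2: _ => // i A X _ <-.
apply/matrixP => j k; rewrite summxE mxE.
under eq_bigr do rewrite rdiagE.
have [_|_] := eqVneq j k; last by rewrite big1.
by rewrite (bigD1 k)//= eqxx big1 ?addr0// => i ik; rewrite eq_sym (negbTE ik).
Qed.

Lemma sub_unit_herm_npd i : ~ pd (I1 + (-1 : R) *: unit_herm i).
Proof.
move=> /pdP/(_ (@ecol R n i) (ecol_neq0 i)).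
rewrite /= qfD qfZ qf_rdiag_ecol eqxx -rdiag1 qf_rdiag_ecol mulr1 subrr.
by rewrite ltxx.
Qed.

Lemma cQ_recession p y (t : R) : cQ p -> strict_epi y -> 0 <= t -> strict_epi (y + t *: p).
Proof.
move=> cp Qy; rewrite le_eqVlt => /predU1P[<-|t0]; first by rewrite scale0r addr0.
by apply: strict_epiD_cQ => //; exact: cQZ.
Qed.

Lemma cQ_vertical : cQ ((0 : herm R n), (0 : herm R n), (1 : R^o)).
Proof.
have p0 : psd (0 : herm R n) by apply/psdP => v; rewrite /qf mulmx0 mul0mx mxE.
apply: (@closure_path _ _ _ _ (I1, I1, (0 : R^o))) => e e0.
rewrite tripleD !add0r mulr0 addr0; apply: (strict_epi_intro (pdZ e0 pd1) (pdZ e0 pd1)).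
have := @phi_scale R n e I1 I1 e0 pd1 pd1; rewrite phi_II mulr0 => E.
by rewrite -[X in phi X]/(e%:C *: hmx I1) -[X in phi _ X]/(e%:C *: hmx I1) E.
Qed.

Lemma sum_triple (I : Type) (r : seq I) (A B : I -> herm R n) (c : I -> R^o) :
  \sum_(i <- r) (A i, B i, c i) = (\sum_(i <- r) A i, \sum_(i <- r) B i, \sum_(i <- r) c i).
Proof. by elim: r => [|i r IH]; rewrite ?big_nil// !big_cons IH. Qed.

Lemma big_unit1 (V : nmodType) (F : unit -> V) : \sum_(k : unit) F k = F tt.
Proof. by rewrite (bigD1 tt)//= big1 ?addr0//; case. Qed.

(** Elements of the closure of the cone; the second group increases [Y] alone,
    the third one moves [X] and [Y] proportionally, at the cost [- ln d] in [z]. *)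
Definition dirs (d : R) (k : unit + ('I_n + 'I_n)) : H2 :=
  match k with
  | inl _ => (0, 0, 1)
  | inr (inl i) => (0, unit_herm i, 0)
  | inr (inr i) => (unit_herm i, d *: unit_herm i, - ln d)
  end.

(** The amounts that bring [(I, I, c / d)] to [(d I, d I, 1)] when
    [c = 1 - n (1 - d) ln d]. *)
Definition amount (d c : R) (k : unit + ('I_n + 'I_n)) : R :=
  match k with
  | inl _ => c / d - c
  | inr (inl _) => (1 - d) ^+ 2
  | inr (inr _) => 1 - d
  end.

(** How far one may go from [(I, I, c / d)] along minus each direction before
    leaving the domain. *)
Definition exit_time (d c : R) (k : unit + ('I_n + 'I_n)) : R :=
  if k is inl _ then c / d else 1.

Lemma dirs_cQ (d : R) k : 0 < d -> cQ (dirs d k).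
Proof.
move=> d0; case: k => [[]|[i|i]] /=.
- exact: cQ_vertical.
- exact: (cQ_right (unit_herm_psd i)).
- by have := cQ_proportional (unit_herm_psd i) d0; rewrite unit_herm_tr mul1r.
Qed.

(** [d] is kept positive because the bound requires the target point to be in
    the open domain. *)
Lemma optimal_delta (f : H2 -> \bar R) (nu d : R) :
  nu_sc_barrier nu (epi_DBS R n) f -> 0 < d -> d < 1 ->
  (1 - d) + n%:R * (1 - d) ^+ 2 + n%:R * (1 - d) <= nu.
Proof.
move=> Hf d0 d1.
have domf : dom f = strict_epi.
  apply: open_convex_closure_eq.
  - by case: Hf => [[[]]].
  - exact: open_strict_epi.
  - exact: barrier_dom_convex Hf.
  - by move=> x y t; exact: strict_epi_seg.
  - by rewrite -epi_DBSE; case: Hf => [[_ ->]].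
pose c : R := 1 + n%:R * ((1 - d) * - ln d).
have c0 : 0 < c.
  by rewrite ltr_wpDr// mulr_ge0// mulr_ge0 ?subr_ge0 ?(ltW d1)// oppr_ge0 ln_le0// ltW.
have cd : c < c / d by rewrite ltr_pdivlMr// gtr_pMr.
pose x : H2 := (I1, I1, (c / d : R^o)).
have Qx : strict_epi x by apply: strict_epi_II; rewrite divr_gt0.
have dt0 : 0 <= 1 - d by rewrite subr_ge0 ltW.
have := @barrier_parameter_ge R H2 f _ nu Hf _ (index_enum (unit + ('I_n + 'I_n))%type)
  (dirs d) (amount d c) (exit_time d c) x.
rewrite domf => main.
have target : x - \sum_k amount d c k *: dirs d k = (d *: I1, d *: I1, (1 : R^o)).
  rewrite big_sumType big_sumType big_unit1 -!scaler_sumr /=.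
  rewrite !sum_triple -!scaler_sumr sum_unit_herm !big1_eq sumr_const card_ord.
  transitivity (I1 - ((c / d - c) *: 0 + ((1 - d) ^+ 2 *: 0 + (1 - d) *: I1)),
    I1 - ((c / d - c) *: 0 + ((1 - d) ^+ 2 *: I1 + (1 - d) *: (d *: I1))),
    (c / d - ((c / d - c) * 1 + ((1 - d) ^+ 2 * 0 + (1 - d) * (- ln d *+ n)))) : R^o) => //.
  have E1 (a b : R) : 1 - a = b -> I1 - a *: I1 = b *: I1.
    by move=> <-; rewrite scalerBl scale1r.
  congr (_, _, _).
  - by rewrite !scaler0 !add0r; apply: E1; ring.
  - by rewrite scaler0 add0r scalerA -scalerDl; apply: E1; ring.
  - by rewrite /c -mulr_natl; ring.
have sumE : \sum_k amount d c k / exit_time d c k = (1 - d) + n%:R * (1 - d) ^+ 2 + n%:R * (1 - d).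
  rewrite big_sumType big_sumType /=.
  have s1 (a : R) : \sum_(i < n) a / 1 = n%:R * a.
    by rewrite divr1 sumr_const card_ord mulr_natl.
  rewrite big_unit1 !s1 addrA; congr (_ + _ + _).
  by rewrite mulrBl divff ?gt_eqF ?divr_gt0// invf_div mulrCA divff ?gt_eqF// mulr1.
rewrite -sumE; apply: main => //.
  rewrite target; apply: (strict_epi_intro (pdZ d0 pd1) (pdZ d0 pd1)).
  have := @phi_scale R n d I1 I1 d0 pd1 pd1; rewrite phi_II mulr0 => E.
  by rewrite -[X in phi X]/(d%:C *: hmx I1) -[X in phi _ X]/(d%:C *: hmx I1) E.
move=> k; split.
- by move=> y t; rewrite /= domf => Qy t0; apply: cQ_recession => //; exact: dirs_cQ.
- case: k => [[]|[i|i]] /=; first by rewrite subr_ge0 ltW.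
    exact: sqr_ge0.
  exact: dt0.
- by case: k => [[]|[i|i]] //=; rewrite divr_gt0.
- case: k => [[]|[i|i]] /=.
  + rewrite /x -scaleN1r scalerA mulN1r tripleD.
    rewrite !scaler0 !addr0 mulr1 subrr => -[_].
    by rewrite /phi2 /= phi_II ltxx.
  + by rewrite /x -scaleN1r scalerA mulr1 tripleD => -[[_ h] _]; exact: (sub_unit_herm_npd h).
  + by rewrite /x -scaleN1r scalerA mulr1 tripleD => -[[h _] _]; exact: (sub_unit_herm_npd h).
Qed.

Lemma optimal (f : H2 -> \bar R) (nu : R) :
  nu_sc_barrier nu (epi_DBS R n) f -> (2 * n + 1)%:R <= nu.
Proof.
move=> Hf; apply/ler_addgt0Pr => e e0.
pose m : R := 1 + 3 * n%:R; have m0 : 0 < m by rewrite ltr_pwDl// mulr_ge0.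
pose d := e / (e + m).
have em : 0 < e + m by rewrite addr_gt0.
have d0 : 0 < d by rewrite divr_gt0.
have d1 : d < 1 by rewrite ltr_pdivrMr// mul1r ltrDl.
have dm : d * m <= e.
  by rewrite /d mulrAC ler_pdivrMr// ler_wpM2l ?(ltW e0)// lerDr ltW.
have h := optimal_delta Hf d0 d1.
apply: (@le_trans _ _ ((1 - d) + n%:R * (1 - d) ^+ 2 + n%:R * (1 - d) + d * m)); last exact: lerD.
rewrite -subr_ge0.
have -> : (1 - d) + n%:R * (1 - d) ^+ 2 + n%:R * (1 - d) + d * m - (2 * n + 1)%:R = n%:R * d ^+ 2.
  by rewrite /m natrD natrM; ring.
by rewrite mulr_ge0 ?sqr_ge0.
Qed.

End Optimal.

Theorem corollary1p3 (R : realType) (n : nat) :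
  [/\ closed (epi_DBS R n),
      convex_set (epi_DBS R n : set (convex_lmodType _)),
      sc_barrier (epi_DBS R n) (DBS_barrier R n),
      log_homogeneous (2 * n + 1)%:R (DBS_barrier R n) &
      forall (f : herm R n * herm R n * R^o -> \bar R) (nu : R),
        nu_sc_barrier nu (epi_DBS R n) f -> (2 * n + 1)%:R <= nu].
Proof.
split.
- exact: epi_closed.
- exact: epi_convex.
- exact: barrier_sc.
- exact: barrier_loghom.
- by move=> f nu; exact: optimal.
Qed.
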